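(* Let $Y$ be the bounded strong solution of the call-side obstacle problem, and suppose that $$qk_1\ge r(K_1+k_1-K_2).$$ Then $s\mapsto Y(\ln s,\tau)$ is convex on $(0,k_1)$ for every $\tau\in[0,T]$. Equivalently, $$\partial_{xx}Y-\partial_xY\ge0\qquad\text{almost everywhere in }(-\infty,\ln k_1)\times(0,T].$$
   Context: Constants: $0<K_1<k_1<k_2<K_2$, $\sigma>0$, $r>0$, $q\ge0$, $T>0$. Put $\mathcal Lu:=\frac{\sigma^2}{2}\partial_{xx}u+\left(r-q-\frac{\sigma^2}{2}\right)\partial_xu-ru$ and $\psi_1(x):=(e^x-K_1)^++K_2-k_1$. Let $Q=(-\infty,\ln k_1)\times(0,T]$. For $1<p<\infty$, $\mathcal W_p(Q)$ is the set of $u\in C((-\infty,\ln k_1]\times[0,T])$ such that, for all $R,\rho>0$, $u,\partial_xu,\partial_{xx}u,\partial_\tau u$ (weak derivatives) belong to $L^p$ of $\left(((-\infty,\ln k_1)\cap(-R,R))\times(0,T)\right)\setminus B_\rho(\ln K_1,0)$, where $B_\rho$ denotes an open disc of radius $\rho$. A strong solution of the call-side obstacle problem is a function $Y\in\mathcal W_p(Q)$ with $Y\ge\psi_1$ in $Q$, $\partial_\tau Y-\mathcal LY\ge0$ almost everywhere in $Q$, $\partial_\tau Y-\mathcal LY=0$ almost everywhere on $\{Y>\psi_1\}$, $Y(x,0)=\psi_1(x)$ for $x<\ln k_1$, and $Y(\ln k_1,\tau)=K_2-K_1$ for $\tau\in[0,T]$. For every $1<p<\infty$ there is exactly one bounded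 strong solution, and it does not depend on $p$. *)

(* Defs.v *)
From HB Require Import structures.
From mathcomp Require Import all_boot all_order all_algebra.
From mathcomp Require Import all_classical all_reals all_analysis.

Set Implicit Arguments.
Unset Strict Implicit.
Unset Printing Implicit Defensive.
Import Order.TTheory GRing.Theory Num.Theory.
Import numFieldNormedType.Exports.

Local Open Scope classical_set_scope.
Local Open Scope ring_scope.

(* Points of the plane are pairs z = (x, tau) : R * R. *)

Definition leb2 (R : realType) := (@lebesgue_measure R \x @lebesgue_measure R)%E.

Section WeakDerivatives.
Variable R : realType.
Implicit Types (f u g phi : R * R -> R) (Om D : set (R * R)).

Definition pderx f : R * R -> R := fun z => derive1 (fun x => f (x, z.2)) z.1.
Definition pdert f : R * R -> R := fun z => derive1 (fun t => f (z.1, t)) z.2.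

Fixpoint Cn (n : nat) f : Prop :=
  match n with
  | 0 => continuous f
  | m.+1 => [/\ continuous f,
      (forall z, derivable (fun x => f (x, z.2)) z.1 1),
      (forall z, derivable (fun t => f (z.1, t)) z.2 1),
      Cn m (pderx f) & Cn m (pdert f)]
  end.

Definition Csmooth f := forall n, Cn n f.

Definition test_function Om phi :=
  [/\ Csmooth phi, compact (closure [set z | phi z != 0]) &
      closure [set z | phi z != 0] `<=` Om].

Definition loc_integrable Om f :=
  forall K, compact K -> K `<=` Om -> (@leb2 R).-integrable K (EFin \o f).

Definition is_weak_derivative Om (i j : nat) u g :=
  [/\ loc_integrable Om u, loc_integrable Om g &
      forall phi, test_function Om phi ->
        \int[@leb2 R]_(z in Om) (u z * iter i pderx (iter j pdert phi) z) =
        (- 1) ^+ (i + j) * \int[@leb2 R]_(z in Om) (g z * phi z)].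

(* A representative of the weak derivative, which is unique up to null sets.
   It is the junk value 0 when there is no weak derivative. *)
Definition weak_derivative Om (i j : nat) u : R * R -> R :=
  xget (cst 0) [set g | is_weak_derivative Om i j u g].

Definition has_weak_derivative Om (i j : nat) u :=
  exists g, is_weak_derivative Om i j u g.

Definition Lp_on D (p : R) f := f \_ D \in Lfun (@leb2 R) p%:E.

End WeakDerivatives.

Section ObstacleProblem.
Variables (R : realType) (K1 k1 K2 sigma r q T : R).
Implicit Types (Y : R * R -> R) (p : R).

Definition Qdom : set (R * R) := `]-oo, ln k1[ `*` `]0, T].

(* Weak derivatives are tested on the interior of Qdom; the top side
   tau = T is a null set. *)
Definition Qint : set (R * R) := `]-oo, ln k1[ `*` `]0, T[.

Definition Qbar : set (R * R) := `]-oo, ln k1] `*` `[0, T].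

(* The products of R carry the sup norm, so the Euclidean disc is explicit. *)
Definition disc (c : R * R) (rho : R) : set (R * R) :=
  [set z | (z.1 - c.1) ^+ 2 + (z.2 - c.2) ^+ 2 < rho ^+ 2].

Definition Qcut (M rho : R) : set (R * R) :=
  ((`]-oo, ln k1[ `&` `]- M, M[) `*` `]0, T[) `\` disc (ln K1, 0) rho.

Definition Dx Y := weak_derivative Qint 1 0 Y.
Definition Dxx Y := weak_derivative Qint 2 0 Y.
Definition Dt Y := weak_derivative Qint 0 1 Y.

Definition Wp p Y :=
  [/\ {within Qbar, continuous Y},
      [/\ has_weak_derivative Qint 1 0 Y, has_weak_derivative Qint 2 0 Y &
          has_weak_derivative Qint 0 1 Y] &
      forall M rho, 0 < M -> 0 < rho ->
        [/\ Lp_on (Qcut M rho) p Y, Lp_on (Qcut M rho) p (Dx Y),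
            Lp_on (Qcut M rho) p (Dxx Y) & Lp_on (Qcut M rho) p (Dt Y)]].

Definition Lop Y : R * R -> R := fun z =>
  sigma ^+ 2 / 2 * Dxx Y z + (r - q - sigma ^+ 2 / 2) * Dx Y z - r * Y z.

Definition psi1 (x : R) : R := Num.max (expR x - K1) 0 + K2 - k1.

Definition strong_solution p Y :=
  Wp p Y /\
  [/\ forall z, Qdom z -> psi1 z.1 <= Y z,
      {ae @leb2 R, forall z, Qdom z -> 0 <= Dt Y z - Lop Y z},
      {ae @leb2 R, forall z, Qdom z -> psi1 z.1 < Y z -> Dt Y z - Lop Y z = 0},
      forall x, x < ln k1 -> Y (x, 0) = psi1 x &
      forall tau, 0 <= tau <= T -> Y (ln k1, tau) = K2 - K1].

Definition bounded_strong_solution p Y :=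
  strong_solution p Y /\ [bounded Y z | z in Qdom].

End ObstacleProblem.

(* Main.v *)
(**
Mollifying [Y] on a rectangle inside the domain turns the weak inequalities
into classical ones: the mollified function is uniformly close to [Y], is a
supersolution, and is a subsolution wherever [Y] exceeds [psi1] by a margin.
Maximum principles are tested on it.

Convexity in [s] amounts to [D >= 0] for
[D(x,t) = lam Y(x+a,t) + (1-lam) Y(x-b,t) - Y(x,t)] with
[lam e^a + (1-lam) e^{-b} = 1]. In the variable [x] the shifts [a, b] are
constant, so [D] can be compared with 0 by the parabolic minimum principle:
where [Y = psi1], [D >= 0] because [psi1] is convex in [s]; elsewhere [D] is a
supersolution. The lateral boundary of [x <= ln k1 - a] is the line
[x + a = ln k1], where [D >= 0] says that [Y] lies below the chord ending at
[s = k1]. This is a two-point minimum principle for such chords, and the only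
place where [q k1 >= r (K1 + k1 - K2)] enters.

For the almost everywhere statement, [D >= 0] with [a = b] is preserved by
mollification and gives [v_xx - v_x >= 0] for the mollified function [v]. Hence
the mollified [Dxx - Dx] is nonnegative at every scale, and Lebesgue's
differentiation theorem on slices concludes.
*)

Require Import Defs.
From HB Require Import structures.
From mathcomp Require Import all_boot all_order all_algebra.
From mathcomp Require Import all_classical all_reals all_analysis.
From mathcomp Require Import measurable_realfun ring lra.

Import Order.TTheory GRing.Theory Num.Theory.
Import numFieldNormedType.Exports.

Local Open Scope classical_set_scope.
Local Open Scope ring_scope.
Set Implicit Arguments.
Unset Strict Implicit.
Unset Printing Implicit Defensive.

(** * Minimum principles *)

(** The hypothesis on [q] is a statement about lines. For the line [u = C - g (k1 - s)] through the
    end point, with [C = K2 - K1], one has [- L u = r (C - g k1) + q g s]. At [s = k1] this equals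
    [(1 - g) r C + g (r C + q k1 - r k1)], so it is nonnegative for all [0 <= g <= 1] as soon as
    [r (K1 + k1 - K2) <= q k1]. The bounds on [g] come from [Y <= C] and from the obstacle lying
    above the line of slope 1 through the end point. Two obstacles shape the estimates. The domain
    is unbounded, so a linear barrier has to confine the minima. Mollification needs room around
    each point, so the approximants never reach the parabolic boundary, where the data are known;
    uniform continuity of [Y] carries the sign across the gap. Each argument by contradiction
    therefore fixes a negative value and divides it between the barrier, the approximation error and
    the modulus of continuity. *)

Lemma is_derive_eps (R : realType) (f : R -> R) (c d : R) :
  is_derive c 1 f d -> forall e, 0 < e -> exists2 del, 0 < del &
    forall h, `|h| < del -> `|f (c + h) - f c - h * d| <= e * `|h|.
Proof.
move=> [df fd] e e0; move: df; rewrite /derivable => /cvg_ex[l hl].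
have ld : l = d by rewrite -fd; apply/esym/cvg_lim.
subst l.
move/cvgrPdist_le : hl => /(_ e e0) /nbhs_ballP[del /= del0 H].
exists del => // h hdel.
have [->|h0] := eqVneq h 0.
  by rewrite addr0 subrr mul0r subrr normr0 mulr0.
have := H h; rewrite /ball /= sub0r normrN => /(_ hdel h0) H'.
have -> : f (c + h) - f c - h * d = - ((d - h^-1 *: (f (h *: 1 + c) - f c)) * h).
  rewrite /GRing.scale/= mulr1 (addrC h c).
  by field.
by rewrite normrN normrM ler_wpM2r.
Qed.

Lemma derive_at_last_min (R : realType) (f : R -> R) (a c d : R) :
  a < c -> is_derive c 1 f d -> (forall t, a <= t <= c -> f c <= f t) -> d <= 0.
Proof.
move=> ac /is_derive_eps dfc fmin; rewrite leNgt; apply/negP => d0.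
have [|del del0 H] := dfc (d / 2); first by rewrite divr_gt0.
pose h := Num.min (del / 2) (c - a).
have h0 : 0 < h by rewrite lt_min divr_gt0//= subr_gt0.
have hdel : `|- h| < del.
  by rewrite normrN gtr0_norm// gt_min ltr_pdivrMr// ltr_pMr ?ltr1n.
have hca : h <= c - a by rewrite ge_min lexx orbT.
have := H _ hdel; rewrite normrN (gtr0_norm h0) ler_norml => /andP[_].
have : f c <= f (c - h) by apply: fmin; lra.
move=> ? ?; have : h * d <= d / 2 * h by lra.
have : 0 < d * h by rewrite mulr_gt0.
lra.
Qed.

(** If [d < 0], then [g], which vanishes at [c], is negative just to the right of [c], and the mean
    value theorem makes [f] drop below [f c]. *)
Lemma second_derivative_at_min (R : realType) (f g : R -> R) (a b c d : R) :
  a < c < b -> (forall x : R, is_derive x 1 f (g x)) -> is_derive c 1 g d ->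
  (forall t, a <= t <= b -> f c <= f t) -> g c = 0 /\ 0 <= d.
Proof.
move=> /andP[ac cb] fg gd fmin.
have gc : g c = 0.
  have H : is_derive c 1 f 0.
    apply: (@derive1_at_min _ f a b) => //.
    - exact/ltW/(lt_trans ac).
    - by rewrite in_itv/= ac cb.
    - by move=> t; rewrite in_itv/= => /andP[? ?]; apply: fmin; rewrite !ltW.
  by have := @derive_val _ _ _ _ _ _ _ (fg c); rewrite (@derive_val _ _ _ _ _ _ _ H).
split => //; rewrite leNgt; apply/negP => d0.
have [|del del0 H] := is_derive_eps gd (e := - d / 2); first by lra.
pose h := Num.min (del / 2) (b - c).
have h0 : 0 < h by rewrite lt_min divr_gt0//= subr_gt0.
have hdel : h < del by rewrite gt_min ltr_pdivrMr// ltr_pMr ?ltr1n.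
have hcb : h <= b - c by rewrite ge_min lexx orbT.
have [||k /[!in_itv]/= /andP[ck kh] fE] := @MVT _ f g c (c + h).
- by rewrite ltrDl.
- apply: continuous_subspaceT => x; apply: differentiable_continuous.
  exact/derivable1_diffP/ex_derive.
have : f c <= f (c + h) by apply: fmin; lra.
rewrite -subr_ge0 fE addrC addKr pmulr_lge0// => gk.
have := H (k - c); rewrite (gtr0_norm (_ : 0 < k - c)) ?subr_gt0//.
have kdel : k - c < del by lra.
move=> /(_ kdel); rewrite subrKC gc subr0 ler_norml => /andP[_].
have : 0 < (k - c) * - d by apply: mulr_gt0; lra.
lra.
Qed.

Definition unif_cont_rect (R : realType) (xa xb ta tb : R) (w : R -> R -> R) :=
  forall e : R, 0 < e -> exists2 del : R, 0 < del & forall x x' t t' : R,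
    xa <= x <= xb -> xa <= x' <= xb -> ta <= t <= tb -> ta <= t' <= tb ->
    `|x - x'| <= del -> `|t - t'| <= del -> `|w x t - w x' t'| <= e.

(** Joint continuity of [v] makes minima over compact rectangles attained; the derivatives are then
    read off pointwise at the minimum. *)
Definition C21 (R : realType) (v vx vxx vt : R -> R -> R) :=
  continuous (fun z : R * R => v z.1 z.2) /\
  forall x t : R, [/\ is_derive x 1 (v^~ t) (vx x t),
    is_derive x 1 (vx^~ t) (vxx x t) & is_derive t 1 (v x) (vt x t)].

Lemma compact_rect (R : realType) (xa xb ta tb : R) :
  compact (`[xa, xb] `*` `[ta, tb] : set (R * R)).
Proof. by apply: compact_setX; exact: segment_compact. Qed.

(** The operator [- s2 dxx - b dx + r] sends [A - x] to [b + r * (A - x)]. With [A] large, [A - x]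
    is thus a positive supersolution on the half-line, and it tends to infinity at its left end. *)
Lemma linear_barrier (R : realType) (b r xb : R) : 0 < r ->
  exists A, forall x, x <= xb -> 1 <= A - x /\ 0 <= b + r * (A - x).
Proof.
move=> r0; exists (xb + 1 + `|b| / r) => x xxb.
have b0 : 0 <= `|b| / r by rewrite divr_ge0// ltW.
split; first lra.
have -> : b + r * (xb + 1 + `|b| / r - x) = (b + `|b|) + r * (xb + 1 - x).
  by field; rewrite gt_eqF.
have : 0 <= r * (xb + 1 - x) by apply: mulr_ge0; lra.
have : - `|b| <= b by rewrite lerNl -normrN ler_norm.
lra.
Qed.

Lemma is_derive_add_linear (R : realType) (f : R -> R) (x d e A : R) :
  is_derive x 1 f d -> is_derive x 1 (fun y => f y + e * (A - y)) (d - e).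
Proof.
move=> fd; have : is_derive x 1 (fun y : R => e * (A - y)) (- e).
  apply: is_derive_eq; rewrite /GRing.scale/=.
  by rewrite add0r mul1r mulrN1.
by move=> ?; exact: is_deriveD.
Qed.

(** At the minimum [vx = eps], [vxx >= 0] and [vt <= 0]. The zeroth order term with [r > 0] then
    turns the differential inequality into a lower bound on the value itself. *)
Lemma supersolution_at_min (R : realType) (s2 b r eps A xa xb t0 x t : R)
    (v vx vxx vt : R -> R -> R) :
  0 <= s2 -> 0 < r -> 0 <= eps -> 0 <= b + r * (A - x) -> C21 v vx vxx vt ->
  xa < x < xb -> t0 < t ->
  (forall y, xa <= y <= xb -> v x t + eps * (A - x) <= v y t + eps * (A - y)) ->
  (forall y, t0 <= y <= t -> v x t <= v x y) ->
  0 <= vt x t - s2 * vxx x t - b * vx x t + r * v x t ->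
  0 <= v x t + eps * (A - x).
Proof.
move=> s20 r0 eps0 bA [cv dv] xI t0t minx mint vsup.
have [vx0 vxx0] : vx x t - eps = 0 /\ 0 <= vxx x t.
  apply: (@second_derivative_at_min _ (fun y => v y t + eps * (A - y))
    (fun y => vx y t - eps) xa xb x (vxx x t)) => //.
  - by move=> y; have [dy _ _] := dv y t; exact: is_derive_add_linear.
  - have [_ dxx _] := dv x t.
    by rewrite -[X in is_derive _ _ _ X]subr0; exact: is_deriveB.
have vt0 : vt x t <= 0.
  by have [_ _ ?] := dv x t; apply: (@derive_at_last_min _ (v x) t0 t).
have h1 : 0 <= s2 * vxx x t by rewrite mulr_ge0.
have h2 : 0 <= eps * (b + r * (A - x)) by rewrite mulr_ge0.
rewrite -(pmulr_rge0 _ r0).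
have vxE : vx x t = eps by apply/eqP; rewrite -subr_eq0 vx0.
rewrite vxE in vsup; clear -vsup vt0 h1 h2; lra.
Qed.

(** The differential inequality is asked only where [w <= - (3 * c)], which leaves room for the
    contact set: clearly negative values of the functions tested below force [Y] above the obstacle
    by a margin. *)
Lemma weak_minimum_principle (R : realType) (s2 b r xb T0 M : R)
    (w : R -> R -> R) :
  0 <= s2 -> 0 < r -> 0 < T0 ->
  (forall x t : R, x <= xb -> 0 <= t <= T0 -> - M <= w x t) ->
  (forall xa, unif_cont_rect xa xb 0 T0 w) ->
  (forall x, x <= xb -> 0 <= w x 0) ->
  (forall t : R, 0 <= t <= T0 -> 0 <= w xb t) ->
  (forall xa xb' t0 c : R, xa < xb' < xb -> 0 < t0 <= T0 -> 0 < c ->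
    exists v vx vxx vt, C21 v vx vxx vt /\
    forall x t : R, xa <= x <= xb' -> t0 <= t <= T0 -> `|v x t - w x t| <= c /\
      (w x t <= - (3 * c) ->
        0 <= vt x t - s2 * vxx x t - b * vx x t + r * v x t)) ->
  forall x, x <= xb -> 0 <= w x T0.
Proof.
move=> s20 r0 T00 wM ucw w0 wb wapprox x1 x1b; rewrite leNgt; apply/negP => wx1.
have x1xb : x1 < xb.
  rewrite lt_neqAle x1b andbT; apply/eqP => E; move: wx1; rewrite E.
  by rewrite ltNge wb// lexx ltW.
have [A hA] := linear_barrier b xb r0.
(* Half of the value [- 2m] is spent on the barrier, which leaves [- m]. With approximation error
   [m / 8], the minimum of [V] is at most [- 7m / 8] and [w] plus barrier is at most [- 3m / 4]
   there, beyond both the modulus [m / 4] and the threshold [3m / 8]. *)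
have [m wm m0] : exists2 m : R, w x1 T0 = - (2 * m) & 0 < m.
  by exists (- w x1 T0 / 2); [field|clear -wx1; lra].
have [th1 _] := hA _ x1b.
have [eps eps0 epsE] : exists2 eps : R, 0 < eps & eps * (A - x1) = m.
  have h : 0 < A - x1 by clear -th1; lra.
  by exists (m / (A - x1)); [exact: divr_gt0|field; rewrite gt_eqF].
have [xa xax1 xaM] : exists2 xa : R, xa < x1 & M <= eps * (A - xa).
  exists (Num.min (x1 - 1) (A - M / eps)).
    by rewrite gt_min; apply/orP; left; clear; lra.
  rewrite -ler_pdivrMl// lerBrDl -lerBrDr ge_min mulrC.
  by rewrite lexx orbT.
have [|del del0 uc] := ucw xa (m / 4); first by rewrite divr_gt0.
(* Approximants live only on rectangles away from [xb] and from time 0. The gaps [xb - xb'] and [t0]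
   are at most [del], so on these sides [w >= - m / 4]. *)
have [xb' /andP[xb'1 xb'b] xb'del] :
    exists2 xb' : R, x1 < xb' < xb & xb - del <= xb'.
  exists (Num.max (xb - del) ((x1 + xb) / 2)); last by rewrite le_max lexx.
  rewrite gt_max lt_max; apply/andP; split.
    by apply/orP; right; clear -x1xb; lra.
  by apply/andP; split; clear -x1xb del0; lra.
have [t0 /andP[t00 t0T] t0del] : exists2 t0 : R, 0 < t0 < T0 & t0 <= del.
  exists (Num.min del (T0 / 2)); last by rewrite ge_min lexx.
  by rewrite lt_min del0 divr_gt0//= gt_min; apply/orP; right; clear -T00; lra.
have [||| v [vx [vxx [vt [C21v hv]]]]] := wapprox xa xb' t0 (m / 8).
- by rewrite (lt_trans xax1).
- by rewrite t00 ltW.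
- by rewrite divr_gt0.
pose V (z : R * R) := v z.1 z.2 + eps * (A - z.1).
have cV : continuous V.
  have [cv _] := C21v.
  move=> z; apply: cvgD; first exact: cv.
  by apply: cvgMr; apply: cvgB; [exact: cvg_cst|exact: cvg_fst].
have x1I : xa <= x1 <= xb' by rewrite !ltW.
have TI : t0 <= T0 <= T0 by rewrite lexx ltW.
have [||[x t] /[!inE] -[/=]] :=
    @compact_EVT_min _ R V _ _ (@compact_rect R xa xb' t0 T0).
- by exists (x1, T0); split; rewrite /= in_itv.
- exact: continuous_subspaceT.
rewrite !in_itv/= => xI tI Vmin.
have {}Vmin x' t' : xa <= x' <= xb' -> t0 <= t' <= T0 -> V (x, t) <= V (x', t').
  by move=> ? ?; apply: Vmin; rewrite inE; split; rewrite /= in_itv.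
have [vwxt vsup] := hv x t xI tI.
have Vneg : V (x, t) <= - (m * 7 / 8).
  have [vwx1 _] := hv x1 T0 x1I TI.
  have := Vmin _ _ x1I TI.
  move: vwx1; rewrite {2}/V/= epsE wm ler_norml => /andP[_].
  by clear; lra.
have wneg : w x t + eps * (A - x) <= - (m * 3 / 4).
  by move: vwxt Vneg; rewrite /V/= ler_norml => /andP[]; clear; lra.
have xxb : x <= xb by clear -xI xb'b; lra.
have tI0 : 0 <= t <= T0 by clear -tI t00; lra.
have [thx bthx] := hA _ xxb.
have epsth : 0 <= eps * (A - x).
  by rewrite mulr_ge0//; [exact: ltW|exact: le_trans thx].
have xaxb : xa <= x <= xb by clear -xI xxb; lra.
have TI0 : (0 : R) <= 0 <= T0 by apply/andP; split => //; exact: ltW.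
have xbI : xa <= xb <= xb by rewrite lexx (le_trans _ xxb)//; clear -xI; lra.
have xax : xa < x.
  rewrite lt_neqAle (andP xI).1 andbT; apply/eqP => E.
  have := wM x t xxb tI0; rewrite -E in wneg * => H.
  by clear -H wneg xaM m0; lra.
have xxb' : x < xb'.
  rewrite lt_neqAle (andP xI).2 andbT; apply/eqP => E.
  have : `|w x t - w xb t| <= m / 4.
    apply: uc => //; last by rewrite subrr normr0 ltW.
    by rewrite distrC ger0_norm ?subr_ge0// E; clear -xb'del; lra.
  have := wb _ tI0; rewrite ler_norml => H /andP[+ _].
  by clear -H wneg epsth m0; lra.
have t0t : t0 < t.
  rewrite lt_neqAle (andP tI).1 andbT; apply/eqP => E.
  have : `|w x t - w x 0| <= m / 4.
    apply: uc => //; first by rewrite subrr normr0 ltW.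
    by rewrite subr0 -E gtr0_norm.
  have := w0 _ xxb; rewrite ler_norml => H /andP[+ _].
  by clear -H wneg epsth m0; lra.
suff : 0 <= V (x, t) by rewrite leNgt; clear -Vneg m0; lra.
apply: (@supersolution_at_min _ s2 b r eps A xa xb' t0 x t v vx vxx vt) => //.
- exact: ltW.
- by rewrite xax.
- by move=> y yI; exact: Vmin.
- move=> y /andP[y0 yt]; rewrite -(lerD2r (eps * (A - x))).
  by apply: Vmin => //; rewrite y0 (le_trans yt (andP tI).2).
- by apply: vsup; clear -wneg epsth m0; lra.
Qed.

(** * Two-point minimum principle for chords ending on the lateral boundary *)

Lemma is_derive_comb_exp (R : realType) (f : R -> R) (x d g k c : R) :
  is_derive x 1 f d -> is_derive x 1 (fun y => f y + g * (k - c * expR y)) (d - g * c * expR x).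
Proof.
move=> fd; have : is_derive x 1 (fun y : R => g * (k - c * expR y)) (- (g * c * expR x)).
  by apply: is_derive_eq; rewrite /GRing.scale/=; ring.
by move=> ?; exact: is_deriveD.
Qed.

(* [v x1 + eps (A - x1) - C + g (k1 - expR x1)] with [g] the slope of the chord
   from [x] to the end point is minimal at the pair [x1 < x]; because [g] is
   stationary in [x], the first and second order conditions at [x1] and at [x]
   decouple. The term in [eps] makes the infimum attained. *)
Lemma two_point_at_min (R : realType)
    (s2 b r q C eta eps A k1 g rho xa xb t0 x1 x t : R)
    (v vx vxx vt : R -> R -> R) :
  0 <= s2 -> 0 < r -> 0 <= eta -> 0 <= eps -> b = r - q - s2 ->
  0 <= C -> r * k1 <= r * C + q * k1 ->
  0 <= g <= 1 -> C21 v vx vxx vt ->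
  xa < x1 < x -> x < xb -> t0 < t -> expR x < k1 ->
  0 <= b + r * (A - x1) ->
  rho * (k1 - expR x) = k1 - expR x1 ->
  v x t = C + eta - g * (k1 - expR x) ->
  (forall y, xa <= y <= x -> v x1 t + eps * (A - x1) + g * (k1 - expR x1) <=
     v y t + eps * (A - y) + g * (k1 - expR y)) ->
  (forall y, x1 <= y <= xb -> 0 <= C + eta - v y t - g * (k1 - expR y)) ->
  (forall y, t0 <= y <= t -> v x1 t - rho * v x t <= v x1 y - rho * v x y) ->
  0 <= vt x1 t - s2 * vxx x1 t - b * vx x1 t + r * v x1 t ->
  vt x t - s2 * vxx x t - b * vx x t + r * v x t <= 0 ->
  0 <= v x1 t + eps * (A - x1) - C + g * (k1 - expR x1).
Proof.
move=> s20 r0 eta0 eps0 bE C0 hk /andP[g0 g1] [cv dv] x1I xxb t0t xk bA rhoE vE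
  min1 min2 mint vsup vsub.
have [vx1 vxx1] : vx x1 t - eps - g * expR x1 = 0 /\
    0 <= vxx x1 t - g * expR x1.
  rewrite -[X in vxx _ _ - X * _]mulr1 -[X in _ - X * expR _ = _]mulr1.
  apply: (@second_derivative_at_min _
    (fun y => v y t + eps * (A - y) + g * (k1 - 1 * expR y))
    (fun y => vx y t - eps - g * 1 * expR y) xa x x1
    (vxx x1 t - g * 1 * expR x1)) => //.
  - move=> y; have [dy _ _] := dv y t.
    by apply: is_derive_comb_exp; exact: is_derive_add_linear.
  - have [_ dxx _] := dv x1 t.
    have := @is_derive_comb_exp _ (fun y => vx y t - eps) x1 (vxx x1 t) g 0 1.
    have -> : (fun y => vx y t - eps + g * (0 - 1 * expR y)) =
              (fun y => vx y t - eps - g * 1 * expR y).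
      by apply/funext => y; ring.
    by apply; rewrite -[X in is_derive _ _ _ X]subr0; exact: is_deriveB.
  - by move=> y yI; rewrite !mul1r; exact: min1.
have [vx2 vxx2] : - vx x t - - g * expR x = 0 /\ 0 <= - vxx x t - - g * expR x.
  rewrite -[X in - vxx _ _ - X * _]mulr1 -[X in _ - X * expR _ = _]mulr1.
  apply: (@second_derivative_at_min _
    (fun y => - v y t + - g * (k1 - 1 * expR y))
    (fun y => - vx y t - - g * 1 * expR y) x1 xb x
    (- vxx x t - - g * 1 * expR x)) => //.
  - by rewrite (andP x1I).2.
  - move=> y; have [dy _ _] := dv y t.
    by apply: is_derive_comb_exp; exact: is_deriveN.
  - have [_ dxx _] := dv x t.
    have := @is_derive_comb_exp _ (fun y => - vx y t) x (- vxx x t) (- g) 0 1.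
    have -> : (fun y => - vx y t + - g * (0 - 1 * expR y)) =
              (fun y => - vx y t - - g * 1 * expR y).
      by apply/funext => y; ring.
    by apply; exact: is_deriveN.
  - move=> y yI; have := min2 y yI; rewrite !mul1r vE; clear; lra.
(* For fixed [x1] and [x], the height over the chord depends on time through [v x1 - rho * v x]
   only, up to a constant. *)
have vt0 : vt x1 t - rho * vt x t <= 0.
  apply: (@derive_at_last_min _ (fun y => v x1 y - rho * v x y) t0 t) => //.
  have [_ _ ?] := dv x t; have [_ _ ?] := dv x1 t.
  by apply: is_deriveB; exact: is_deriveZ.
have rho1 : 1 <= rho.
  have : 0 <= (rho - 1) * (k1 - expR x).
    have : expR x1 < expR x by rewrite ltr_expR (andP x1I).2.
    by rewrite mulrBl rhoE; clear; lra.
  by rewrite pmulr_lge0 ?subr_ge0// subr_gt0.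
have rho0 : 0 < rho by rewrite (lt_le_trans _ rho1).
rewrite -(pmulr_rge0 _ r0).
have h1 : 0 <= s2 * (vxx x1 t - g * expR x1) by rewrite mulr_ge0.
have h2 : 0 <= rho * (s2 * (- vxx x t - - g * expR x)).
  by rewrite mulr_ge0 ?mulr_ge0// ltW.
have h3 : 0 <= eps * (b + r * (A - x1)) by rewrite mulr_ge0.
(* The last factor is the residual of the line of slope [g] at [s = k1], split into its values at
   slopes 0 and 1; the second one is [hk]. *)
have h4 : 0 <= (rho - 1) * ((1 - g) * (r * C) + g * (r * C + q * k1 - r * k1)).
  rewrite mulr_ge0 ?subr_ge0// addr_ge0// mulr_ge0 ?subr_ge0//.
  by rewrite mulr_ge0// ltW.
have h5 : 0 <= rho * r * eta by rewrite mulr_ge0// ltW// mulr_gt0.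
have h6 : rho * (vt x t - s2 * vxx x t - b * vx x t + r * v x t) <= 0.
  by rewrite pmulr_rle0.
have vx1E : vx x1 t = eps + g * expR x1 by clear -vx1; lra.
have vx2E : vx x t = g * expR x by clear -vx2; lra.
rewrite vx1E in vsup; rewrite vx2E vE in h6.
have e1E : expR x1 = k1 - rho * (k1 - expR x) by rewrite rhoE; ring.
(* All summands on the left are nonnegative. The identity rests on the collinearity [e1E] and on
   [b = r - q - s2], by which the derivative terms of [expR] combine to [(q - r) * expR]. *)
suff <- : rho * vt x t - vt x1 t +
    (vt x1 t - s2 * vxx x1 t - b * (eps + g * expR x1) + r * v x1 t) -
    rho * (vt x t - s2 * vxx x t - b * (g * expR x) +
      r * (C + eta - g * (k1 - expR x))) +
    s2 * (vxx x1 t - g * expR x1) +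
    rho * (s2 * (- vxx x t - - g * expR x)) + eps * (b + r * (A - x1)) +
    (rho - 1) * ((1 - g) * (r * C) + g * (r * C + q * k1 - r * k1)) +
    rho * r * eta = r * (v x1 t + eps * (A - x1) - C + g * (k1 - expR x1)).
  by clear -vt0 vsup h1 h2 h3 h4 h5 h6; lra.
by rewrite e1E bE; ring.
Qed.

(** The rectangles stay strictly inside because a mollifier needs room on every side. The minimum
    principles therefore run at times below [T], and [T] itself is reached by continuity at the
    end. *)
Definition approx_obstacle (R : realType) (s2 b r l T : R) (psi : R -> R)
    (Y : R -> R -> R) :=
  forall xa xb ta tb c : R, xa < xb < l -> 0 < ta <= tb -> tb < T -> 0 < c ->
  exists v vx vxx vt, C21 v vx vxx vt /\
  forall x t : R, xa <= x <= xb -> ta <= t <= tb ->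
  [/\ `|v x t - Y x t| <= c,
      0 <= vt x t - s2 * vxx x t - b * vx x t + r * v x t &
      psi x + c <= Y x t ->
      vt x t - s2 * vxx x t - b * vx x t + r * v x t <= 0].

Lemma C21_cst_sub (R : realType) (C : R) (v vx vxx vt : R -> R -> R) :
  C21 v vx vxx vt -> C21 (fun x t => C - v x t) (fun x t => - vx x t)
    (fun x t => - vxx x t) (fun x t => - vt x t).
Proof.
move=> [cv dv]; split.
  by move=> z; apply: cvgB; [exact: cvg_cst|exact: cv].
move=> x t; have [d1 d2 d3] := dv x t; split.
- by rewrite -[X in is_derive _ _ _ X]add0r; exact: is_deriveB.
- exact: is_deriveN.
- by rewrite -[X in is_derive _ _ _ X]add0r; exact: is_deriveB.
Qed.

(** Where [Y > C >= psi] the obstacle is inactive, so [C - Y] is a supersolution there because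
    [r * C >= 0]. The bound makes the slopes of chords to the end point nonnegative. *)
Lemma obstacle_solution_le (R : realType) (s2 b r l T C M : R) (psi : R -> R)
    (Y : R -> R -> R) :
  0 <= s2 -> 0 < r -> 0 <= C ->
  approx_obstacle s2 b r l T psi Y ->
  (forall x t : R, x <= l -> 0 <= t <= T -> Y x t <= M) ->
  (forall xa, unif_cont_rect xa l 0 T Y) ->
  (forall x, x <= l -> psi x <= C) ->
  (forall x, x <= l -> Y x 0 = psi x) ->
  (forall t : R, 0 <= t <= T -> Y l t = C) ->
  forall x t, x <= l -> 0 < t < T -> Y x t <= C.
Proof.
move=> s20 r0 C0 hY YM ucY psiC Y0 Yl x t xl /andP[t0 tT].
rewrite -subr_ge0.
apply: (@weak_minimum_principle _ s2 b r l t (M - C) (fun x t => C - Y x t)) => //.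
- move=> y u yl /andP[u0 ut].
  have := YM y u yl; rewrite u0 (le_trans ut (ltW tT)) => /(_ isT).
  by clear; lra.
- move=> xa e e0; have [del del0 H] := ucY xa e e0; exists del => //.
  move=> y y' u u' yI y'I /andP[u0 ut] /andP[u'0 u't] yy uu.
  rewrite opprB addrC addrA subrK -normrN opprB; apply: H => //.
    by rewrite u0 (le_trans ut (ltW tT)).
  by rewrite u'0 (le_trans u't (ltW tT)).
- by move=> y yl; rewrite subr_ge0 Y0// psiC.
- move=> u /andP[u0 ut]; rewrite Yl ?subrr//.
  by rewrite u0 (le_trans ut (ltW tT)).
move=> xa xb t1 c xI tI c0.
have [v [vx [vxx [vt [Cv hv]]]]] := hY xa xb t1 t c xI tI tT c0.
exists (fun x t => C - v x t), (fun x t => - vx x t), (fun x t => - vxx x t),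
  (fun x t => - vt x t); split; first exact: C21_cst_sub.
move=> y u yI uI; have [h1 _ h3] := hv y u yI uI; split.
  by rewrite opprB addrC addrA subrK distrC.
move=> hw; have yl : y <= l by clear -yI xI; lra.
have rC : 0 <= r * C by rewrite mulr_ge0// ltW.
have := psiC _ yl => pC.
have {}h3 := h3 ltac:(clear -hw pC c0; lra).
by clear -h3 rC; lra.
Qed.

(* Height of [f x1] above the line through [(expR x, f x)] and [(k1, C)], in the
   variable [s = expR x]. *)
Definition chord_end (R : realType) (C k1 : R) (f : R -> R) (x1 x : R) :=
  f x1 - C + (k1 - expR x1) * ((C - f x) / (k1 - expR x)).

(** A negative value leads to a minimum over triples [(x1, x, t)]. Two perturbations confine it:
    [eps * (A - x1)] grows as [x1] goes to the left, and raising the end value from [C] to [C + eta]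
    makes the slope of the chord blow up as [x] approaches [l]. Coincidence of the two points, the
    initial time and near contact with the obstacle at [x] are incompatible with so negative a
    value. An interior minimum with [v] a subsolution at [x] remains, to which [two_point_at_min]
    applies. *)
Lemma chord_right_end (R : realType) (s2 b r q l T C M : R) (psi : R -> R)
    (Y : R -> R -> R) :
  0 <= s2 -> 0 < r -> 0 <= C -> b = r - q - s2 ->
  r * expR l <= r * C + q * expR l ->
  approx_obstacle s2 b r l T psi Y ->
  (forall x t : R, x <= l -> 0 <= t <= T -> `|Y x t| <= M) ->
  (forall xa, unif_cont_rect xa l 0 T Y) ->
  (forall x t : R, x <= l -> 0 <= t <= T -> psi x <= Y x t) ->
  (forall x, x <= l -> psi x <= C) ->
  (forall x, x <= l -> C - psi x <= expR l - expR x) ->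
  (forall x1 x, x1 <= x -> x < l -> 0 <= chord_end C (expR l) psi x1 x) ->
  (forall x, x <= l -> Y x 0 = psi x) ->
  (forall t : R, 0 <= t <= T -> Y l t = C) ->
  forall x1 x t, x1 <= x -> x < l -> 0 < t < T ->
  0 <= chord_end C (expR l) (Y^~ t) x1 x.
Proof.
move=> s20 r0 C0 bE hk hY YM ucY psiY psiC psil psic Y0 Yl z1 z T0 z1z zl.
move=> /andP[T00 T0T].
have YC : forall x t, x <= l -> 0 < t <= T0 -> Y x t <= C.
  move=> x t xl /andP[t0 tT0].
  apply: (@obstacle_solution_le _ s2 b r l T C M psi Y) => //.
    by move=> y u yl uI; apply: le_trans (YM y u yl uI); exact: ler_norm.
  by rewrite t0 (le_lt_trans tT0).
rewrite leNgt; apply/negP => neg.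
set k1 := expR l in hk psil psic neg.
have ek x : x < l -> 0 < k1 - expR x by move=> ?; rewrite subr_gt0 ltr_expR.
have [m negE m0] : exists2 m : R,
    chord_end C k1 (Y^~ T0) z1 z = - (2 * m) & 0 < m.
  exists (- chord_end C k1 (Y^~ T0) z1 z / 2); first by field.
  by clear -neg; lra.
have [A hA] := linear_barrier b l r0.
have [thz1 _] := hA z1 (ltW (le_lt_trans z1z zl)).
have kz1 := ek _ (le_lt_trans z1z zl); have kz := ek _ zl.
(* Each perturbation costs [m / 2] at [(z1, z, T0)], so the perturbed height there is
   [- 2m + m / 2 + m / 2 = - m]. *)
have [eps eps0 epsE] : exists2 eps : R, 0 < eps & eps * (A - z1) = m / 2.
  have h : 0 < A - z1 by clear -thz1; lra.
  by exists (m / 2 / (A - z1)); [rewrite !divr_gt0|field; rewrite gt_eqF].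
have [eta eta0 etaE] : exists2 eta : R, 0 < eta &
    (k1 - expR z1) * (eta / (k1 - expR z)) = m / 2.
  exists (m / 2 * (k1 - expR z) / (k1 - expR z1)).
    by rewrite divr_gt0// mulr_gt0// divr_gt0.
  by field; rewrite !gt_eqF.
pose P (v : R -> R -> R) x1 x t := v x1 t + eps * (A - x1) - C +
  (k1 - expR x1) * ((C + eta - v x t) / (k1 - expR x)).
have Pz : P Y z1 z T0 = - m.
  have -> : P Y z1 z T0 = chord_end C k1 (Y^~ T0) z1 z + eps * (A - z1) +
    (k1 - expR z1) * (eta / (k1 - expR z)).
    by rewrite /P /chord_end; field; rewrite gt_eqF.
  by rewrite negE epsE etaE; field.
have m4 : 0 < m / 4 by rewrite divr_gt0.
have CM : C <= M.
  have := YM l 0; rewrite lexx => /(_ isT).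
  rewrite (ltW (lt_trans T00 T0T)) Yl ?lexx ?(ltW (lt_trans T00 T0T))// => H.
  exact: le_trans (ler_norm _) (H isT).
have M1 : 0 < M + C + 1 by clear -CM C0; lra.
have [xa xaz1 xaM] : exists2 xa : R, xa < z1 & M + C <= eps * (A - xa).
  exists (Num.min (z1 - 1) (A - (M + C) / eps)).
    by rewrite gt_min; apply/orP; left; clear; lra.
  rewrite -ler_pdivrMl// lerBrDl -lerBrDr ge_min mulrC.
  by rewrite lexx orbT.
have TI t : 0 < t <= T0 -> 0 <= t <= T.
  by move=> /andP[? /le_lt_trans/(_ T0T)?]; rewrite !ltW.
have YMl x t : x <= l -> 0 < t <= T0 -> - M <= Y x t.
  by move=> xl /TI tT; have := YM _ _ xl tT; rewrite ler_norml => /andP[].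
have [del del0 uc] := ucY xa (m / 4) m4.
have nearl x t : xa <= x < l -> l - del <= x -> 0 < t <= T0 ->
    C - m / 4 <= Y x t.
  move=> /andP[xax xl] lx tT.
  have : `|Y x t - Y l t| <= m / 4.
    apply: uc => //; [| | exact: TI | exact: TI | |].
    - by rewrite xax ltW.
    - by rewrite lexx ltW// (le_lt_trans xax).
    - by rewrite distrC gtr0_norm ?subr_gt0// lerBlDr -lerBlDl.
    - by rewrite subrr normr0 ltW.
  by rewrite Yl ?TI// ler_norml => /andP[+ _]; clear; lra.
(* Once [x1 < l - del], one has [k1 - expR x1 >= kap]. At [x = xb], where [k1 - expR x = mu], the
   [eta] term is then at least [kap * eta / mu >= M + C + 1], which outweighs
   [Y x1 t - C >= - (M + C)]; this dictates [mu]. *)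
pose kap := k1 - expR (l - del).
have kap0 : 0 < kap by apply: ek; rewrite gtrBl.
have [mu mu0 [muz muM]] : exists2 mu : R, 0 < mu &
    mu <= k1 - expR z /\ (M + C + 1) * mu <= kap * eta.
  exists (Num.min (k1 - expR z) (kap * eta / (M + C + 1))).
    by rewrite lt_min kz divr_gt0// mulr_gt0.
  by rewrite ge_min lexx; split => //; rewrite -ler_pdivlMl// mulrC ge_min lexx orbT.
have k1mu : 0 < k1 - mu.
  by have := expR_gt0 z; clear -muz; lra.
pose xb := ln (k1 - mu).
have exb : expR xb = k1 - mu by rewrite lnK.
have xbP x : x <= xb -> mu <= k1 - expR x.
  by rewrite -ler_expR exb; clear; lra.
have zxb : z <= xb by rewrite -ler_expR exb; clear -muz; lra.
have xbl : xb < l by rewrite -ltr_expR exb; rewrite -/k1; clear -mu0; lra.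
pose Rm := k1 / mu.
have k10 : 0 < k1 by exact: expR_gt0.
have Rm0 : 0 < Rm by rewrite divr_gt0.
have rhoI x1 x : x1 < l -> x <= xb ->
    0 < (k1 - expR x1) / (k1 - expR x) <= Rm.
  move=> x1l xxb; have x1k := ek _ x1l; have xk := ek _ (le_lt_trans xxb xbl).
  rewrite divr_gt0//= /Rm ler_pM ?invr_ge0 ?(ltW xk) ?(ltW x1k)//.
    by rewrite gerBl expR_ge0.
  by rewrite lef_pV2 ?posrE// xbP.
have Rm1 : 0 < 8 * (1 + Rm) by clear -Rm0; lra.
(* [Rm] bounds the ratio of the two distances to [k1], so an error [e] in the values of the solution
   moves the height by at most [e + Rm * e]; [e1] keeps this at [m / 8]. *)
pose e1 := m / (8 * (1 + Rm)).
have e10 : 0 < e1 by rewrite divr_gt0.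
have e1E : e1 + Rm * e1 = m / 8 by rewrite /e1; field; rewrite gt_eqF// addr_gt0.
have [del1 del10 uc1] := ucY xa e1 e10.
have [t0 /andP[t00 t0T] t0del] : exists2 t0 : R, 0 < t0 < T0 & t0 <= del1.
  exists (Num.min del1 (T0 / 2)); last by rewrite ge_min lexx.
  by rewrite lt_min del10 divr_gt0//= gt_min; apply/orP; right; clear -T00; lra.
have [c c0 [ceta ce1]] : exists2 c : R, 0 < c & c <= eta /\ c <= e1.
  exists (Num.min eta e1); first by rewrite lt_min eta0.
  by rewrite !ge_min !lexx orbT.
have cE : c + Rm * c <= m / 8.
  by rewrite -e1E lerD// ler_wpM2l// ltW.
have [||//|//| v [vx [vxx [vt [Cv hv]]]]] := hY xa xb t0 T0 c.
- by rewrite (lt_le_trans xaz1)// (le_trans z1z).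
- by rewrite t00 ltW.
have PvY x1 x t : xa <= x1 <= xb -> xa <= x <= xb -> t0 <= t <= T0 ->
    `|P v x1 x t - P Y x1 x t| <= m / 8.
  move=> x1I xI tI.
  have [h1 _ _] := hv x1 t x1I tI; have [h2 _ _] := hv x t xI tI.
  have /andP[r1 r2] := rhoI x1 x (le_lt_trans (andP x1I).2 xbl) (andP xI).2.
  have -> : P v x1 x t - P Y x1 x t = (v x1 t - Y x1 t) -
      ((k1 - expR x1) / (k1 - expR x)) * (v x t - Y x t).
    rewrite /P; field; rewrite gt_eqF// ek//.
    exact: le_lt_trans (andP xI).2 xbl.
  apply: le_trans (ler_normB _ _) _; apply: le_trans cE; rewrite lerD//.
  by rewrite normrM (gtr0_norm r1) ler_pM// ltW.
pose V (u : R * R * R) := P v u.1.1 u.1.2 u.2.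
pose D := [set u : R * R * R | u.1.1 <= u.1.2].
pose K := ((`[xa, xb] `*` `[xa, xb]) `*` `[t0, T0]) `&` D.
have cK : compact K.
  apply: compact_closedI.
    by apply: compact_setX; [exact: compact_rect|exact: segment_compact].
  rewrite (_ : D = (fun u : R * R * R => u.1.2 - u.1.1) @^-1` [set y | 0 <= y]).
    apply: closed_comp; last exact: closed_ge.
    move=> u _; apply: cvgB.
      by apply: (@cvg_comp _ _ _ fst snd); [exact: cvg_fst|exact: cvg_snd].
    by apply: (@cvg_comp _ _ _ fst fst); exact: cvg_fst.
  by apply/seteqP; split => u /=; rewrite subr_ge0.
have c11 (u : R * R * R) : (u.1.1 @[u --> u] --> u.1.1).
  by apply: (@cvg_comp _ _ _ fst fst); exact: cvg_fst.
have c12 (u : R * R * R) : (u.1.2 @[u --> u] --> u.1.2).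
  by apply: (@cvg_comp _ _ _ fst snd); [exact: cvg_fst|exact: cvg_snd].
have cexp (f : R * R * R -> R) u : f x @[x --> u] --> f u ->
    expR (f x) @[x --> u] --> expR (f u).
  by move=> cf; apply: (cvg_comp _ _ cf); exact: continuous_expR.
have cV : {within K, continuous V}.
  apply: continuous_in_subspaceT => u; rewrite inE => -[[[_ /= xI] _] _].
  have [cv _] := Cv.
  have xk : k1 - expR u.1.2 != 0.
    rewrite gt_eqF// ek// (le_lt_trans _ xbl)//.
    by move: xI; rewrite in_itv/= => /andP[].
  apply: cvgD; first (apply: cvgB; last exact: cvg_cst); first apply: cvgD.
  - by apply: (cvg_comp2 (c11 u) cvg_snd (cv (u.1.1, u.2))).
  - by apply: cvgMr; apply: cvgB; [exact: cvg_cst|exact: c11].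
  - apply: cvgM; first by apply: cvgB; [exact: cvg_cst|apply: cexp; exact: c11].
    apply: cvgM.
      apply: cvgB; first exact: cvg_cst.
      by apply: (cvg_comp2 (c12 u) cvg_snd (cv (u.1.2, u.2))).
    by apply: cvgV => //; apply: cvgB; [exact: cvg_cst|apply: cexp; exact: c12].
have zI : xa <= z <= xb by rewrite zxb andbT (le_trans (ltW xaz1)).
have z1I : xa <= z1 <= xb by rewrite (ltW xaz1) (le_trans z1z).
have TI0 : t0 <= T0 <= T0 by rewrite lexx ltW.
have [|[[x1 x] t] /[!inE] -[/= [[]]]] := @compact_EVT_min _ R V K _ cK cV.
  by exists (z1, z, T0); rewrite /K/D/= !in_itv/=.
rewrite /= !in_itv/= => x1I xI tI x1x Vmin.
have {}Vmin x1' x' t' : xa <= x1' <= xb -> xa <= x' <= xb -> t0 <= t' <= T0 ->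
    x1' <= x' -> P v x1 x t <= P v x1' x' t'.
  move=> ? ? ? ?; apply: (Vmin (x1', x', t')).
  by rewrite inE /K/D/= !in_itv/=.
have Pvneg : P v x1 x t <= - (m * 7 / 8).
  have := Vmin _ _ _ z1I zI TI0 z1z; have := PvY _ _ _ z1I zI TI0.
  by rewrite Pz ler_norml => /andP[_]; clear; lra.
have PYneg : P Y x1 x t <= - (m * 3 / 4).
  have := PvY _ _ _ x1I xI tI.
  by rewrite ler_norml => /andP[+ _]; move: Pvneg; clear; lra.
have x1l : x1 < l := le_lt_trans (andP x1I).2 xbl.
have xl : x < l := le_lt_trans (andP xI).2 xbl.
have tI0 : 0 < t <= T0 by rewrite (lt_le_trans t00 (andP tI).1) (andP tI).2.
have [x1k xk] := (ek _ x1l, ek _ xl).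
have [thx1 bthx1] := hA _ (ltW x1l).
have epsth : 0 <= eps * (A - x1).
  by rewrite mulr_ge0//; [exact: ltW|exact: le_trans thx1].
have tail0 : 0 <= (C - Y x t) / (k1 - expR x).
  by rewrite divr_ge0 ?(ltW xk)// subr_ge0 YC// ltW.
have tailE : (C + eta - Y x t) / (k1 - expR x) =
    (C - Y x t) / (k1 - expR x) + eta / (k1 - expR x).
  by rewrite addrAC mulrDl.
have eta1 : 0 < eta / (k1 - expR x) by rewrite divr_gt0.
have PYE : P Y x1 x t = chord_end C k1 (Y^~ t) x1 x + eps * (A - x1) +
   (k1 - expR x1) * (eta / (k1 - expR x)).
  by rewrite /P tailE /chord_end; ring.
have PYY : Y x1 t + eps * (A - x1) - C +
    (k1 - expR x1) * (eta / (k1 - expR x)) <= P Y x1 x t.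
  have := mulr_ge0 (ltW x1k) tail0.
  by rewrite PYE /chord_end; clear; lra.
have etak : 0 < (k1 - expR x1) * (eta / (k1 - expR x)) by rewrite mulr_gt0.
(* Otherwise [Y x1 t] is within [m / 4] of [C], which forces [P Y x1 x t >= - m / 4]. *)
have x1far : x1 < l - del.
  rewrite ltNge; apply/negP => H.
  have := nearl x1 t _ H tI0; rewrite (andP x1I).1 x1l => /(_ isT).
  by move: PYY PYneg etak epsth m0; clear; lra.
have Yx1 := YMl _ _ (ltW x1l) tI0.
have xax1 : xa < x1.
  rewrite lt_neqAle (andP x1I).1 andbT; apply/eqP => E.
  by move: PYY PYneg etak Yx1 xaM m0; rewrite -E; clear; lra.
have xxb : x < xb.
  rewrite lt_neqAle (andP xI).2 andbT; apply/eqP => E.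
  have muE : k1 - expR x = mu by rewrite E exb; ring.
  have h1 : kap * (eta / mu) <= (k1 - expR x1) * (eta / (k1 - expR x)).
    rewrite muE ler_wpM2r ?divr_ge0 ?(ltW eta0) ?(ltW mu0)//.
    by rewrite lerD2l lerN2 ler_expR ltW.
  have h2 : M + C + 1 <= kap * (eta / mu) by rewrite mulrA ler_pdivlMr.
  by move: PYY PYneg Yx1 h1 h2 epsth m0; clear; lra.
have {}x1x : x1 < x.
  rewrite lt_neqAle x1x andbT; apply/eqP => E.
  have : P v x1 x t = eps * (A - x1) + eta.
    by rewrite /P E; field; rewrite gt_eqF.
  by move: Pvneg epsth eta0 m0; clear; lra.
have [hv1 vsup1 _] := hv x1 t x1I tI; have [hv2 _ vsub] := hv x t xI tI.
have /andP[rho0 rhoR] := rhoI x1 x x1l (andP xI).2.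
have psix := psic _ _ (ltW x1x) xl.
have chordE e : chord_end C k1 psi x1 x - (k1 - expR x1) / (k1 - expR x) * e =
   psi x1 - C + (k1 - expR x1) * ((C - (psi x + e)) / (k1 - expR x)).
  by rewrite /chord_end; field; rewrite gt_eqF.
(* At time [t0] the solution is within [e1] of the obstacle, whose own chords to the end point have
   the right sign. *)
have t0t : t0 < t.
  rewrite lt_neqAle (andP tI).1 andbT; apply/eqP => E.
  have near0 y : xa <= y < l -> `|Y y t - Y y 0| <= e1.
    move=> /andP[yxa yl]; apply: uc1; [| | exact: TI | | |].
    - by rewrite yxa ltW.
    - by rewrite yxa ltW.
    - by apply/andP; split => //; rewrite ltW// (lt_trans T00).
    - by rewrite subrr normr0 ltW.
    - by rewrite subr0 -E gtr0_norm.
  have := near0 x1; rewrite (ltW xax1) x1l (Y0 _ (ltW x1l)) ler_norml.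
  move=> /(_ isT) /andP[n1 _].
  have := near0 x; rewrite (andP xI).1 xl (Y0 _ (ltW xl)) ler_norml.
  move=> /(_ isT) /andP[_ n2].
  have h1 : (k1 - expR x1) / (k1 - expR x) * e1 <= Rm * e1.
    by rewrite ler_wpM2r// ltW.
  have h2 : (k1 - expR x1) * ((C - (psi x + e1)) / (k1 - expR x)) <=
            (k1 - expR x1) * ((C - Y x t) / (k1 - expR x)).
    rewrite ler_wpM2l ?(ltW x1k)// ler_wpM2r ?invr_ge0 ?(ltW xk)//.
    by move: n2; clear; lra.
  move: psix n1 h1 h2 (chordE e1) PYE PYneg epsth etak e1E m0.
  by rewrite /chord_end; clear; lra.
(* Otherwise replacing [Y x t] by [psi x + c] costs at most [Rm * c], and [psi x1 <= Y x1 t] reduces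
   the height to that of the obstacle, which is nonnegative. *)
have psixY : psi x + c <= Y x t.
  rewrite leNgt; apply/negP => H.
  have h0 := psiY x1 t (ltW x1l) (TI _ tI0).
  have h1 : (k1 - expR x1) / (k1 - expR x) * c <= Rm * c.
    by rewrite ler_wpM2r// ltW.
  have h2 : (k1 - expR x1) * ((C - (psi x + c)) / (k1 - expR x)) <=
            (k1 - expR x1) * ((C - Y x t) / (k1 - expR x)).
    rewrite ler_wpM2l ?(ltW x1k)// ler_wpM2r ?invr_ge0 ?(ltW xk)//.
    by move: H; clear; lra.
  move: psix h0 h1 h2 (chordE c) PYE PYneg epsth etak cE c0 m0.
  by rewrite /chord_end; clear; lra.
have {}vsub := vsub psixY.
pose g := (C + eta - v x t) / (k1 - expR x).
have PvE : P v x1 x t = v x1 t + eps * (A - x1) - C + g * (k1 - expR x1).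
  by rewrite /P /g; ring.
suff : 0 <= P v x1 x t by rewrite leNgt; move: Pvneg m0; clear; lra.
have YCx := YC x t (ltW xl) tI0.
(* Lower bound: [Y x t <= C], and [c <= eta] absorbs the approximation error. Upper bound: at [x1]
   the line of slope [g] lies above [v], while the line of slope 1 through the end point lies below
   [psi]. *)
have gI : 0 <= g <= 1.
  apply/andP; split.
    rewrite divr_ge0 ?(ltW xk)//; move: hv2 YCx ceta; rewrite ler_norml.
    by move=> /andP[_]; clear; lra.
  rewrite -(ler_pM2r x1k) mul1r.
  have h0 := psiY x1 t (ltW x1l) (TI _ tI0); have := psil _ (ltW x1l).
  move: PvE Pvneg epsth hv1 h0; rewrite ler_norml => + + + /andP[+ _].
  have : c <= m / 8.
    by apply: le_trans cE; rewrite lerDl mulr_ge0// ltW.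
  by move: m0; clear; lra.
rewrite PvE.
apply: (@two_point_at_min _ s2 b r q C eta eps A k1 g
  ((k1 - expR x1) / (k1 - expR x)) xa xb t0 x1 x t v vx vxx vt) => //.
- exact: ltW.
- exact: ltW.
- by rewrite xax1.
- by rewrite -subr_gt0.
- by field; rewrite gt_eqF.
- by rewrite /g; field; rewrite gt_eqF.
- move=> y /andP[yxa yx].
  have yI : xa <= y <= xb by rewrite yxa (le_trans yx)// ltW.
  have := Vmin y x t yI xI tI yx; rewrite PvE /P -/g.
  by clear; lra.
- move=> y /andP[x1y yxb].
  have yI : xa <= y <= xb by rewrite (le_trans (ltW xax1)).
  have yk := ek _ (le_lt_trans yxb xbl).
  have := Vmin x1 y t x1I yI tI x1y; rewrite /P lerD2l ler_pM2l// -/g.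
  by rewrite ler_pdivlMr// -subr_ge0.
- move=> y /andP[t0y yt].
  have yI : t0 <= y <= T0 by rewrite t0y (le_trans yt (andP tI).2).
  have := Vmin x1 x y x1I xI yI (ltW x1x); rewrite /P.
  set rho := (k1 - expR x1) / (k1 - expR x).
  have rhoE u : (k1 - expR x1) * ((C + eta - u) / (k1 - expR x)) =
    rho * (C + eta) - rho * u by rewrite /rho; ring.
  by rewrite !rhoE; clear; lra.
Qed.

(** * Comparison of the solution with its translates in [x] *)

Lemma C21_translated_comb (R : realType) (a b lam : R)
    (v vx vxx vt : R -> R -> R) : C21 v vx vxx vt ->
  let tr (f : R -> R -> R) x t :=
    lam * f (x + a) t + (1 - lam) * f (x - b) t - f x t in
  C21 (tr v) (tr vx) (tr vxx) (tr vt).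
Proof.
move=> [cv dv] tr.
have ctr (h : R) : continuous (fun z : R * R => v (z.1 + h) z.2).
  move=> z; apply: (cvg_comp2 _ cvg_snd (cv (z.1 + h, z.2))).
  by apply: cvgD; [exact: cvg_fst|exact: cvg_cst].
have dtr (f : R -> R) (h x d : R) : is_derive (x + h) 1 f d ->
    is_derive x 1 (fun y => f (y + h)) d.
  move=> fd; rewrite -[d]mulr1.
  apply: (@is_derive1_comp _ f (fun y => y + h)) => //.
  exact: is_derive_shift.
split.
  move=> z; apply: cvgB; last exact: cv.
  by apply: cvgD; apply: cvgMr; exact: ctr.
move=> x t; have [d1 d2 d3] := dv x t.
have [da1 da2 da3] := dv (x + a) t; have [db1 db2 db3] := dv (x - b) t.
split; apply: is_deriveB; apply: is_deriveD; apply: is_deriveZ.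
- exact: (dtr (v^~ t)).
- exact: (dtr (v^~ t)).
- exact: (dtr (vx^~ t)).
- exact: (dtr (vx^~ t)).
Qed.

Lemma translated_comb_ge0 (R : realType) (s2 b l T C M lam al be r : R)
    (psi : R -> R) (Y : R -> R -> R) :
  0 <= s2 -> 0 < r -> 0 < al -> 0 < be -> 0 <= lam <= 1 ->
  lam * expR al + (1 - lam) * expR (- be) = 1 ->
  approx_obstacle s2 b r l T psi Y ->
  (forall x t : R, x <= l -> 0 <= t <= T -> `|Y x t| <= M) ->
  (forall xa, unif_cont_rect xa l 0 T Y) ->
  (forall x t : R, x <= l -> 0 <= t <= T -> psi x <= Y x t) ->
  (forall x, x <= l - al ->
    psi x <= lam * psi (x + al) + (1 - lam) * psi (x - be)) ->
  (forall x1 x t, x1 <= x -> x < l -> 0 < t < T ->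
    0 <= chord_end C (expR l) (Y^~ t) x1 x) ->
  (forall x, x <= l -> Y x 0 = psi x) ->
  (forall t : R, 0 <= t <= T -> Y l t = C) ->
  forall x t : R, x <= l - al -> 0 < t < T ->
  Y x t <= lam * Y (x + al) t + (1 - lam) * Y (x - be) t.
Proof.
move=> s20 r0 al0 be0 /andP[lam0 lam1] lamE hY YM ucY psiY psic hchord Y0 Yl.
move=> z T0 zl /andP[T00 T0T].
have lam1' : 0 <= 1 - lam by rewrite subr_ge0.
have TI t : 0 <= t <= T0 -> 0 <= t <= T.
  by move=> /andP[? /le_lt_trans/(_ T0T)/ltW->]; rewrite andbT.
have dom x : x <= l - al -> [/\ x <= l, x + al <= l & x - be <= l].
  by move=> H; split; clear -H al0 be0; lra.
(* The coefficients [lam], [1 - lam] and 1 add up to 2; hence the tolerances [e / 2] and [c / 2]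
   below. *)
have comb u1 u2 u3 v1 v2 v3 (e : R) : `|u1 - v1| <= e -> `|u2 - v2| <= e ->
    `|u3 - v3| <= e -> `|lam * u1 + (1 - lam) * u2 - u3 -
      (lam * v1 + (1 - lam) * v2 - v3)| <= 2 * e.
  move=> h1 h2 h3.
  have -> : lam * u1 + (1 - lam) * u2 - u3 -
      (lam * v1 + (1 - lam) * v2 - v3) =
      lam * (u1 - v1) + (1 - lam) * (u2 - v2) - (u3 - v3) by ring.
  apply: le_trans (ler_normB _ _) _.
  apply: le_trans (lerD (ler_normD _ _) h3) _.
  rewrite !normrM (ger0_norm lam0) (ger0_norm lam1').
  have := ler_wpM2l lam0 h1; have := ler_wpM2l lam1' h2.
  by clear; lra.
rewrite -subr_ge0.
apply: (@weak_minimum_principle _ s2 b r (l - al) T0 (2 * M)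
  (fun x t => lam * Y (x + al) t + (1 - lam) * Y (x - be) t - Y x t)) => //.
- move=> x t xl tI; have [h1 h2 h3] := dom x xl.
  have Y0M y : y <= l -> `|Y y t - 0| <= M by move=> ?; rewrite subr0 YM// TI.
  have := comb _ _ _ _ _ _ _ (Y0M _ h2) (Y0M _ h3) (Y0M _ h1).
  by rewrite !mulr0 addr0 !subr0 ler_norml => /andP[].
- move=> xa e e0; have e2 : 0 < e / 2 by rewrite divr_gt0.
  have [del del0 H] := ucY (xa - be) (e / 2) e2; exists del => //.
  move=> x x' t t' /andP[xax xl] /andP[xax' xl'] /TI tI /TI t'I xx tt.
  have [h1 h2 h3] := dom x xl; have [h1' h2' h3'] := dom x' xl'.
  have -> : e = 2 * (e / 2) by field.
  apply: comb; apply: H => //; rewrite ?h1 ?h2 ?h3 ?h1' ?h2' ?h3' ?andbT;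
    try by clear -xax xax' al0 be0; lra.
  + by rewrite [X in `|X|](_ : _ = x - x')//; ring.
  + by rewrite [X in `|X|](_ : _ = x - x')//; ring.
- by move=> x xl; have [h1 h2 h3] := dom x xl; rewrite !Y0// subr_ge0 psic.
(* Lateral boundary: the chord starts at [l - al - be] and passes over [l - al]. Time 0 is separate
   because the chord inequality is known only for positive times. *)
- move=> t tI; rewrite subrK Yl ?TI//.
  have [t0'|tpos] := eqVneq t 0.
    rewrite t0'; have [h1 h2 h3] := dom (l - al) (lexx _).
    by have := psic _ (lexx (l - al)); rewrite subrK !Y0// -(Y0 l)// Yl ?TI ?subr_ge0// lexx ltW.
  have tI' : 0 < t < T.
    by rewrite lt_neqAle eq_sym tpos (andP tI).1 (le_lt_trans (andP tI).2).
  have ll : l - al < l by rewrite gtrBl.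
  have l2 : l - al - be <= l - al by rewrite gerBl ltW.
  have := hchord _ _ _ l2 ll tI'; rewrite /chord_end.
  have ek : 0 < expR l - expR (l - al) by rewrite subr_gt0 ltr_expR.
  rewrite mulrA -(pmulr_lge0 _ ek) mulrDl divfK ?gt_eqF// => hc.
  have ek1 : 0 < expR l - expR (l - al - be).
    by rewrite subr_gt0 ltr_expR; clear -al0 be0; lra.
  rewrite -(pmulr_lge0 _ ek1).
  (* This is [lamE] multiplied by [expR (l - al)]; it makes [1 - lam] the ratio of the two distances
     to the end point. *)
  have ekE : expR l - expR (l - al) = (1 - lam) * (expR l - expR (l - al - be)).
    have : expR (l - al) * (lam * expR al + (1 - lam) * expR (- be)) =
      expR (l - al) by rewrite lamE mulr1.
    rewrite mulrDr !(mulrCA (expR _)) -!expRD subrK => {1}<-.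
    by ring.
  by move: hc; rewrite ekE; clear; lra.
move=> xa xb t0 c xI tI c0.
have [||//|//|v [vx [vxx [vt [Cv hv]]]]] :=
  hY (xa - be) (xb + al) t0 T0 (c / 2).
- by clear -xI al0 be0; lra.
- exact: tI.
- by rewrite divr_gt0.
pose tr (f : R -> R -> R) x t :=
  lam * f (x + al) t + (1 - lam) * f (x - be) t - f x t.
exists (tr v), (tr vx), (tr vxx), (tr vt); split.
  exact: C21_translated_comb.
move=> x t xI' tI'.
have tIT : 0 <= t <= T by apply: TI; clear -tI tI'; lra.
have [||a1 a2 _] := hv (x + al) t; [by clear -xI' al0 be0; lra|by []|].
have [||b1 b2 _] := hv (x - be) t; [by clear -xI' al0 be0; lra|by []|].
have [||c1 _ c3] := hv x t; [by clear -xI' al0 be0; lra|by []|].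
split.
  have -> : c = 2 * (c / 2) by field.
  exact: comb.
(* Both shifted values dominate the obstacle, so [hw] and [psic] give [Y x t >= psi x + 3c]: the
   approximant is a subsolution at [x] and a supersolution at the shifted points. *)
move=> hw; have xl : x <= l - al by clear -xI' xI; lra.
have [h1 h2 h3] := dom x xl.
have := psiY _ _ h2 tIT; have := psiY _ _ h3 tIT; have := psic _ xl.
move=> p0 /(ler_wpM2l lam1') p1 /(ler_wpM2l lam0) p2.
have {}c3 := c3 ltac:(clear -hw p0 p1 p2 c0; lra).
move: (mulr_ge0 lam0 a2) (mulr_ge0 lam1' b2) c3; rewrite /tr; clear; lra.
Qed.

(** * Smooth mollifiers *)

(** One-variable counterpart of [Cn], with the derivative as a witness. All kernels are products, so
    smoothness in the plane reduces to it. *)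
Fixpoint smooth1 (R : realType) (n : nat) (f : R -> R) : Prop :=
  match n with
  | 0 => continuous f
  | m.+1 => exists2 g : R -> R, (forall x : R, is_derive x 1 f (g x)) &
      smooth1 m g
  end.

Section Smooth1.
Variable R : realType.
Implicit Types f g : R -> R.

Lemma is_derive_continuous f g :
  (forall x : R, is_derive x 1 f (g x)) -> continuous f.
Proof.
move=> fg x; apply: differentiable_continuous.
exact/derivable1_diffP/ex_derive.
Qed.

Lemma smooth1W n f : smooth1 n.+1 f -> smooth1 n f.
Proof.
elim: n f => [|n IH] f /= [g fg sg]; first exact: is_derive_continuous fg.
by exists g => //; apply: IH.
Qed.

Lemma smooth1_continuous n f : smooth1 n f -> continuous f.
Proof. by elim: n f => [//|n IH] f /smooth1W/IH. Qed.

Lemma smooth1_cst n (c : R) : smooth1 n (cst c).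
Proof.
elim: n c => [|n IH] c /=; first by move=> x; exact: cvg_cst.
by exists (cst 0) => // x; exact: is_derive_cst.
Qed.

Lemma smooth1D n f g : smooth1 n f -> smooth1 n g ->
  smooth1 n (fun x => f x + g x).
Proof.
elim: n f g => [|n IH] f g /=.
  by move=> cf cg x; apply: cvgD; [exact: cf|exact: cg].
move=> [f1 df sf] [g1 dg sg]; exists (fun x => f1 x + g1 x); last exact: IH.
by move=> x; exact: is_deriveD.
Qed.

Lemma smooth1M n f g : smooth1 n f -> smooth1 n g ->
  smooth1 n (fun x => f x * g x).
Proof.
elim: n f g => [|n IH] f g.
  by move=> cf cg x; apply: cvgM; [exact: cf|exact: cg].
move=> sf sg; have [sf' sg'] := (smooth1W sf, smooth1W sg).
move: sf sg => /= [f1 df sf] [g1 dg sg].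
exists (fun x => f x * g1 x + g x * f1 x); last by apply: smooth1D; apply: IH.
by move=> x; exact: is_deriveM.
Qed.

Lemma smooth1_affine n f (a b : R) : smooth1 n f ->
  smooth1 n (fun x => f (a * x + b)).
Proof.
have daf (x : R) : is_derive x 1 (fun x => a * x + b) a.
  rewrite -[X in is_derive _ _ _ X]addr0; apply: is_deriveD.
  by rewrite -[X in is_derive _ _ _ X]mulr1; exact: is_deriveZ.
elim: n f => [|n IH] f /=.
  move=> cf x; apply: (@continuous_comp _ _ _ (fun x => a * x + b) f).
    exact: is_derive_continuous daf _.
  exact: cf.
move=> [g fg sg]; exists (fun x => g (a * x + b) * a).
  move=> x; apply: (@is_derive1_comp _ f (fun x => a * x + b)) => //.
apply: smooth1M; [exact: IH|exact: smooth1_cst].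
Qed.

(** The case [n = 0] is the classical [exp (- 1 / x)]. The powers of [1 / x] make the family closed
    under differentiation, [flat n] having the derivative [flat n.+2 - n * flat n.+1], so smoothness
    is one induction over all members at once. *)
Definition flat n (x : R) : R := if 0 < x then x^-1 ^+ n * expR (- x^-1) else 0.

Lemma flat_ge0 n x : 0 <= flat n x.
Proof.
rewrite /flat; case: ifPn => // x0.
by rewrite mulr_ge0 ?expR_ge0// exprn_ge0// invr_ge0 ltW.
Qed.

Lemma flat_le0 n x : x <= 0 -> flat n x = 0.
Proof. by rewrite /flat ltNge => ->. Qed.

Lemma flat_gt0 n x : 0 < x -> 0 < flat n x.
Proof.
by move=> x0; rewrite /flat x0 mulr_gt0 ?expR_gt0// exprn_gt0// invr_gt0.
Qed.

(** With [y = 1 / x] this is [y ^ (n + 2) / (n + 2)! <= expR y], a single term of the exponential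
    series. It gives the derivative 0 at the origin. *)
Lemma flat_quadratic n x : flat n x <= n.+2`!%:R * x ^+ 2.
Proof.
rewrite /flat; case: ifPn => x0; last by rewrite mulr_ge0// sqr_ge0.
have y0 : 0 < x^-1 by rewrite invr_gt0.
rewrite expRN -ler_pdivlMr ?invr_gt0 ?expR_gt0// invrK.
have := expR_ge1Dxn n.+1 (ltW y0) => /(le_trans (_ : _ <= _)) H.
have {}H : x^-1 ^+ n.+2 / n.+2`!%:R <= expR x^-1.
  by apply: H; rewrite lerDr.
have f0 : (0 : R) < n.+2`!%:R by rewrite ltr0n fact_gt0.
rewrite ler_pdivrMr// in H.
have -> : x^-1 ^+ n = x^-1 ^+ n.+2 * x ^+ 2.
  rewrite -addn2 exprD -mulrA -exprMn mulVf ?expr1n ?mulr1//.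
  by rewrite gt_eqF.
by rewrite (mulrAC _ (x ^+ 2)) (mulrC _ (expR _)) ler_wpM2r// ?sqr_ge0.
Qed.

Lemma is_derive_quadratic f (x d C : R) :
  (forall h, `|f (x + h) - f x - h * d| <= C * h ^+ 2) -> is_derive x 1 f d.
Proof.
move=> H.
have C0 : 0 <= C by have := H 1; rewrite expr1n mulr1; exact: le_trans.
have cvgd : h^-1 *: (f (h *: 1 + x) - f x) @[h --> 0^'] --> d.
  apply/cvgrPdist_le => e e0; near=> h.
  have h0 : h != 0 by near: h; exact: nbhs_dnbhs_neq.
  have -> : d - h^-1 *: (f (h *: 1 + x) - f x) =
      - ((f (x + h) - f x - h * d) / h).
    by rewrite /GRing.scale/= mulr1 (addrC h); field.
  rewrite normrN normrM normfV ler_pdivrMr ?normr_gt0//.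
  apply: le_trans (H h) _; rewrite -[h ^+ 2]ger0_norm ?sqr_ge0// normrX.
  rewrite expr2 mulrA ler_wpM2r//.
  have -> : e = (C + 1) * (e / (C + 1)) by field; rewrite gt_eqF// ltr_wpDl.
  apply: ler_pM => //; first by rewrite lerDl.
  near: h; apply: dnbhs0_le; rewrite divr_gt0// ltr_wpDl//.
by split; [apply/cvg_ex; exists d | apply: cvg_lim].
Unshelve. all: by end_near. Qed.

Lemma is_derive_flat n (x : R) :
  is_derive x 1 (flat n) (flat n.+2 x - n%:R * flat n.+1 x).
Proof.
have [x0|x0|->] := ltgtP x 0.
- rewrite !flat_le0 ?ltW// mulr0 subr0.
  apply: (@near_eq_is_derive _ R R (cst 0)).
  have : \forall y \near x, y \in `]-oo, 0[.
    by apply: near_in_itvNyo; rewrite in_itv.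
  by apply: filterS => y; rewrite in_itv/= => y0; rewrite flat_le0// ltW.
- rewrite /flat x0 -/(flat n).
  apply: (@near_eq_is_derive _ R R
    ((fun y : R => y ^+ n * expR (- y)) \o (fun x : R => x^-1))).
    have : \forall y \near x, y \in `]0, +oo[.
      by apply: near_in_itvoy; rewrite in_itv/= x0.
    apply: filterS => y; rewrite in_itv/= andbT => y0.
    by rewrite /flat y0.
  have d1 : is_derive x 1 (fun x : R => x^-1) (- x^-1 ^+ 2).
    have : is_derive x 1 (fun x : R => x^-1) (- x ^- 2 *: 1).
      by apply: is_deriveV; rewrite gt_eqF.
    by rewrite /GRing.scale/= mulr1 exprVn.
  have d2 (y : R) : is_derive y 1 (fun y : R => y ^+ n * expR (- y))
      ((n%:R * y ^+ n.-1 - y ^+ n) * expR (- y)).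
    have dn : is_derive y 1 (fun y : R => y ^+ n) (n%:R * y ^+ n.-1).
      apply: DeriveDef; first exact: exprn_derivable.
      by rewrite exp_derive /GRing.scale/= mulr1.
    have de : is_derive y 1 (fun y : R => expR (- y)) (- expR (- y)).
      rewrite -mulrN1; apply: (@is_derive1_comp _ expR (fun y => - y)).
    rewrite [X in is_derive _ _ _ X](_ : _ =
      y ^+ n *: - expR (- y) + expR (- y) *: (n%:R * y ^+ n.-1)).
      exact: is_deriveM.
    by rewrite /GRing.scale/=; ring.
  rewrite [X in is_derive _ _ _ X](_ : _ =
    ((n%:R * x^-1 ^+ n.-1 - x^-1 ^+ n) * expR (- x^-1)) * (- x^-1 ^+ 2)).
    exact: is_derive1_comp.
  by case: n {d2} => [|n] /=; rewrite ?mul0r ?sub0r !exprS ?expr0; ring.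
- rewrite !flat_le0// mulr0 subr0; apply: (@is_derive_quadratic _ _ _ n.+2`!%:R).
  move=> h; rewrite add0r (@flat_le0 _ 0)// mulr0 !subr0.
  by rewrite ger0_norm ?flat_ge0// flat_quadratic.
Unshelve. all: by end_near. Qed.

Lemma smooth1_flat n m : smooth1 n (flat m).
Proof.
elim: n m => [|n IH] m /=; first exact: is_derive_continuous (is_derive_flat m).
exists (fun x => flat m.+2 x - m%:R * flat m.+1 x).
  exact: is_derive_flat.
apply: smooth1D; first exact: IH.
rewrite (_ : (fun x => - _) = (fun x => (- m%:R) * flat m.+1 x)); last first.
  by apply/funext => x; rewrite mulNr.
by apply: smooth1M; [exact: smooth1_cst|exact: IH].
Qed.

End Smooth1.

(** * Compactly supported mollifiers and product test functions *)

Section Bump.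
Variable R : realType.
Implicit Types f g : R -> R.

Lemma is_derive_unique f (x a b : R) :
  is_derive x 1 f a -> is_derive x 1 f b -> a = b.
Proof. by move=> [_ <-] [_ <-]. Qed.

Lemma smooth1_derivative f : (forall n, smooth1 n f) ->
  exists2 g : R -> R, (forall x : R, is_derive x 1 f (g x)) &
    forall n, smooth1 n g.
Proof.
move=> sf; have /= [g fg _] := sf 1%N; exists g => // n.
have /= [h fh sh] := sf n.+1.
suff <- : h = g by [].
by apply/funext => x; exact: is_derive_unique (fh x) (fg x).
Qed.

Lemma derivative_eq0 f g (d : R) : (forall x : R, is_derive x 1 f (g x)) ->
  (forall x, d < `|x| -> f x = 0) -> forall x, d < `|x| -> g x = 0.
Proof.
move=> fg f0 x dx; apply: (is_derive_unique (fg x)).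
apply: (@near_eq_is_derive _ R R (cst 0)).
have nx : `|y| @[y --> x] --> `|x| by exact: norm_continuous.
by apply: filterS (cvgr_gt _ nx _ dx) => y /= dy; rewrite f0.
Qed.

Lemma bounded_of_support f (d : R) : continuous f ->
  (forall x, d < `|x| -> f x = 0) -> exists2 B, 0 < B & forall x, `|f x| <= B.
Proof.
move=> cf f0.
have [d0|d0] := ltP d 0.
  exists 1 => // x; rewrite f0 ?normr0//; exact: lt_le_trans d0 _.
have [||c _ cmax] := @EVT_max _ (fun x => `|f x|) (- d) d.
- by rewrite ge0_cp.
- apply: continuous_subspaceT => x; apply: cvg_norm; exact: cf.
exists (`|f c| + 1); first by rewrite ltr_wpDl.
move=> x; have [xd|/f0->] := leP `|x| d; last first.
  by rewrite normr0 addr_ge0.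
apply: le_trans (cmax x _) _; last by rewrite lerDl.
by rewrite in_itv/= -ler_norml.
Qed.

(** The mass is left arbitrary: it is a positive constant, divided out where values matter and
    harmless where only signs do. Positivity inside the support yields this, and also the lower
    bound used at Lebesgue points. *)
Record mollifier (d : R) (f f1 f2 : R -> R) : Prop := Mollifier {
  moll_smooth : forall n, smooth1 n f ;
  moll_derive : forall x : R, is_derive x 1 f (f1 x) ;
  moll_derive2 : forall x : R, is_derive x 1 f1 (f2 x) ;
  moll_cont : [/\ continuous f, continuous f1 & continuous f2] ;
  moll_ge0 : forall x, 0 <= f x ;
  moll_gt0 : forall x, `|x| < d -> 0 < f x ;
  moll_even : forall x, f (- x) = f x ;
  moll_supp : forall x, d < `|x| -> [/\ f x = 0, f1 x = 0 & f2 x = 0] ;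
  moll_bound : exists2 B : R, 0 < B &
    forall x, [/\ `|f x| <= B, `|f1 x| <= B & `|f2 x| <= B] }.

(** On []-d, d[] the function is [exp (- 1 / (d + x) - 1 / (d - x))], written in the shape that
    [smooth1_affine] accepts. *)
Lemma mollifier_exists (d : R) : 0 < d -> exists f f1 f2, mollifier d f f1 f2.
Proof.
move=> d0; pose f x := flat 0 (1 * x + d) * flat 0 ((-1) * x + d).
have sf n : smooth1 n f.
  by apply: smooth1M; apply: smooth1_affine; exact: smooth1_flat.
have [f1 df sf1] := smooth1_derivative sf.
have [f2 df1 sf2] := smooth1_derivative sf1.
have fs x : d < `|x| -> f x = 0.
  rewrite /f real_ltr_normr ?num_real// => /orP[dx|dx].
    by rewrite (@flat_le0 _ _ (-1 * x + d)) ?mulr0//; lra.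
  by rewrite (@flat_le0 _ _ (1 * x + d)) ?mul0r//; lra.
have f1s := derivative_eq0 df fs; have f2s := derivative_eq0 df1 f1s.
have [cf cf1 cf2] : [/\ continuous f, continuous f1 & continuous f2].
  by split; exact: (@smooth1_continuous _ 0).
have [B0 B00 HB0] := bounded_of_support cf fs.
have [B1 B10 HB1] := bounded_of_support cf1 f1s.
have [B2 B20 HB2] := bounded_of_support cf2 f2s.
exists f, f1, f2; split => //.
- by move=> x; rewrite mulr_ge0// flat_ge0.
- move=> x; rewrite ltr_norml => /andP[dx xd].
  by rewrite mulr_gt0// flat_gt0//; lra.
- by move=> x; rewrite /f mulrC !mulN1r opprK !mul1r.
- by move=> x dx; rewrite fs ?f1s ?f2s.
exists (B0 + B1 + B2); first by rewrite !addr_gt0.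
move=> x; split; [apply: le_trans (HB0 x) _|apply: le_trans (HB1 x) _|
  apply: le_trans (HB2 x) _]; lra.
Qed.

Lemma cont_prod2 f g : continuous f -> continuous g ->
  continuous (fun z : R * R => f z.1 * g z.2).
Proof.
move=> cf cg z; apply: cvgM.
  by apply: (@cvg_comp _ _ _ fst f); [exact: cvg_fst|exact: cf].
by apply: (@cvg_comp _ _ _ snd g); [exact: cvg_snd|exact: cg].
Qed.

Lemma is_derive_mulr_cst f (x d c : R) :
  is_derive x 1 f d -> is_derive x 1 (fun y => f y * c) (d * c).
Proof.
move=> df; rewrite (_ : (fun y => _) = (fun y => c *: f y)).
  by rewrite mulrC; exact: is_deriveZ.
by apply/funext => y; rewrite mulrC.
Qed.

Lemma pderx_prod f f1 g : (forall x : R, is_derive x 1 f (f1 x)) ->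
  pderx (fun z : R * R => f z.1 * g z.2) = (fun z => f1 z.1 * g z.2).
Proof.
move=> df; apply/funext => z; rewrite /pderx /= derive1E.
have dfg := is_derive_mulr_cst (g z.2) (df z.1); exact: derive_val.
Qed.

Lemma pdert_prod f g g1 : (forall x : R, is_derive x 1 g (g1 x)) ->
  pdert (fun z : R * R => f z.1 * g z.2) = (fun z => f z.1 * g1 z.2).
Proof.
move=> dg; apply/funext => z; rewrite /pdert /= derive1E.
have dfg : is_derive z.2 1 (fun x => f z.1 * g x) (f z.1 * g1 z.2).
  exact: is_deriveZ.
exact: derive_val.
Qed.

Lemma Cn_prod n f g : smooth1 n f -> smooth1 n g ->
  Cn n (fun z : R * R => f z.1 * g z.2).
Proof.
elim: n f g => [|n IH] f g sf sg; first exact: cont_prod2.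
have [f1 df sf1] := sf; have [g1 dg sg1] := sg; split.
- by apply: cont_prod2; [exact: smooth1_continuous sf|exact: smooth1_continuous sg].
- by move=> z; have [] := is_derive_mulr_cst (g z.2) (df z.1).
- by move=> z; have [] := is_deriveZ (f z.1) (dg z.2).
- by rewrite (pderx_prod _ df); apply: IH => //; exact: smooth1W.
- by rewrite (pdert_prod _ dg); apply: IH => //; exact: smooth1W.
Qed.

Lemma test_function_prod (Om : set (R * R)) (xa xb ta tb : R) f g :
  (forall n, smooth1 n f) -> (forall n, smooth1 n g) ->
  (forall x, x \notin `[xa, xb] -> f x = 0) ->
  (forall x, x \notin `[ta, tb] -> g x = 0) ->
  `[xa, xb] `*` `[ta, tb] `<=` Om ->
  test_function Om (fun z : R * R => f z.1 * g z.2).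
Proof.
move=> sf sg f0 g0 sub.
have cl : closure [set z : R * R | f z.1 * g z.2 != 0] `<=`
    `[xa, xb] `*` `[ta, tb].
  have /closure_id-> : closed (`[xa, xb] `*` `[ta, tb] : set (R * R)).
    by apply: compact_closed; [exact: norm_hausdorff|exact: compact_rect].
  apply: closure_subset => -[x t] /= fg0; split => /=.
    by apply: contrapT => /negP/f0 E; rewrite E mul0r eqxx in fg0.
  by apply: contrapT => /negP/g0 E; rewrite E mulr0 eqxx in fg0.
split; first by move=> n; exact: Cn_prod.
- apply: subclosed_compact cl; [exact: closed_closure|exact: compact_rect].
- exact: subset_trans cl sub.
Qed.

End Bump.

(** * Mollification of strong solutions *)

Section UnderIntegral.
Context d (T : measurableType d) (R : realType) (mu : {measure set T -> \bar R}).
Implicit Types (K : set T) (Y : T -> R).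

Lemma integrable_mul_bounded K Y (h : T -> R) (B : R) :
  measurable K -> mu.-integrable K (EFin \o Y) -> measurable_fun setT h ->
  (forall w, `|h w| <= B) ->
  mu.-integrable K (EFin \o (fun w => Y w * h w)).
Proof.
move=> mK iY mh hB.
have -> : EFin \o (fun w => Y w * h w) = ((EFin \o Y) \* (EFin \o h))%E.
  by apply/funext => w /=; rewrite EFinM.
apply: integrableMl => //.
- exact: measurable_funTS.
- by exists B; split; [exact: num_real|move=> M BM w _; exact: le_trans (hB w) (ltW BM)].
Qed.

Lemma integrable_norm_mul K Y (c : R) : measurable K ->
  mu.-integrable K (EFin \o Y) ->
  mu.-integrable K (EFin \o (fun w => `|Y w| * c)).
Proof.
move=> mK iY; apply: (@integrable_mul_bounded _ (Num.norm \o Y) (cst c) `|c|) => //.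
exact: integrable_norm.
Qed.

Lemma integrable_scale K (g : T -> R) (a : R) : measurable K ->
  mu.-integrable K (EFin \o g) ->
  mu.-integrable K (EFin \o (fun w => a * g w)).
Proof.
move=> mK ig; have -> : EFin \o (fun w => a * g w) =
    (fun w => a%:E * (EFin \o g) w)%E by apply/funext => w; rewrite /= EFinM.
exact: integrableZl.
Qed.

Lemma is_derive_under_kernel K Y (h h1 : R -> T -> R) (B x : R) :
  measurable K -> mu.-integrable K (EFin \o Y) ->
  (forall u, measurable_fun setT (h u)) ->
  (forall u w, `|h u w| <= B) -> (forall u w, `|h1 u w| <= B) ->
  (forall (u : R) (w : T), is_derive u 1 (h^~ w) (h1 u w)) ->
  is_derive x 1 (fun u => \int[mu]_(w in K) (Y w * h u w))
    (\int[mu]_(w in K) (Y w * h1 x w)).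
Proof.
move=> mK iY mh hB h1B dh.
pose F (u : R) (w : T) := Y w * h u w.
have dF (u : R) (w : T) : is_derive u 1 (F^~ w) (Y w * h1 u w).
  exact: (@is_deriveZ _ _ _ (h^~ w)).
have dFE u w : partial1of2 F u w = Y w * h1 u w.
  by rewrite partial1of2E; have := dF u w => ?; rewrite derive_val.
have xI : `]x - 1, x + 1[%classic x.
  by rewrite /= in_itv/= ltrBlDr ltrDl ltr01.
have iF u : mu.-integrable K (EFin \o F u).
  exact: (@integrable_mul_bounded _ _ _ B).
have H0 u w : `]x - 1, x + 1[%classic u -> K w -> derivable (F^~ w) u 1.
  by move=> _ _; have [] := dF u w.
have B0 (w : T) : 0 <= B by rewrite (le_trans _ (hB 0 w)).
have G0 (w : T) : 0 <= `|Y w| * B by rewrite mulr_ge0// (B0 w).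
have iG : mu.-integrable K (EFin \o (fun w => `|Y w| * B)).
  exact: integrable_norm_mul.
have GB u w : `]x - 1, x + 1[%classic u -> K w ->
    `|partial1of2 F u w| <= `|Y w| * B.
  by move=> _ _; rewrite dFE normrM ler_wpM2l.
have H := derivable_under_integral mK xI (fun u _ => iF u) H0 G0 iG GB.
have E := differentiation_under_integral mK xI (fun u _ => iF u) H0 G0 iG GB.
split; first exact: H.
by rewrite -derive1E E; apply: eq_Rintegral => w _; exact: dFE.
Qed.

End UnderIntegral.

(** * Convolution with product kernels and its classical derivatives *)

Section Convolution.
Variable R : realType.
Local Notation T2 := (measurableTypeR R * measurableTypeR R)%type.
Implicit Types (Y : T2 -> R) (f g : R -> R) (K : set T2).

(** The domain [K] does not move with [(x, t)]: for compact [K], local integrability of [Y]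
    suffices, and derivatives in [x] and [t] fall on the kernel alone. *)
Definition conv K Y f g (x t : R) :=
  \int[@leb2 R]_(w in K) (Y w * (f (x - w.1) * g (t - w.2))).

Lemma measurable_kernel f g (x t : R) : continuous f -> continuous g ->
  measurable_fun (setT : set T2) (fun w : T2 => f (x - w.1) * g (t - w.2)).
Proof.
move=> cf cg; apply: measurable_funM.
  apply: (measurableT_comp (continuous_measurable_fun cf)).
  by apply: measurable_funB; [exact: measurable_cst|exact: measurable_fst].
apply: (measurableT_comp (continuous_measurable_fun cg)).
by apply: measurable_funB; [exact: measurable_cst|exact: measurable_snd].
Qed.

Lemma kernel_bound f g (B x t : R) (w : T2) :
  (forall y, `|f y| <= B) -> (forall y, `|g y| <= B) ->
  `|f (x - w.1) * g (t - w.2)| <= B * B.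
Proof. by move=> fB gB; rewrite normrM ler_pM. Qed.

Lemma conv_bound K Y f g (B x t : R) : measurable K ->
  (@leb2 R).-integrable K (EFin \o Y) -> continuous f -> continuous g ->
  (forall y, `|f y| <= B) -> (forall y, `|g y| <= B) ->
  `|conv K Y f g x t| <= \int[@leb2 R]_(w in K) `|Y w| * (B * B).
Proof.
move=> mK iY cf cg fB gB.
have iYh := integrable_mul_bounded mK iY (measurable_kernel x t cf cg)
  (fun w => kernel_bound x t w fB gB).
apply: le_trans (le_normr_Rintegral _ _) _ => //.
rewrite -RintegralZr//; last exact: integrable_norm.
apply: le_Rintegral => //.
- exact: (integrable_norm iYh).
- exact: integrable_norm_mul.
- by move=> w _; rewrite normrM ler_wpM2l// kernel_bound.
Qed.

Lemma is_derive_shift_sub f f1 (u c : R) : (forall y : R, is_derive y 1 f (f1 y)) ->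
  is_derive u 1 (fun v => f (v - c)) (f1 (u - c)).
Proof.
move=> df; rewrite -[X in is_derive _ _ _ X]mulr1.
apply: (@is_derive1_comp _ f (fun u => u - c)) => //.
exact: is_derive_shift.
Qed.

Lemma is_derive_conv_x K Y f f1 g (B x t : R) : measurable K ->
  (@leb2 R).-integrable K (EFin \o Y) ->
  continuous f -> continuous g ->
  (forall y, `|f y| <= B) -> (forall y, `|f1 y| <= B) ->
  (forall y, `|g y| <= B) -> (forall y : R, is_derive y 1 f (f1 y)) ->
  is_derive x 1 ((conv K Y f g)^~ t) (conv K Y f1 g x t).
Proof.
move=> mK iY cf cg fB f1B gB df.
pose h u (w : T2) := f (u - w.1) * g (t - w.2).
pose h1 u (w : T2) := f1 (u - w.1) * g (t - w.2).
have mh u : measurable_fun setT (h u) by exact: measurable_kernel.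
have hB u w : `|h u w| <= B * B by exact: kernel_bound.
have h1B u w : `|h1 u w| <= B * B by exact: kernel_bound.
apply: (is_derive_under_kernel x mK iY mh hB h1B).
by move=> u w; apply: is_derive_mulr_cst; exact: is_derive_shift_sub.
Qed.

Lemma is_derive_conv_t K Y f g g1 (B x t : R) : measurable K ->
  (@leb2 R).-integrable K (EFin \o Y) ->
  continuous f -> continuous g ->
  (forall y, `|f y| <= B) -> (forall y, `|g y| <= B) ->
  (forall y, `|g1 y| <= B) -> (forall y : R, is_derive y 1 g (g1 y)) ->
  is_derive t 1 (conv K Y f g x) (conv K Y f g1 x t).
Proof.
move=> mK iY cf cg fB gB g1B dg.
pose h u (w : T2) := f (x - w.1) * g (u - w.2).
pose h1 u (w : T2) := f (x - w.1) * g1 (u - w.2).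
have mh u : measurable_fun setT (h u) by exact: measurable_kernel.
have hB u w : `|h u w| <= B * B by exact: kernel_bound.
have h1B u w : `|h1 u w| <= B * B by exact: kernel_bound.
apply: (is_derive_under_kernel t mK iY mh hB h1B) => u w.
apply: (@is_deriveZ _ _ _ (fun v => g (v - w.2))).
exact: is_derive_shift_sub.
Qed.

Lemma lipschitz_of_is_derive f f1 (L : R) : (forall y : R, is_derive y 1 f (f1 y)) ->
  (forall y, `|f1 y| <= L) -> forall a b, `|f a - f b| <= L * `|a - b|.
Proof.
move=> df fL.
have H a b : a < b -> `|f b - f a| <= L * `|b - a|.
  move=> ab; have [||c _ ->] := @MVT _ f f1 a b => //.
    by apply: continuous_subspaceT; exact: is_derive_continuous df.
  by rewrite normrM ler_wpM2r.
move=> a b; have [ab|ba|->] := ltgtP a b; last by rewrite !subrr normr0 mulr0.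
  by rewrite distrC (distrC a); exact: H.
exact: H.
Qed.

(** Bounded partial derivatives make [v] Lipschitz in each variable uniformly in the other, hence
    jointly continuous. *)
Lemma continuous_of_bounded_partials (v vx vt : R -> R -> R) (L : R) :
  (forall x t : R, is_derive x 1 (v^~ t) (vx x t)) ->
  (forall x t : R, is_derive t 1 (v x) (vt x t)) ->
  (forall x t, `|vx x t| <= L) -> (forall x t, `|vt x t| <= L) ->
  continuous (fun z : R * R => v z.1 z.2).
Proof.
move=> dvx dvt vxL vtL [x t]; apply/cvgrPdist_le => e e0 /=.
have L0 : 0 <= L by apply: le_trans (vxL 0 0).
have L1 : 0 < 2 * (L + 1) by clear -L0; lra.
have del0 : 0 < e / (2 * (L + 1)) by rewrite divr_gt0.
have near_x : \forall z \near (x, t), `|x - z.1| <= e / (2 * (L + 1)).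
  have cx : z.1 @[z --> (x, t)] --> x by exact: cvg_fst.
  by move/cvgrPdist_le : cx; apply.
have near_t : \forall z \near (x, t), `|t - z.2| <= e / (2 * (L + 1)).
  have ct : z.2 @[z --> (x, t)] --> t by exact: cvg_snd.
  by move/cvgrPdist_le : ct; apply.
near=> z.
have -> : v x t - v z.1 z.2 = (v x t - v z.1 t) + (v z.1 t - v z.1 z.2) by ring.
apply: le_trans (ler_normD _ _) _.
have h1 := lipschitz_of_is_derive (dvx^~ t) (vxL^~ t) x z.1.
have h2 := lipschitz_of_is_derive (dvt z.1) (vtL z.1) t z.2.
have h3 : `|x - z.1| <= e / (2 * (L + 1)) by near: z.
have h4 : `|t - z.2| <= e / (2 * (L + 1)) by near: z.
have h5 := ler_wpM2l L0 h3; have h6 := ler_wpM2l L0 h4.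
have h7 : (L + 1) * (e / (2 * (L + 1))) = e / 2.
  by field; rewrite gt_eqF//; clear -L0; lra.
move: h1 h2 h5 h6 h7 del0; clear; lra.
Unshelve. all: by end_near. Qed.

Lemma C21_conv K Y (d : R) f f1 f2 : measurable K ->
  (@leb2 R).-integrable K (EFin \o Y) -> mollifier d f f1 f2 ->
  C21 (conv K Y f f) (conv K Y f1 f) (conv K Y f2 f) (conv K Y f f1).
Proof.
move=> mK iY [_ df df1 [cf cf1 cf2] _ _ _ _ [B B0 fB]].
have [B1 B2 B3] : [/\ forall y, `|f y| <= B, forall y, `|f1 y| <= B &
  forall y, `|f2 y| <= B] by split=> y; have [] := fB y.
have d1 x t := @is_derive_conv_x K Y f f1 f B x t mK iY cf cf B1 B2 B1 df.
have d2 x t := @is_derive_conv_x K Y f1 f2 f B x t mK iY cf1 cf B2 B3 B1 df1.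
have d3 x t := @is_derive_conv_t K Y f f f1 B x t mK iY cf cf B1 B1 B2 df.
split; last by [].
apply: (continuous_of_bounded_partials d1 d3) => x t.
  exact: conv_bound mK iY cf1 cf B2 B1.
exact: conv_bound mK iY cf cf1 B1 B2.
Qed.

End Convolution.

(** * Mass of the kernel and uniform closeness of the mollification *)

Section KernelMass.
Variable R : realType.
Local Notation mu := (@lebesgue_measure R).
Local Notation T2 := (measurableTypeR R * measurableTypeR R)%type.
Implicit Types (f g : R -> R) (K : set T2).

Lemma integral_shift f (c : R) : continuous f -> (forall x, 0 <= f x) ->
  (\int[mu]_x (f x)%:E = \int[mu]_x (f (x - c))%:E)%E.
Proof.
move=> cf f0.
have dF (x : R) : is_derive x 1 (fun y : R => y - c) 1 by exact: is_derive_shift.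
have dF1 : (fun y : R => y - c)^`()%classic = cst 1.
  by apply/funext => x; rewrite derive1E derive_val.
rewrite (@increasing_ge0_integration_by_substitutionT _ (fun y => y - c)) ?dF1//.
- by apply: eq_integral => x _; rewrite /= fctE/= mulr1.
- by move=> x y xy; rewrite ltrD2r.
- by move=> x; exact: cvg_cst.
- exact: is_cvg_cst.
- exact: is_cvg_cst.
- exact: cvg_addrr_Ny.
- exact: cvg_addrr.
Qed.

Lemma mollifier_mass (d : R) f f1 f2 : 0 < d -> mollifier d f f1 f2 ->
  exists2 I : R, 0 < I & forall c,
    (\int[mu]_x (f (c - x))%:E = I%:E)%E.
Proof.
move=> d0 [_ _ _ [cf _ _] f0 fpos feven fs [B B0 fB]].
have mf : measurable_fun setT (EFin \o f).
  by apply/measurable_EFinP; exact: continuous_measurable_fun.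
have EI : (\int[mu]_x (f x)%:E = \int[mu]_(x in `[(- d)%R, d]) (f x)%:E)%E.
  rewrite [RHS]integral_mkcond; apply: eq_integral => x _.
  rewrite patchE; case: ifPn => //; rewrite notin_setE /= in_itv/=.
  by rewrite -ler_norml => /negP; rewrite -ltNge => /fs[->].
have Ifin : (\int[mu]_x (f x)%:E < +oo)%E.
  rewrite EI; apply: (@le_lt_trans _ _ (\int[mu]_(x in `[(- d)%R, d]) (cst B%:E x))%E).
    apply: ge0_le_integral => //.
    - by move=> x _; rewrite lee_fin.
    - exact: measurable_funTS.
    - by move=> x _; rewrite lee_fin (le_trans (ler_norm _))//; have [] := fB x.
  rewrite integral_cst//= lebesgue_measure_itv/= lte_fin gtrN//.
  by rewrite -EFinD -EFinM ltey.
have dd : - (d / 2) <= d / 2 by clear -d0; lra.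
have [||c cI cmin] := @EVT_min _ f (- (d / 2)) (d / 2) => //.
  exact: continuous_subspaceT.
have fc0 : 0 < f c.
  apply: fpos; move: cI; rewrite in_itv/= ltr_norml => /andP[h1 h2].
  by apply/andP; split; clear -h1 h2 d0; lra.
have Ipos : (0 < \int[mu]_x (f x)%:E)%E.
  apply: (@lt_le_trans _ _ (\int[mu]_(x in `[(- (d / 2))%R, (d / 2)%R]) (cst (f c)%:E x))%E).
    rewrite integral_cst//= lebesgue_measure_itv/= lte_fin ifT; last first.
      by clear -d0; lra.
    by rewrite -EFinD -EFinM lte_fin mulr_gt0//; clear -d0; lra.
  apply: (@le_trans _ _ (\int[mu]_(x in `[(- (d / 2))%R, (d / 2)%R]) (f x)%:E)%E).
    apply: ge0_le_integral => //.
    - by move=> x _; rewrite lee_fin ltW.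
    - exact: measurable_funTS.
  by apply: ge0_subset_integral => // x _; rewrite lee_fin.
have Ifn : (\int[mu]_x (f x)%:E)%E \is a fin_num.
  by rewrite ge0_fin_numE// ltW.
exists (fine (\int[mu]_x (f x)%:E)%E); first by rewrite fine_gt0// Ipos.
move=> c'; rewrite fineK// [RHS](integral_shift c' cf f0).
by apply: eq_integral => x _; rewrite -feven opprB.
Qed.

Lemma integral_prod_kernel f g (x t : R) : continuous f -> continuous g ->
  (forall y, 0 <= f y) -> (forall y, 0 <= g y) ->
  (\int[@leb2 R]_w (f (x - w.1) * g (t - w.2))%:E =
   \int[mu]_y (f (x - y))%:E * \int[mu]_y (g (t - y))%:E)%E.
Proof.
move=> cf cg f0 g0.
have ms (h : R -> R) (c : R) : continuous h ->
    measurable_fun (setT : set (measurableTypeR R))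
      (fun y : measurableTypeR R => (h (c - y))%:E).
  move=> ch; apply/measurable_EFinP.
  apply: (measurableT_comp (continuous_measurable_fun ch)).
  by apply: measurable_funB; [exact: measurable_cst|exact: measurable_id].
rewrite /leb2 fubini_tonelli1/=; last 2 first.
- by apply/measurable_EFinP; exact: measurable_kernel.
- by move=> w; rewrite lee_fin mulr_ge0.
rewrite /fubini_F/=.
under eq_integral => y _.
  under eq_integral do rewrite EFinM.
  rewrite ge0_integralZl//; [|exact: ms|by move=> z _; rewrite lee_fin|by rewrite lee_fin].
  over.
rewrite ge0_integralZr//; [exact: ms|by move=> z _; rewrite lee_fin|].
by apply: integral_ge0 => z _; rewrite lee_fin.
Qed.

(** Passes between the whole domain, on which weak derivatives are tested, and a compact [K], on
    which integrability is known. *)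
Lemma conv_restrict K (Y : T2 -> R) (Q : set T2) (h : T2 -> R) :
  K `<=` Q -> (forall w, ~ K w -> h w = 0) ->
  \int[@leb2 R]_(w in Q) (Y w * h w) = \int[@leb2 R]_(w in K) (Y w * h w).
Proof.
move=> KQ hK; rewrite Rintegral_mkcond [RHS]Rintegral_mkcond.
apply: eq_Rintegral => w _; rewrite !patchE.
case: ifPn => wQ; case: ifPn => wK //.
  by rewrite hK ?mulr0// => /mem_set; rewrite (negbTE wK).
by move: wQ; rewrite notin_setE; case; apply: KQ; rewrite inE in wK.
Qed.

Lemma conv_one (d : R) f f1 f2 : 0 < d -> mollifier d f f1 f2 ->
  exists2 N, 0 < N & forall K x t,
  (forall w, `|x - w.1| <= d -> `|t - w.2| <= d -> K w) ->
  conv K (cst 1) f f x t = N.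
Proof.
move=> d0 mf; have [I I0 HI] := mollifier_mass d0 mf.
case: mf => _ _ _ [cf _ _] f0 _ _ fs _.
exists (I * I); first exact: mulr_gt0.
move=> K x t HK; rewrite /conv.
rewrite -(@conv_restrict K (cst 1) setT (fun w => f (x - w.1) * f (t - w.2)))//.
  rewrite /Rintegral; under eq_integral do rewrite mul1r.
  by rewrite integral_prod_kernel// !HI.
move=> w nKw; apply: contrapT => fw; apply: nKw; apply: HK.
  by rewrite leNgt; apply/negP => /fs[E _ _]; apply: fw; rewrite E mul0r.
by rewrite leNgt; apply/negP => /fs[E _ _]; apply: fw; rewrite E mulr0.
Qed.

Lemma conv_close K (Y : T2 -> R) (d c : R) f f1 f2 (x t y : R) : measurable K ->
  (@leb2 R).-integrable K (EFin \o Y) -> (@leb2 R).-integrable K (EFin \o cst 1) ->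
  mollifier d f f1 f2 ->
  (forall w, K w -> `|x - w.1| <= d -> `|t - w.2| <= d -> `|Y w - y| <= c) ->
  `|conv K Y f f x t - y * conv K (cst 1) f f x t| <= c * conv K (cst 1) f f x t.
Proof.
move=> mK iY i1 [_ _ _ [cf _ _] f0 _ _ fs [B B0 fB]] HY.
have B1 z : `|f z| <= B by have [] := fB z.
have mk := @measurable_kernel _ f f x t cf cf.
have kB w : `|f (x - w.1) * f (t - w.2)| <= B * B.
  exact: (@kernel_bound _ f f B x t w).
have ik := integrable_mul_bounded mK iY mk kB.
have i1k := integrable_mul_bounded mK i1 mk kB.
have iak (a : R) : (@leb2 R).-integrable K
    (EFin \o (fun w => a * (cst 1 w * (f (x - w.1) * f (t - w.2))))).
  exact: (integrable_scale a mK i1k).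
have near w : K w -> (y - c) * (cst 1 w * (f (x - w.1) * f (t - w.2))) <=
    Y w * (f (x - w.1) * f (t - w.2)) <=
    (y + c) * (cst 1 w * (f (x - w.1) * f (t - w.2))).
  move=> Kw; rewrite /cst mul1r.
  have [xw|/fs[-> _ _]] := leP `|x - w.1| d; last by rewrite !(mul0r,mulr0) lexx.
  have [tw|/fs[-> _ _]] := leP `|t - w.2| d; last by rewrite !mulr0 lexx.
  have := HY w Kw xw tw; rewrite ler_norml => /andP[h1 h2].
  have kw : 0 <= f (x - w.1) * f (t - w.2) by rewrite mulr_ge0.
  by apply/andP; split; apply: ler_wpM2r => //; [clear -h1|clear -h2]; lra.
rewrite /conv ler_norml; apply/andP; split.
- rewrite lerBrDl addrC -mulNr -mulrDl addrC -RintegralZl//.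
  by apply: le_Rintegral => // w /near/andP[].
- rewrite lerBlDl -mulrDl -RintegralZl//.
  by apply: le_Rintegral => // w /near/andP[].
Qed.

End KernelMass.

(** * Mollification commutes with weak derivatives *)

Section WeakConvolution.
Variable R : realType.
Local Notation T2 := (measurableTypeR R * measurableTypeR R)%type.
Implicit Types (f g : R -> R) (K Q : set T2).

Lemma is_derive_reflect f f1 (x u : R) : (forall y : R, is_derive y 1 f (f1 y)) ->
  is_derive u 1 (fun v => f (x - v)) (- f1 (x - u)).
Proof.
move=> df; rewrite -mulrN1.
apply: (@is_derive1_comp _ f (fun v => x - v)) => //.
by rewrite -[X in is_derive _ _ _ X]add0r; exact: is_deriveB.
Qed.

Lemma smooth1_reflect n f (x : R) : smooth1 n f -> smooth1 n (fun v => f (x - v)).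
Proof.
move=> sf; rewrite (_ : (fun v => _) = (fun v => f ((-1) * v + x))).
  exact: smooth1_affine.
by apply/funext => v; rewrite mulN1r addrC.
Qed.

Lemma test_function_kernel Q (d d' x t : R) f f1 f2 e e1 e2 :
  mollifier d f f1 f2 -> mollifier d' e e1 e2 ->
  (forall w, `|x - w.1| <= d -> `|t - w.2| <= d' -> Q w) ->
  test_function Q (fun w : R * R => f (x - w.1) * e (t - w.2)).
Proof.
move=> [sf _ _ _ _ _ _ fs _] [se _ _ _ _ _ _ es _] HQ.
have notI (g : R -> R) (r c y : R) : (forall z, r < `|z| -> g z = 0) ->
    y \notin `[(c - r), (c + r)] -> g (c - y) = 0.
  move=> gs; rewrite in_itv/= => h; apply: gs.
  by rewrite ltNge; apply: contra h; rewrite distrC ler_distl.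
apply: (@test_function_prod _ _ (x - d) (x + d) (t - d') (t + d')
  (fun v => f (x - v)) (fun v => e (t - v))) => //.
- by move=> n; exact: smooth1_reflect.
- by move=> n; exact: smooth1_reflect.
- by move=> y; apply: notI => z /fs[].
- by move=> y; apply: notI => z /es[].
- move=> [w1 w2] /= [/=]; rewrite !in_itv/= => w1I w2I.
  by apply: HQ; rewrite /= distrC ler_distl.
Qed.

Lemma kernel_eq0 K (d d' x t : R) (f g : R -> R) :
  (forall y, d < `|y| -> f y = 0) -> (forall y, d' < `|y| -> g y = 0) ->
  (forall w, `|x - w.1| <= d -> `|t - w.2| <= d' -> K w) ->
  forall w, ~ K w -> f (x - w.1) * g (t - w.2) = 0.
Proof.
move=> f0 g0 HK w nKw; apply: contrapT => fw; apply: nKw; apply: HK.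
  by rewrite leNgt; apply/negP => /f0 E; apply: fw; rewrite E mul0r.
by rewrite leNgt; apply/negP => /g0 E; apply: fw; rewrite E mulr0.
Qed.

(** The kernel, as a function of [w], is a test function. Each derivative in [w] of the reflected
    factor produces a sign, which cancels the sign [(-1) ^ (i + j)] of the weak derivative. The
    three cases are the orders occurring in the operator. *)
Lemma weak_derivative_conv Q K (d d' x t : R) f f1 f2 e e1 e2 (Y G : T2 -> R) (i j : nat)
    (h g : R -> R) :
  mollifier d f f1 f2 -> mollifier d' e e1 e2 -> measurable K ->
  (@leb2 R).-integrable K (EFin \o Y) -> K `<=` Q ->
  (forall w, `|x - w.1| <= d -> `|t - w.2| <= d' -> K w) ->
  is_weak_derivative Q i j Y G ->
  [\/ [/\ i = 1%N, j = 0%N, h = f1 & g = e],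
      [/\ i = 2%N, j = 0%N, h = f2 & g = e] |
      [/\ i = 0%N, j = 1%N, h = f & g = e1]] ->
  conv K Y h g x t = conv K G f e x t.
Proof.
move=> mf me mK iY KQ HK [_ _ wd] cases.
have HQ w : `|x - w.1| <= d -> `|t - w.2| <= d' -> Q w.
  by move=> h1 h2; apply: KQ; exact: HK.
have tf := test_function_kernel mf me HQ; have {wd} := wd _ tf.
case: mf => _ df df1 [cf cf1 cf2] _ _ _ fs [B B0 fB].
case: me => _ de _ [ce ce1 _] _ _ _ es [B' B'0 eB].
have e0 y : d' < `|y| -> e y = 0 by move=> /es[].
have e10 y : d' < `|y| -> e1 y = 0 by move=> /es[].
have f0 y : d < `|y| -> f y = 0 by move=> /fs[].
have f10 y : d < `|y| -> f1 y = 0 by move=> /fs[].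
have f20 y : d < `|y| -> f2 y = 0 by move=> /fs[].
have dr (c y : R) : is_derive y 1 (fun v => f (c - v)) (- f1 (c - y)).
  exact: is_derive_reflect.
have dr1 (c y : R) : is_derive y 1 (fun v => - f1 (c - v)) (f2 (c - y)).
  by rewrite -[f2 _]opprK; apply: is_deriveN; exact: is_derive_reflect.
have fB0 y : `|f y| <= B by have [] := fB y.
have fB1 y : `|f1 y| <= B by have [] := fB y.
have der (c y : R) : is_derive y 1 (fun v => e (c - v)) (- e1 (c - y)).
  exact: is_derive_reflect.
have kB (a b : R -> R) (A A' : R) (w : T2) : (forall y, `|a y| <= A) -> (forall y, `|b y| <= A') ->
    `|a (x - w.1) * b (t - w.2)| <= A * A'.
  by move=> aA bA; rewrite normrM ler_pM.
rewrite /conv -(conv_restrict G KQ (kernel_eq0 f0 e0 HK)).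
case: cases => -[-> -> -> ->] /=.
- rewrite (pderx_prod (fun v => e (t - v)) (dr x)) expr1 => E.
  apply: (@mulrI _ (-1)); first by rewrite unitrN1.
  rewrite -E -RintegralZl//; last first.
    apply: integrable_mul_bounded => //; first exact: measurable_kernel.
    by move=> w; apply: (kB f1 e B B' w) => // y; have [] := eB y.
  rewrite (conv_restrict Y KQ (h := fun w => - f1 (x - w.1) * e (t - w.2))).
    by apply: eq_Rintegral => w _; ring.
  by move=> w nKw; rewrite mulNr (kernel_eq0 f10 e0 HK)// oppr0.
- rewrite (pderx_prod (fun v => e (t - v)) (dr x)).
  rewrite (pderx_prod (fun v => e (t - v)) (dr1 x)) expr2 mulrNN mulr1 mul1r.
  by move=> <-; rewrite -(conv_restrict Y KQ (kernel_eq0 f20 e0 HK)).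
- rewrite (pdert_prod (fun v => f (x - v)) (der t)) expr1 => E.
  apply: (@mulrI _ (-1)); first by rewrite unitrN1.
  rewrite -E -RintegralZl//; last first.
    apply: integrable_mul_bounded => //; first exact: measurable_kernel.
    by move=> w; apply: (kB f e1 B B' w) => // y; have [] := eB y.
  rewrite (conv_restrict Y KQ (h := fun w => f (x - w.1) * - e1 (t - w.2))).
    by apply: eq_Rintegral => w _; ring.
  by move=> w nKw; rewrite mulrN (kernel_eq0 f0 e10 HK)// oppr0.
Qed.
End WeakConvolution.

Lemma compact_unif_cont_rect (R : realType) (xa xb ta tb : R) (f : R * R -> R) :
  {within `[xa, xb] `*` `[ta, tb], continuous f} ->
  unif_cont_rect xa xb ta tb (fun x t => f (x, t)).
Proof.
move=> cf e e0; set K := `[xa, xb] `*` `[ta, tb].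
have e2 : 0 < e / 2 by rewrite divr_gt0.
pose P (d : R) (z : R * R) := K z -> forall w, K w ->
  `|z.1 - w.1| <= d -> `|z.2 - w.2| <= d -> `|f z - f w| <= e.
(* Compactness in near-covering form turns the local moduli around each point into one [d] valid on
   the whole rectangle. *)
have : \forall d \near 0^'+, K `<=` P d.
  apply: (compact_near_coveringP _).1; first exact: compact_rect.
  move=> z Kz.
  have fz := (subspace_continuousP _ f).1 cf z Kz.
  move/cvgrPdist_le : fz => /(_ _ e2).
  rewrite near_withinE => /nbhs_ballP[d0 /= d00 fd].
  have {}fd w : `|z.1 - w.1| < d0 -> `|z.2 - w.2| < d0 -> K w ->
    `|f z - f w| <= e / 2 by move=> h1 h2; apply: fd; split.
  have d02 : 0 < d0 / 2 by rewrite divr_gt0.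
  exists (ball z (d0 / 2), [set d : R | d < d0 / 2]).
    split => /=; first exact: nbhsx_ballx.
    exact: nbhs_right_lt.
  move=> [y d] /= [[/= y1 y2] dd0] Ky w Kw h1 h2.
  rewrite /ball/= in y1 y2.
  have -> : f y - f w = (f y - f z) + (f z - f w) by ring.
  have e_half : e = e / 2 + e / 2 by field.
  apply: le_trans (ler_normD _ _) _; rewrite [leRHS]e_half lerD//.
    rewrite distrC; apply: fd => //; [apply: lt_trans y1 _|apply: lt_trans y2 _];
      by clear -d00; lra.
  apply: fd => //.
    have := ler_distD y.1 z.1 w.1; move: y1 h1 dd0; clear; lra.
  have := ler_distD y.2 z.2 w.2; move: y2 h2 dd0; clear; lra.
move=> Kd; have [d /=[d0 Pd]] : exists d : R, 0 < d /\ K `<=` P d.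
  near (0 : R)^'+ => d; exists d; split; first by near: d; exact: nbhs_right_gt.
  by near: d.
exists d => // x x' t t' xI x'I tI t'I xx tt.
by apply: (Pd (x, t)) => //; split; rewrite /= in_itv.
Unshelve. all: by end_near. Qed.

(** * Strong solutions admit classical approximations *)

Section ApproxObstacle.
Variable R : realType.
Local Notation T2 := (measurableTypeR R * measurableTypeR R)%type.
Implicit Types (f g : R -> R) (K Q : set T2) (Y G H : T2 -> R).

Lemma ae_leb2_mono (P P' : T2 -> Prop) : (forall w, P w -> P' w) ->
  {ae @leb2 R, forall w, P w} -> {ae @leb2 R, forall w, P' w}.
Proof. by move=> PP'; apply: filterS. Qed.

Lemma integrable_kernel K Y f f1 f2 e e1 e2 (d d' x t : R) :
  mollifier d f f1 f2 -> mollifier d' e e1 e2 -> measurable K -> (@leb2 R).-integrable K (EFin \o Y) ->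
  (@leb2 R).-integrable K
    (EFin \o (fun w => Y w * (f (x - w.1) * e (t - w.2)))).
Proof.
move=> [_ _ _ [cf _ _] _ _ _ _ [B B0 fB]] [_ _ _ [ce _ _] _ _ _ _ [B' B'0 eB]].
move=> mK iY; apply: (integrable_mul_bounded (B := B * B')) => //.
  exact: measurable_kernel.
move=> w; rewrite normrM ler_pM//; first by have [] := fB (x - w.1).
by have [] := eB (t - w.2).
Qed.

Lemma conv_add K Y G f f1 f2 e e1 e2 (d d' x t a : R) :
  mollifier d f f1 f2 -> mollifier d' e e1 e2 -> measurable K ->
  (@leb2 R).-integrable K (EFin \o Y) -> (@leb2 R).-integrable K (EFin \o G) ->
  conv K (fun w => Y w + a * G w) f e x t =
  conv K Y f e x t + a * conv K G f e x t.
Proof.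
move=> mf me mK iY iG; rewrite /conv.
have ikY := integrable_kernel x t mf me mK iY.
have ikG := integrable_kernel x t mf me mK iG.
rewrite -RintegralZl// -RintegralD//; last exact: (integrable_scale a mK ikG).
by apply: eq_Rintegral => w _; ring.
Qed.

Lemma integrable_add K Y G (a : R) : measurable K ->
  (@leb2 R).-integrable K (EFin \o Y) -> (@leb2 R).-integrable K (EFin \o G) ->
  (@leb2 R).-integrable K (EFin \o (fun w => Y w + a * G w)).
Proof.
move=> mK iY iG; have iaG := integrable_scale a mK iG.
pose aG w := a * G w.
have -> : EFin \o (fun w => Y w + a * G w) =
  ((EFin \o Y) \+ (EFin \o aG))%E by apply/funext.
exact: integrableD.
Qed.

(** Equality is asked only on the support of the kernel, because away from contact the equation for
    the solution is known only locally. *)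
Lemma conv_ae_eq K H G f f1 f2 (d x t : R) : mollifier d f f1 f2 ->
  measurable K ->
  (@leb2 R).-integrable K (EFin \o H) -> (@leb2 R).-integrable K (EFin \o G) ->
  {ae @leb2 R, forall w, K w -> `|x - w.1| <= d -> `|t - w.2| <= d ->
     H w = G w} ->
  conv K H f f x t = conv K G f f x t.
Proof.
move=> mf mK iH iG HG; rewrite /conv /Rintegral; congr fine.
apply: ae_eq_integral => //.
- exact: measurable_int (integrable_kernel x t mf mf mK iH).
- exact: measurable_int (integrable_kernel x t mf mf mK iG).
apply: filterS HG => w HG Kw; congr (_%:E).
case: mf => _ _ _ _ _ _ _ fs _.
have [xw|/fs[-> _ _]] := leP `|x - w.1| d; last by rewrite !(mul0r,mulr0).
have [tw|/fs[-> _ _]] := leP `|t - w.2| d; last by rewrite !mulr0.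
by rewrite HG.
Qed.

Lemma conv_ae_ge0 K H f f1 f2 (d x t : R) : mollifier d f f1 f2 ->
  measurable K -> (@leb2 R).-integrable K (EFin \o H) ->
  {ae @leb2 R, forall w, K w -> 0 <= H w} -> 0 <= conv K H f f x t.
Proof.
move=> mf mK iH H0.
(* Passing to the absolute value turns an almost everywhere sign into a pointwise one. *)
rewrite (@conv_ae_eq K H (fun w => `|H w|) f f1 f2 d x t)//.
- apply: Rintegral_ge0 => w _; case: mf => _ _ _ _ f0 _ _ _ _.
  by rewrite !mulr_ge0.
- exact: integrable_norm.
- by apply: filterS H0 => w H0 Kw _ _; rewrite ger0_norm// H0.
Qed.

Lemma conv_ae_eq0 K H f f1 f2 (d x t : R) : mollifier d f f1 f2 ->
  measurable K -> (@leb2 R).-integrable K (EFin \o H) ->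
  {ae @leb2 R, forall w, K w -> `|x - w.1| <= d -> `|t - w.2| <= d ->
     H w = 0} -> conv K H f f x t = 0.
Proof.
move=> mf mK iH H0.
rewrite (@conv_ae_eq K H (fun=> 0) f f1 f2 d x t)//.
  rewrite /conv /Rintegral; under eq_integral do rewrite mul0r.
  by rewrite integral0.
exact: integrable0.
Qed.

Lemma measurable_rect (xa xb ta tb : R) :
  measurable (`[xa, xb] `*` `[ta, tb] : set T2).
Proof. by apply: measurableX; exact: measurable_itv. Qed.

Lemma integrable_one_rect (xa xb ta tb : R) :
  (@leb2 R).-integrable (`[xa, xb] `*` `[ta, tb] : set T2) (EFin \o cst 1).
Proof.
apply: measurable_bounded_integrable => //.
- exact: measurable_rect.
- suff : ((@lebesgue_measure R \x @lebesgue_measure R)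
    (`[xa, xb] `*` `[ta, tb]) < +oo)%E by [].
  rewrite product_measure1E//= !lebesgue_measure_itv/=.
  by case: ifP => _; case: ifP => _; rewrite -?EFinD -?EFinM ?mule0 ?mul0e ltey.
- by exists 1; split => // M M1 w _; rewrite /cst/= normr1 ltW.
Qed.

End ApproxObstacle.

Lemma C21_scale (R : realType) (a : R) (v vx vxx vt : R -> R -> R) :
  C21 v vx vxx vt -> C21 (fun x t => a * v x t) (fun x t => a * vx x t)
    (fun x t => a * vxx x t) (fun x t => a * vt x t).
Proof.
move=> [cv dv]; split; first by move=> z; apply: cvgMr; exact: cv.
by move=> x t; have [d1 d2 d3] := dv x t; split; exact: is_deriveZ.
Qed.

Lemma weak_derivativeP (R : realType) (Om : set (R * R)) i j (u : R * R -> R) :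
  has_weak_derivative Om i j u ->
  is_weak_derivative Om i j u (weak_derivative Om i j u).
Proof. by move=> [g ug]; exact: (@xgetPex _ (cst 0) [set g | is_weak_derivative Om i j u g] (ex_intro _ g ug)). Qed.

Lemma continuous_psi1 (R : realType) (K1 k1 K2 : R) : continuous (psi1 K1 k1 K2).
Proof.
move=> x; apply: cvgB; last exact: cvg_cst.
apply: cvgD; last exact: cvg_cst.
apply: (@continuous_max _ _ (fun x => expR x - K1) (cst 0)).
  by apply: cvgB; [exact: continuous_expR|exact: cvg_cst].
exact: cvg_cst.
Qed.

Lemma solution_unif_cont (R : realType) (k1 T : R) (Y : R * R -> R) (xa : R) :
  {within Qbar k1 T, continuous Y} ->
  unif_cont_rect xa (ln k1) 0 T (fun x t => Y (x, t)).
Proof.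
move=> cY; apply: compact_unif_cont_rect.
apply: continuous_subspaceW cY => -[x t] [/= xI tI]; split => //=.
by move: xI; rewrite !in_itv/= => /andP[].
Qed.

Lemma psi1_unif_cont (R : realType) (K1 k1 K2 xa xb ta tb : R) :
  unif_cont_rect xa xb ta tb (fun x (t : R) => psi1 K1 k1 K2 x).
Proof.
apply: (@compact_unif_cont_rect _ _ _ _ _ (fun z => psi1 K1 k1 K2 z.1)).
apply: continuous_subspaceT => z.
apply: (@cvg_comp _ _ _ fst (psi1 K1 k1 K2)); first exact: cvg_fst.
exact: continuous_psi1.
Qed.

Lemma exists_margin (R : realType) (s : seq R) : all (fun x => 0 < x) s ->
  exists2 d : R, 0 < d & all (fun x => d < x) s.
Proof.
elim: s => [_|x s IH /= /andP[x0 /IH[d d0 ds]]]; first by exists 1.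
exists (Num.min (x / 2) d); first by rewrite lt_min d0 divr_gt0.
rewrite gt_min ltr_pdivrMr// ltr_pMr// ltr1n/=.
by apply: sub_all ds => y dy; rewrite gt_min dy orbT.
Qed.

Lemma strong_solution_approx (R : realType) (K1 k1 K2 sigma r q T p : R)
    (Y : R * R -> R) :
  0 < T -> strong_solution K1 k1 K2 sigma r q T p Y ->
  approx_obstacle (sigma ^+ 2 / 2) (r - q - sigma ^+ 2 / 2) r (ln k1) T
    (psi1 K1 k1 K2) (fun x t => Y (x, t)).
Proof.
move=> T0 [[cY [w10 w20 w01] _] [obst sup eq _ _]].
move=> xa xb ta tb c /andP[xab xbl] /andP[ta0 tab] tbT c0.
have c4 : 0 < c / 4 by rewrite divr_gt0.
have [d1 d10 ucY] := @solution_unif_cont _ k1 T Y (xa - 1) cY _ c4.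
have [d2 d20 ucp] := @psi1_unif_cont _ K1 k1 K2 (xa - 1) (ln k1) 0 T _ c4.
(* The width is below the moduli [d1] of [Y] and [d2] of the obstacle for [c / 4]; below the
   distances of the rectangle to the sides, so that the enlarged [K] stays in the domain; and below
   1, the enlargement on which the moduli were taken. *)
have [|d d0 /= /and5P[dd1 dd2 dl dta /andP[dtb /andP[d1' _]]]] :=
  @exists_margin _ [:: d1; d2; ln k1 - xb; ta; T - tb; 1].
  by rewrite /= d10 d20 subr_gt0 xbl ta0 subr_gt0 tbT ltr01.
have [f [f1 [f2 mf]]] := mollifier_exists d0.
set K := `[xa - d, xb + d] `*` `[ta - d, tb + d].
have mK := @measurable_rect R (xa - d) (xb + d) (ta - d) (tb + d).
have cK := @compact_rect R (xa - d) (xb + d) (ta - d) (tb + d).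
have i1 := @integrable_one_rect R (xa - d) (xb + d) (ta - d) (tb + d).
rewrite -/K in mK cK i1.
have KQ : K `<=` Qint k1 T.
  move=> [w1 w2] [/=]; rewrite !in_itv/= => /andP[_ w1b] /andP[w2a w2b].
  by split; rewrite /= in_itv/=; [clear -w1b dl|clear -w2a w2b dta dtb]; lra.
have wDx := weak_derivativeP w10; have wDxx := weak_derivativeP w20.
have wDt := weak_derivativeP w01.
have iY : (@leb2 R).-integrable K (EFin \o Y) by case: wDx => /(_ K cK KQ).
have iDx : (@leb2 R).-integrable K (EFin \o Dx k1 T Y).
  by case: wDx => _ /(_ K cK KQ).
have iDxx : (@leb2 R).-integrable K (EFin \o Dxx k1 T Y).
  by case: wDxx => _ /(_ K cK KQ).
have iDt : (@leb2 R).-integrable K (EFin \o Dt k1 T Y).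
  by case: wDt => _ /(_ K cK KQ).
have [N N0 HN] := conv_one d0 mf.
have iN0 : 0 < N^-1 by rewrite invr_gt0.
set s2 := sigma ^+ 2 / 2; set b := r - q - s2.
exists (fun x t => N^-1 * conv K Y f f x t),
  (fun x t => N^-1 * conv K Y f1 f x t),
  (fun x t => N^-1 * conv K Y f2 f x t),
  (fun x t => N^-1 * conv K Y f f1 x t).
split; first by apply: C21_scale; exact: (C21_conv mK iY mf).
move=> x t xI tI.
have HK w : `|x - w.1| <= d -> `|t - w.2| <= d -> K w.
  rewrite !ler_norml => h1 h2; split; rewrite /= in_itv/=.
    by clear -h1 xI; lra.
  by clear -h2 tI; lra.
have E1 : conv K Y f1 f x t = conv K (Dx k1 T Y) f f x t.
  by apply: (weak_derivative_conv mf mf mK iY KQ HK wDx); constructor 1.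
have E2 : conv K Y f2 f x t = conv K (Dxx k1 T Y) f f x t.
  by apply: (weak_derivative_conv mf mf mK iY KQ HK wDxx); constructor 2.
have E3 : conv K Y f f1 x t = conv K (Dt k1 T Y) f f x t.
  by apply: (weak_derivative_conv mf mf mK iY KQ HK wDt); constructor 3.
pose H w := ((Dt k1 T Y w + - s2 * Dxx k1 T Y w) + - b * Dx k1 T Y w) + r * Y w.
have HE w : H w = Dt k1 T Y w - Lop k1 sigma r q T Y w.
  by rewrite /H /Lop -/s2 -/b; ring.
have iH2 := integrable_add (- s2) mK iDt iDxx.
have iH3 := integrable_add (- b) mK iH2 iDx.
have iH : (@leb2 R).-integrable K (EFin \o H) := integrable_add r mK iH3 iY.
have convH : conv K H f f x t = conv K (Dt k1 T Y) f f x t +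
    - s2 * conv K (Dxx k1 T Y) f f x t + - b * conv K (Dx k1 T Y) f f x t +
    r * conv K Y f f x t.
  rewrite /H (conv_add x t r mf mf mK iH3 iY) (conv_add x t (- b) mf mf mK iH2 iDx).
  by rewrite (conv_add x t (- s2) mf mf mK iDt iDxx).
have lin (A0 A1 A2 A3 B1 B2 B3 CH n : R) : A1 = B1 -> A2 = B2 -> A3 = B3 ->
    CH = B3 + - s2 * B2 + - b * B1 + r * A0 ->
    n * A3 - s2 * (n * A2) - b * (n * A1) + r * (n * A0) = n * CH.
  by move=> -> -> -> ->; ring.
have opE := lin _ _ _ _ _ _ _ _ N^-1 E1 E2 E3 convH.
have Kdom w : K w -> Qdom k1 T w.
  by move=> /KQ[h1 h2]; split => //; move: h2; rewrite /= !in_itv/= =>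
    /andP[-> /ltW].
have xtK : xa - 1 <= x <= ln k1 /\ 0 <= t <= T.
  by split; [clear -xI xbl|clear -tI ta0 tbT]; lra.
have wK w : K w -> xa - 1 <= w.1 <= ln k1 /\ 0 <= w.2 <= T.
  move=> [/=]; rewrite !in_itv/= => h1 h2.
  by split; [clear -h1 d1' dl|clear -h2 dta dtb]; lra.
split.
- have := @conv_close _ K Y d c f f1 f2 x t (Y (x, t)) mK iY i1 mf.
  rewrite HN// => hc.
  have {}hc : `|conv K Y f f x t - Y (x, t) * N| <= c * N.
    apply: hc => w Kw h1 h2; have [w1 w2] := wK w Kw.
    rewrite distrC; apply: le_trans (_ : c / 4 <= c); last by clear -c0; lra.
    rewrite (surjective_pairing w); apply: ucY => //.
    - exact: xtK.1.
    - exact: xtK.2.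
    - exact: le_trans h1 (ltW dd1).
    - exact: le_trans h2 (ltW dd1).
  have -> : N^-1 * conv K Y f f x t - Y (x, t) =
    N^-1 * (conv K Y f f x t - Y (x, t) * N) by field; rewrite gt_eqF.
  by rewrite normrM (gtr0_norm iN0) ler_pdivrMl// (mulrC N).
- rewrite opE mulr_ge0 ?(ltW iN0)//; apply: (conv_ae_ge0 _ _ mf mK iH).
  by apply: ae_leb2_mono sup => w sup /Kdom/sup; rewrite HE.
(* The margin [c] at [(x, t)] loses at most [c / 4] through [Y] and [c / 4] through the obstacle, so
   [Y > psi1] on the whole support of the kernel and the equation holds almost everywhere there. *)
- move=> psiY; rewrite opE (conv_ae_eq0 mf mK iH) ?mulr0//.
  apply: ae_leb2_mono eq => w eq Kw h1 h2; rewrite HE; apply: eq; first exact: Kdom.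
  have [w1 w2] := wK w Kw.
  have a1 : `|Y (x, t) - Y (w.1, w.2)| <= c / 4.
    apply: ucY => //; [exact: xtK.1|exact: xtK.2| |].
    - exact: le_trans h1 (ltW dd1).
    - exact: le_trans h2 (ltW dd1).
  have a2 : `|psi1 K1 k1 K2 x - psi1 K1 k1 K2 w.1| <= c / 4.
    apply: (ucp _ _ t w.2) => //; [exact: xtK.1|exact: xtK.2| |].
    - exact: le_trans h1 (ltW dd2).
    - exact: le_trans h2 (ltW dd2).
  rewrite -surjective_pairing in a1.
  move: a1 a2; rewrite !ler_norml => /andP[_ a1] /andP[a2 _].
  by clear -a1 a2 psiY c0; lra.
Qed.

(** * Convexity and slope of the obstacle in [s = expR x] *)

Section Psi1.
Variables (R : realType) (K1 k1 K2 : R).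
Hypotheses (K1k1 : K1 < k1) (k1K2 : k1 < K2).
Local Notation psi := (psi1 K1 k1 K2).

(** The maximum enters through its universal property, which leaves linear inequalities only. *)
Lemma psi1P x : exists2 m : R, psi x = m + (K2 - k1) &
  [/\ 0 <= m, expR x - K1 <= m &
      forall c, 0 <= c -> expR x - K1 <= c -> m <= c].
Proof.
exists (Num.max (expR x - K1) 0); first by rewrite /psi1 addrA.
split; [by rewrite le_max lexx orbT|by rewrite le_max lexx|].
by move=> c c0 xc; rewrite ge_max xc.
Qed.

Lemma psi1_ge0 x : 0 <= psi x.
Proof. by have [m -> [m0 _ _]] := psi1P x; move: m0 k1K2; lra. Qed.

Lemma psi1_le x : expR x <= k1 -> psi x <= K2 - K1.
Proof.
move=> xk; have [m -> [_ _ mmin]] := psi1P x.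
have : m <= k1 - K1 by apply: mmin; [move: K1k1|move: xk]; lra.
by lra.
Qed.

Lemma psi1_slope x : K2 - K1 - psi x <= k1 - expR x.
Proof. by have [m -> [_ m1 _]] := psi1P x; move: m1; lra. Qed.

Lemma psi1_right_end x : expR x = k1 -> psi x = K2 - K1.
Proof.
move=> xk; apply/le_anti; rewrite psi1_le ?xk//=.
by have := psi1_slope x; rewrite xk; lra.
Qed.

Lemma psi1_translated_comb (al be lam x : R) : 0 <= lam <= 1 ->
  lam * expR al + (1 - lam) * expR (- be) = 1 ->
  psi x <= lam * psi (x + al) + (1 - lam) * psi (x - be).
Proof.
move=> /andP[l0 l1] lE; have l1' : 0 <= 1 - lam by rewrite subr_ge0.
have xE : lam * expR (x + al) + (1 - lam) * expR (x - be) = expR x.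
  by rewrite !expRD !(mulrCA _ (expR x)) -mulrDr lE mulr1.
have [m -> [_ _ mmin]] := psi1P x.
have [ma -> [a0 a1 _]] := psi1P (x + al).
have [mb -> [b0 b1 _]] := psi1P (x - be).
suff : m <= lam * ma + (1 - lam) * mb by lra.
apply: mmin; first by rewrite addr_ge0// mulr_ge0.
have := ler_wpM2l l0 a1; have := ler_wpM2l l1' b1.
by rewrite -xE; lra.
Qed.

(** The obstacle is convex in [s] and takes the value [K2 - K1] at [s = k1]. After clearing the
    denominator, the cases are the two branches of the maximum at [x]. *)
Lemma psi1_chord_end x1 x : x1 <= x -> expR x < k1 ->
  0 <= chord_end (K2 - K1) k1 psi x1 x.
Proof.
move=> x1x xk; rewrite /chord_end.
have e1 : expR x1 <= expR x by rewrite ler_expR.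
have u0 : 0 < k1 - expR x by rewrite subr_gt0.
have v0 : 0 <= k1 - K1 by rewrite subr_ge0 ltW.
rewrite mulrA -(pmulr_lge0 _ u0) mulrDl divfK ?gt_eqF//.
have [m -> [_ _ mmin]] := psi1P x; have [m1 -> [m10 m1x _]] := psi1P x1.
have u1 : 0 <= k1 - expR x1 by move: e1 u0; lra.
have [h|h] := leP 0 (expR x - K1).
  have := ler_wpM2l u1 (mmin _ h (lexx _)); have := ler_wpM2r (ltW u0) m1x.
  by lra.
have := ler_wpM2l u1 (mmin _ (lexx 0) (ltW h)).
have := mulr_ge0 (ltW u0) m10.
have : 0 <= (k1 - K1) * (expR x - expR x1) by rewrite mulr_ge0// subr_ge0.
by lra.
Qed.

End Psi1.

(** * Convexity of the solution in [s] *)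

Lemma solution_translated_comb (R : realType) (K1 k1 K2 sigma r q T p : R)
    (Y : R * R -> R) :
  0 < K1 -> K1 < k1 -> k1 < K2 -> 0 < r -> 0 < T ->
  bounded_strong_solution K1 k1 K2 sigma r q T p Y ->
  r * (K1 + k1 - K2) <= q * k1 ->
  forall lam al be x t : R, 0 <= lam <= 1 -> 0 < al -> 0 < be ->
  lam * expR al + (1 - lam) * expR (- be) = 1 ->
  x <= ln k1 - al -> 0 <= t <= T ->
  Y (x, t) <= lam * Y (x + al, t) + (1 - lam) * Y (x - be, t).
Proof.
move=> K10 K1k1 k1K2 r0 T0 [sol bd] hqk1.
have app := strong_solution_approx T0 sol.
case: sol => [[cY _ _] [obst _ _ init bdry]].
have k10 : 0 < k1 by exact: lt_trans K1k1.
set l := ln k1 in app *.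
have lE : expR l = k1 by rewrite lnK.
have el x : x <= l -> expR x <= k1 by rewrite -ler_expR lE.
have C0 : 0 <= K2 - K1 by clear -K1k1 k1K2; lra.
have TT : 0 <= (0 : R) <= T by rewrite lexx ltW.
have Y0 x : x <= l -> Y (x, 0) = psi1 K1 k1 K2 x.
  rewrite le_eqVlt => /predU1P[->|]; last exact: init.
  by rewrite psi1_right_end// bdry.
(* The obstacle inequality is given for [x < l] and positive times; lateral and initial data extend
   it to the closure. *)
have psiY x t : x <= l -> 0 <= t <= T -> psi1 K1 k1 K2 x <= Y (x, t).
  move=> xl /andP[t0 tT].
  move: xl; rewrite le_eqVlt => /predU1P[->|xl].
    by rewrite psi1_right_end// bdry// t0.
  move: t0; rewrite le_eqVlt => /predU1P[<-|t0]; first by rewrite Y0// ltW.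
  by apply: (obst (x, t)); split; rewrite /= in_itv/= ?t0.
have [M YM] : exists M, forall x t : R, x <= l -> 0 <= t <= T -> `|Y (x, t)| <= M.
  case: bd => M0 [_ bd]; exists (`|M0| + 1 + (K2 - K1)) => x t xl /andP[t0 tT].
  have psiM : `|psi1 K1 k1 K2 x| <= K2 - K1.
    by rewrite ger0_norm ?psi1_ge0// psi1_le// el.
  move: xl; rewrite le_eqVlt => /predU1P[->|xl].
    rewrite bdry ?t0// ger0_norm//.
    by rewrite lerDr addr_ge0.
  move: t0; rewrite le_eqVlt => /predU1P[<-|t0].
    by rewrite (Y0 _ (ltW xl)) (le_trans psiM)// lerDr addr_ge0.
  apply: (@le_trans _ _ (`|M0| + 1)); last by rewrite lerDl.
  apply: bd; first by rewrite (le_lt_trans (ler_norm _))// ltrDl.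
  by split; rewrite /= in_itv/= ?t0.
have ucY xa := @solution_unif_cont _ k1 T Y xa cY.
have hk : r * expR l <= r * (K2 - K1) + q * expR l.
  by rewrite lE; clear -hqk1; lra.
have s20 : 0 <= sigma ^+ 2 / 2 by rewrite divr_ge0// sqr_ge0.
have chord x1 x t : x1 <= x -> x < l -> 0 < t < T ->
    0 <= chord_end (K2 - K1) (expR l) (fun x => Y (x, t)) x1 x.
  apply: (@chord_right_end _ (sigma ^+ 2 / 2) (r - q - sigma ^+ 2 / 2) r q l T
    (K2 - K1) M (psi1 K1 k1 K2) (fun x t => Y (x, t))) => //.
  - by move=> z zl; apply: psi1_le => //; exact: el.
  - by move=> z zl; rewrite lE psi1_slope.
  - move=> z1 z z1z zl; rewrite lE; apply: psi1_chord_end => //.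
    by rewrite -lE ltr_expR.
move=> lam al be x t lamI al0 be0 lamE xl.
have [dx dal dbe] : [/\ x <= l, x + al <= l & x - be <= l].
  by clear -xl al0 be0; clearbody l; split; lra.
have openT u : 0 < u < T ->
    Y (x, u) <= lam * Y (x + al, u) + (1 - lam) * Y (x - be, u).
  apply: (@translated_comb_ge0 _ (sigma ^+ 2 / 2) (r - q - sigma ^+ 2 / 2) l T
    (K2 - K1) M lam al be r (psi1 K1 k1 K2) (fun x t => Y (x, t))) => //.
  by move=> z zl; exact: psi1_translated_comb.
move=> /andP[t0 tT].
move: t0; rewrite le_eqVlt => /predU1P[<-|t0].
  by rewrite !Y0//; exact: psi1_translated_comb.
move: tT; rewrite le_eqVlt => /predU1P[->|tT]; last by apply: openT; rewrite t0.
rewrite leNgt; apply/negP => neg.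
(* Final time, by continuity: moving from [T] to [u] changes the difference by at most [2 * e], half
   of the assumed violation [4 * e]. *)
pose e := (Y (x, T) - (lam * Y (x + al, T) + (1 - lam) * Y (x - be, T))) / 4.
have e0 : 0 < e by rewrite divr_gt0// subr_gt0.
have [d d0 uc] := ucY (x - be) e e0.
pose u := Num.max (T / 2) (T - d).
have u0 : 0 < u by rewrite lt_max divr_gt0.
have uT : u < T by rewrite gt_max; apply/andP; split; clear -T0 d0; lra.
have ud : T - u <= d by rewrite lerBlDr -lerBlDl le_max lexx orbT.
have cl z : x - be <= z <= l -> `|Y (z, T) - Y (z, u)| <= e.
  move=> zI; apply: uc => //.
  - by rewrite lexx ltW.
  - by rewrite !ltW.
  - by rewrite subrr normr0 ltW.
  - by rewrite gtr0_norm ?subr_gt0.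
have := openT u; rewrite u0 uT => /(_ isT).
have /andP[lam0 lam1] := lamI.
have lam1' : 0 <= 1 - lam by rewrite subr_ge0.
have [xa xb xc] : [/\ x - be <= x, x - be <= x + al & x - be <= x - be].
  by clear -al0 be0; split; lra.
have := cl x; rewrite xa dx ler_norml => /(_ isT)/andP[_ h1].
have := cl (x + al); rewrite xb dal ler_norml => /(_ isT)/andP[h2 _].
have := cl (x - be); rewrite xc dbe ler_norml => /(_ isT)/andP[h3 _].
have := ler_wpM2l lam0 h2; have := ler_wpM2l lam1' h3; move: h1 e0.
rewrite /e; clear; lra.
Qed.

(** For [s = lam b + (1 - lam) a], the shifts [al = ln (b / s)] and [be = ln (s / a)] satisfy the
    weight relation, which reads [(lam b + (1 - lam) a) / s = 1]. *)
Lemma convex_function_ln (R : realType) (k1 : R) (y : R -> R) :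
  (forall lam al be x : R, 0 <= lam <= 1 -> 0 < al -> 0 < be ->
    lam * expR al + (1 - lam) * expR (- be) = 1 -> x <= ln k1 - al ->
    y x <= lam * y (x + al) + (1 - lam) * y (x - be)) ->
  convex_function `]0, k1[ (fun s : R => y (ln s)).
Proof.
move=> H.
have conv_lt (a b lam : R) : 0 < a -> a < b -> b < k1 -> 0 < lam < 1 ->
    y (ln (lam * b + (1 - lam) * a)) <= lam * y (ln b) + (1 - lam) * y (ln a).
  move=> a0 ab bk /andP[l0 l1]; set s := lam * b + (1 - lam) * a.
  have b0 : 0 < b by exact: lt_trans ab.
  have l1' : 0 < 1 - lam by rewrite subr_gt0.
  have as_ : a < s.
    have : 0 < lam * (b - a) by rewrite mulr_gt0// subr_gt0.
    by rewrite /s; clear; lra.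
  have sb : s < b.
    have : 0 < (1 - lam) * (b - a) by rewrite mulr_gt0// subr_gt0.
    by rewrite /s; clear; lra.
  have s0 : 0 < s by exact: lt_trans as_.
  have eb : ln s + (ln b - ln s) = ln b by ring.
  have ea : ln s - (ln s - ln a) = ln a by ring.
  have := H lam (ln b - ln s) (ln s - ln a) (ln s); rewrite eb ea; apply.
  - by rewrite !ltW.
  - by rewrite subr_gt0 ltr_ln.
  - by rewrite subr_gt0 ltr_ln.
  - rewrite opprB !expRB !lnK// !mulrA -mulrDl -/s divff// gt_eqF//.
  - have : ln b <= ln k1 by rewrite ler_ln ?posrE// ?ltW// (lt_trans b0).
    by clear; lra.
move=> t a b; rewrite !inE /= !in_itv/= => /andP[a0 ak] /andP[b0 bk].
have [->|t0] := eqVneq t 0%:i01; first by rewrite !conv0.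
have [->|t1] := eqVneq t 1%:i01; first by rewrite !conv1.
have t0' : 0 < t%:num by rewrite lt_neqAle eq_sym t0 ge0.
have t1' : t%:num < 1 by rewrite lt_neqAle t1 le1.
have {t0 t1} : 0 < t%:num < 1 by rewrite t0'.
change (0 < t%:num < 1 -> y (ln (t%:num * (a : R) + (1 - t%:num) * (b : R))) <=
  t%:num * y (ln a) + (1 - t%:num) * y (ln b)).
move: (t%:num) a b a0 ak b0 bk {t0' t1'} => lam a b a0 ak b0 bk lamI.
(* [conv_lt] puts its weight on the larger point, so for [a < b] it is applied with [1 - lam]. *)
have [ab|ba|->] := ltgtP a b.
- have := conv_lt a b (1 - lam) a0 ab bk.
  rewrite subr_gt0 (andP lamI).2 gtrBl (andP lamI).1 => /(_ isT).
  by rewrite !subKr addrC [leRHS]addrC.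
- exact: conv_lt.
- by rewrite -!mulrDl (_ : lam + (1 - lam) = 1) ?mul1r//; ring.
Qed.

(** * The almost everywhere inequality *)

Section Translation.
Variable R : realType.
Local Notation MR := (measurableTypeR R).
Local Notation T2 := (measurableTypeR R * measurableTypeR R)%type.
Local Notation mu := (@lebesgue_measure R).

Lemma measurable_add_cst (c : R) : measurable_fun (setT : set MR) (fun x : MR => (x + c : MR)).
Proof. by apply: measurable_funD; [exact: measurable_id|exact: measurable_cst]. Qed.

Lemma lebesgue_measure_shift (c : R) (A : set MR) : measurable A ->
  pushforward mu (fun x : MR => (x + c : MR)) A = mu A.
Proof.
move=> mA; apply/esym; pose mf := measurable_add_cst c.
apply: (lebesgue_measure_unique (mu := pushforward mu (fun x : MR => (x + c : MR)))) => //= _ [[a b]] _ <-.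
rewrite /pushforward.
have -> : (fun x : MR => (x + c : MR)) @^-1` `]a, b] = `]a - c, b - c]%classic.
  by apply/seteqP; split => x /=; rewrite !in_itv/= ltrBlDr lerBrDr.
rewrite !lebesgue_measure_itv/= !lte_fin ltrD2r; case: ifP => // _.
by rewrite -!EFinD; congr (_%:E); ring.
Qed.

Definition shift1 (c : R) (w : T2) : T2 := (w.1 + c, w.2).

Lemma measurable_shift1 c : measurable_fun setT (shift1 c).
Proof.
apply: measurable_fun_pair; last exact: measurable_snd.
by apply: measurable_funD; [exact: measurable_fst|exact: measurable_cst].
Qed.

Lemma leb2_shift (c : R) (A : set T2) : measurable A ->
  pushforward (@leb2 R) (shift1 c) A = @leb2 R A.
Proof.
move=> mA; apply/esym; pose mf := measurable_shift1 c.
apply: (product_measure_unique (m' := pushforward (@leb2 R) (shift1 c))) => //= A1 A2 mA1 mA2.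
rewrite /pushforward.
have -> : shift1 c @^-1` (A1 `*` A2) = ((fun x : MR => (x + c : MR)) @^-1` A1) `*` A2.
  by apply/seteqP; split => -[x y].
rewrite /leb2 product_measure1E//; last first.
  by rewrite -[X in measurable X]setTI; exact: measurable_add_cst.
by congr (_ * _)%E; exact: lebesgue_measure_shift.
Qed.

Lemma ge0_integral_leb2_shift (c : R) (h : T2 -> \bar R) :
  measurable_fun setT h -> (forall w, 0 <= h w)%E ->
  (\int[@leb2 R]_w h (shift1 c w) = \int[@leb2 R]_w h w)%E.
Proof.
move=> mh h0; pose mf := measurable_shift1 c.
have := @ge0_integral_pushforward _ _ _ _ R _ mf (@leb2 R) setT h measurableT mh.
rewrite preimage_setT => <-; last by move=> w _; exact: h0.
by apply: eq_measure_integral => A mA _; exact: leb2_shift.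
Qed.

Lemma integral_leb2_shift (c : R) (h : T2 -> R) : measurable_fun setT h ->
  \int[@leb2 R]_w h (shift1 c w) = \int[@leb2 R]_w h w.
Proof.
move=> mh; rewrite /Rintegral; congr fine.
have mE : measurable_fun setT (EFin \o h) by exact/measurable_EFinP.
rewrite [LHS](@integralE _ _ _ _ _ ((EFin \o h) \o shift1 c)).
rewrite [RHS]integralE; congr (_ - _)%E.
  under eq_integral do rewrite funepos_comp/=.
  apply: (ge0_integral_leb2_shift c (measurable_funepos mE)) => w.
  exact: funepos_ge0.
under eq_integral do rewrite funeneg_comp/=.
apply: (ge0_integral_leb2_shift c (measurable_funeneg mE)) => w.
exact: funeneg_ge0.
Qed.

Lemma integrable_leb2_shift (c : R) (h : T2 -> R) : measurable_fun setT h ->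
  (@leb2 R).-integrable setT (EFin \o h) ->
  (@leb2 R).-integrable setT (EFin \o (h \o shift1 c)).
Proof.
move=> mh /integrableP[_ hoo]; apply/integrableP; split.
  apply/measurable_EFinP; apply: measurableT_comp => //.
  exact: measurable_shift1.
have mah : measurable_fun setT (abse \o (EFin \o h)).
  by apply: measurableT_comp => //; exact/measurable_EFinP.
apply: le_lt_trans hoo.
by rewrite -(ge0_integral_leb2_shift c mah)// => w; exact: abse_ge0.
Qed.

End Translation.

(** * Convexity in [s] under mollification *)

Section ConvolutionConvexity.
Variable R : realType.
Local Notation T2 := (measurableTypeR R * measurableTypeR R)%type.
Implicit Types (K : set T2) (Y : T2 -> R) (f e : R -> R).

(** Extension by 0 gives integrals over the whole plane, where moving the evaluation point in [x]
    amounts to translating the function. *)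
Lemma conv_patch K Y f e (x t : R) :
  conv K Y f e x t = conv setT (Y \_ K) f e x t.
Proof.
rewrite /conv Rintegral_mkcond; apply: eq_Rintegral => w _.
by rewrite !patchE; case: ifPn => // _; rewrite mul0r.
Qed.

Lemma conv_shift Y f e (h x t : R) : measurable_fun setT Y ->
  continuous f -> continuous e ->
  conv setT Y f e (x + h) t = conv setT (Y \o @shift1 R h) f e x t.
Proof.
move=> mY cf ce; rewrite /conv.
rewrite -(integral_leb2_shift h); last first.
  by apply: measurable_funM => //; exact: measurable_kernel.
by apply: eq_Rintegral => w _; rewrite /shift1/= opprD addrACA subrr addr0.
Qed.

(** With [a = expR h] the pointwise inequality is the one for equal shifts [h], cleared of
    denominators. The two weights do not depend on the point, so it survives averaging against a
    nonnegative kernel. *)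
Lemma conv_translated_comb K Y f e (B x t h a : R) :
  measurable K -> (@leb2 R).-integrable K (EFin \o Y) ->
  continuous f -> continuous e -> 0 <= a ->
  (forall y, 0 <= f y <= B) -> (forall y, 0 <= e y <= B) ->
  (forall w, f (x - w.1) * e (t - w.2) != 0 ->
    [/\ K w, K (w.1 + h, w.2), K (w.1 - h, w.2) &
      (1 + a) * Y w <= Y (w.1 + h, w.2) + a * Y (w.1 - h, w.2)]) ->
  (1 + a) * conv K Y f e x t <= conv K Y f e (x + h) t + a * conv K Y f e (x - h) t.
Proof.
move=> mK iY cf ce a0 fB eB HK.
rewrite !(@conv_patch K Y); set Z := Y \_ K.
have iZ : (@leb2 R).-integrable setT (EFin \o Z).
  have -> : EFin \o Z = (EFin \o Y) \_ K by rewrite restrict_EFin.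
  exact: (integrable_mkcond _ mK).1.
have mZ : measurable_fun setT Z by apply/measurable_EFinP; exact: measurable_int iZ.
rewrite !conv_shift// /conv.
have mk : measurable_fun setT (fun w : T2 => f (x - w.1) * e (t - w.2)).
  exact: measurable_kernel.
have kB w : `|f (x - w.1) * e (t - w.2)| <= B * B.
  have /andP[f0 f1] := fB (x - w.1); have /andP[e0 e1] := eB (t - w.2).
  by rewrite ger0_norm ?mulr_ge0// ler_pM.
have ik (W : T2 -> R) : (@leb2 R).-integrable setT (EFin \o W) ->
  (@leb2 R).-integrable setT (EFin \o (fun w => W w * (f (x - w.1) * e (t - w.2)))).
  by move=> iW; apply: (integrable_mul_bounded measurableT iW mk kB).
have i0 := ik _ iZ.
have i1 := ik _ (integrable_leb2_shift h mZ iZ).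
have i2 := ik _ (integrable_leb2_shift (- h) mZ iZ).
have ia0 := integrable_scale (1 + a) measurableT i0.
have ia2 := integrable_scale a measurableT i2.
rewrite -!RintegralZl// -RintegralD//; apply: le_Rintegral => //.
  exact: (integrable_add a measurableT i1 i2).
move=> w _ /=.
have [k0|k0] := eqVneq (f (x - w.1) * e (t - w.2)) 0.
  by rewrite k0 !mulr0 addr0.
have [Kw Kp Km ineq] := HK w k0.
have kge : 0 <= f (x - w.1) * e (t - w.2).
  by rewrite mulr_ge0//; [have /andP[] := fB (x - w.1)|have /andP[] := eB (t - w.2)].
have ZE u : K u -> Z u = Y u by move=> Ku; rewrite /Z patchE mem_set.
rewrite /shift1 (ZE _ Kw) (ZE _ Kp) (ZE _ Km).
move: (f _ * e _) kge => k kge; rewrite !mulrA -mulrDl; exact: ler_wpM2r.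
Qed.

Lemma second_minus_first_ge0 (v v1 v2 : R -> R) (m x : R) : 0 < m ->
  (forall y : R, is_derive y 1 v (v1 y)) ->
  (forall y : R, is_derive y 1 v1 (v2 y)) ->
  (forall h, 0 < h < m ->
    (1 + expR h) * v x <= v (x + h) + expR h * v (x - h)) ->
  0 <= v2 x - v1 x.
Proof.
move=> m0 dv dv1 H.
pose psi h := v (x + h) + expR h * v (x - h) - (1 + expR h) * v x.
(* [psi] has a local minimum at 0, and its second derivative there is
   [2 (v2 x - v1 x)]. *)
pose dpsi h := v1 (x + h) + (expR h * v (x - h) + - (expR h * v1 (x - h))) - expR h * v x.
have psi0 h : - (m / 2) <= h <= m / 2 -> psi 0 <= psi h.
  move=> hI; have -> : psi 0 = 0 by rewrite /psi expR0 addr0 subr0; ring.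
  have [h0|h0|->] := ltgtP h 0; last by
    rewrite /psi expR0 addr0 subr0 le_eqVlt; apply/orP; left; apply/eqP; ring.
    (* Only positive [h] are given; the symmetry [psi h = expR h * psi (- h)] supplies the other
       side of 0. *)
    have := H (- h); rewrite opprK => /(_ ltac:(clear -h0 hI m0; lra)) Hh.
    have -> : psi h = expR h * (v (x - h) + expR (- h) * v (x + h) - (1 + expR (- h)) * v x).
      by rewrite /psi expRN; field; rewrite gt_eqF// expR_gt0.
    by rewrite mulr_ge0 ?expR_ge0// subr_ge0.
  by rewrite subr_ge0; apply: H; clear -h0 hI m0; lra.
have dp (g g1 : R -> R) (h : R) : (forall y : R, is_derive y 1 g (g1 y)) ->
    is_derive h 1 (fun u => g (x + u)) (g1 (x + h)).
  move=> dg; rewrite -[X in is_derive _ _ _ X]mulr1.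
  apply: (@is_derive1_comp _ g (fun u => x + u)) => //.
  by rewrite -[X in is_derive _ _ _ X]add0r; exact: is_deriveD.
have dm (g g1 : R -> R) (h : R) : (forall y : R, is_derive y 1 g (g1 y)) ->
    is_derive h 1 (fun u => expR u * g (x - u)) (expR h * g (x - h) + - (expR h * g1 (x - h))).
  move=> dg; have := is_derive_reflect x h dg => dr.
  rewrite [X in is_derive _ _ _ X](_ : _ = expR h *: - g1 (x - h) + g (x - h) *: expR h).
    exact: is_deriveM.
  by rewrite /GRing.scale/=; ring.
have [_] : dpsi 0 = 0 /\ 0 <= 2 * (v2 x - v1 x).
  apply: (@second_derivative_at_min _ psi dpsi (- (m / 2)) (m / 2) 0) => //.
  - by clear -m0; lra.
  - move=> h; rewrite /psi /dpsi.
    have := dp v v1 h dv; have := dm v v1 h dv => dmh dph.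
    have dc : is_derive h 1 (fun u => (1 + expR u) * v x) (expR h * v x).
      apply: is_derive_mulr_cst; rewrite -[X in is_derive _ _ _ X]add0r.
      exact: is_deriveD.
    by apply: is_deriveB; exact: is_deriveD.
  - have := dp v1 v2 0 dv1; have := dm v v1 0 dv; have := dm v1 v2 0 dv1.
    rewrite expR0 !mul1r subr0 addr0 => d3 d2 d1.
    have dc : is_derive (0 : R) 1 (fun u => expR u * v x) (expR 0 * v x).
      exact: is_derive_mulr_cst.
    rewrite expR0 mul1r in dc.
    rewrite [X in is_derive _ _ _ X](_ : _ =
      v2 x + ((v x + - v1 x) + - (v1 x + - v2 x)) - v x); last by ring.
    by apply: is_deriveB; apply: is_deriveD; apply: is_deriveD; exact: is_deriveN.
by rewrite pmulr_rge0.
Qed.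

End ConvolutionConvexity.

(** The widths [d] in [x] and [d'] in time are independent, because they are later sent to 0 one
    variable at a time. *)
Lemma solution_conv_ge0 (R : realType) (K1 k1 K2 sigma r q T p : R)
    (Y : R * R -> R) :
  0 < K1 -> K1 < k1 -> k1 < K2 -> 0 < r -> 0 < T ->
  bounded_strong_solution K1 k1 K2 sigma r q T p Y ->
  r * (K1 + k1 - K2) <= q * k1 ->
  forall xa xb ta tb d d' x t : R, forall f f1 f2 e e1 e2 : R -> R,
  xb < ln k1 -> 0 < ta -> tb < T ->
  xa < x - d -> x + d < xb -> ta <= t - d' -> t + d' <= tb ->
  mollifier d f f1 f2 -> mollifier d' e e1 e2 ->
  0 <= conv (`[xa, xb] `*` `[ta, tb]) (fun z => Dxx k1 T Y z - Dx k1 T Y z)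
    f e x t.
Proof.
move=> K10 K1k1 k1K2 r0 T0 sol hqk1 xa xb ta tb d d' x t f f1 f2 e e1 e2.
move=> xbl ta0 tbT xad xdb tad tdb mf me.
have tcomb := solution_translated_comb K10 K1k1 k1K2 r0 T0 sol hqk1.
case: (sol) => [[[_ [w10 w20 _] _] _] _].
set K := `[xa, xb] `*` `[ta, tb].
have mK := @measurable_rect R xa xb ta tb.
have cK := @compact_rect R xa xb ta tb.
rewrite -/K in mK cK.
have KQ : K `<=` Qint k1 T.
  move=> [w1 w2] [/=]; rewrite !in_itv/= => /andP[_ w1b] /andP[w2a w2b].
  split; rewrite /= in_itv/=; first exact: le_lt_trans xbl.
  by rewrite (lt_le_trans ta0)// (le_lt_trans w2b).
have wDx := weak_derivativeP w10; have wDxx := weak_derivativeP w20.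
have iY : (@leb2 R).-integrable K (EFin \o Y) by case: wDx => /(_ K cK KQ).
have iDx : (@leb2 R).-integrable K (EFin \o Dx k1 T Y).
  by case: wDx => _ /(_ K cK KQ).
have iDxx : (@leb2 R).-integrable K (EFin \o Dxx k1 T Y).
  by case: wDxx => _ /(_ K cK KQ).
have HK w : `|x - w.1| <= d -> `|t - w.2| <= d' -> K w.
  rewrite !ler_norml => h1 h2; split; rewrite /= in_itv/=.
    by clear -h1 xad xdb; lra.
  by clear -h2 tad tdb; lra.
have E1 : conv K Y f1 e x t = conv K (Dx k1 T Y) f e x t.
  by apply: (weak_derivative_conv mf me mK iY KQ HK wDx); constructor 1.
have E2 : conv K Y f2 e x t = conv K (Dxx k1 T Y) f e x t.
  by apply: (weak_derivative_conv mf me mK iY KQ HK wDxx); constructor 2.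
have -> : (fun z => Dxx k1 T Y z - Dx k1 T Y z) =
    (fun z => Dxx k1 T Y z + (-1) * Dx k1 T Y z).
  by apply/funext => z; rewrite mulN1r.
rewrite (conv_add x t (-1) mf me mK iDxx iDx) mulN1r -E1 -E2.
case: mf => _ df df1 [cf cf1 cf2] f0 _ _ fs [B B0 fB].
case: me => _ _ _ [ce _ _] e0 _ _ es [B' B'0 eB].
pose M := B + B'.
have [fM f1M f2M] : [/\ forall y, `|f y| <= M, forall y, `|f1 y| <= M &
    forall y, `|f2 y| <= M].
  by split=> y; have [h1 h2 h3] := fB y; rewrite ler_wpDr// ltW.
have eM y : `|e y| <= M by have [h1 _ _] := eB y; rewrite ler_wpDl// ltW.
have dv y := @is_derive_conv_x _ K Y f f1 e M y t mK iY cf ce fM f1M eM df.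
have dv1 y := @is_derive_conv_x _ K Y f1 f2 e M y t mK iY cf1 ce f1M f2M eM df1.
(* The distance from the support of the kernel to the vertical sides of [K]: shifts by [h < m] stay
   inside. *)
pose m := Num.min (x - d - xa) (xb - x - d).
have m0 : 0 < m by rewrite lt_min; apply/andP; split; [clear -xad|clear -xdb]; lra.
apply: (@second_minus_first_ge0 _ (fun y => conv K Y f e y t)
  (fun y => conv K Y f1 e y t) (fun y => conv K Y f2 e y t) m x m0 dv dv1).
move=> h /andP[h0]; rewrite lt_min => /andP[hm1 hm2].
apply: (@conv_translated_comb _ K Y f e M) => //.
- by move=> y; rewrite f0 (le_trans (ler_norm _)).
- by move=> y; rewrite e0 (le_trans (ler_norm _)).
move=> w kw.
have w1d : `|x - w.1| <= d.
  by rewrite leNgt; apply/negP => /fs[E _ _]; rewrite E mul0r eqxx in kw.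
have w2d : `|t - w.2| <= d'.
  by rewrite leNgt; apply/negP => /es[E _ _]; rewrite E mulr0 eqxx in kw.
have [/= w1K w2K] := HK w w1d w2d.
move: w1d; rewrite ler_norml => w1d.
have eh : 0 < expR h := expR_gt0 h.
have eh1 : 0 < 1 + expR h by rewrite addr_gt0.
split; first by [].
- by split; rewrite //= in_itv/=; clear -w1d hm2 h0 xad; lra.
- by split; rewrite //= in_itv/=; clear -w1d hm1 h0 xdb; lra.
(* For equal shifts [h] the weight relation forces [lam = 1 / (1 + expR h)]. *)
have := tcomb (1 + expR h)^-1 h h w.1 w.2.
have -> : 1 - (1 + expR h)^-1 = expR h / (1 + expR h).
  by field; rewrite gt_eqF.
rewrite -surjective_pairing => H.
have {}H : Y w <= (1 + expR h)^-1 * Y (w.1 + h, w.2) +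
    expR h / (1 + expR h) * Y (w.1 - h, w.2).
  apply: H => //.
  - by rewrite invr_ge0 ltW//= invf_le1// lerDl ltW.
  - by rewrite expRN; field; rewrite !gt_eqF.
  - by clear -w1d hm2 xbl; lra.
  - by move: w2K; rewrite in_itv/= => w2K; clear -w2K ta0 tbT; lra.
have -> : Y (w.1 + h, w.2) + expR h * Y (w.1 - h, w.2) =
    (1 + expR h) * ((1 + expR h)^-1 * Y (w.1 + h, w.2) +
    expR h / (1 + expR h) * Y (w.1 - h, w.2)).
  by field; rewrite gt_eqF.
by rewrite ler_wpM2l// ltW.
Qed.

(** * From the sign of mollifications to a sign almost everywhere, in one variable *)

Section MollifiedSign.
Variable R : realType.
Local Notation mu := (@lebesgue_measure R).
Local Notation MR := (measurableTypeR R).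

(** All widths come from one profile, so its bound and its positive minimum near the centre hold at
    every scale. *)
Lemma mollifier_scale (f f1 f2 : R -> R) (d : R) : mollifier 1 f f1 f2 -> 0 < d ->
  mollifier d (fun x => f (x / d)) (fun x => f1 (x / d) / d)
    (fun x => f2 (x / d) / d / d).
Proof.
move=> [sf df df1 [cf cf1 cf2] f0 fp fe fs [B B0 fB]] d0.
have dV : 0 < d^-1 by rewrite invr_gt0.
have cd : continuous (fun x : R => x / d) by move=> x; apply: cvgMl; exact: cvg_id.
have cc (g : R -> R) : continuous g -> continuous (fun x : R => g (x / d)).
  by move=> cg x; apply: (@continuous_comp _ _ _ (fun x : R => x / d) g); [exact: cd|exact: cg].
have ccM (g : R -> R) : continuous g -> continuous (fun x : R => g x / d).
  by move=> cg x; apply: cvgMl; exact: cg.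
have dd (g g1 : R -> R) : (forall x : R, is_derive x 1 g (g1 x)) ->
    forall x : R, is_derive x 1 (fun y => g (y / d)) (g1 (x / d) / d).
  move=> dg x; apply: (@is_derive1_comp _ g (fun y => y / d)) => //.
  by rewrite -[X in is_derive _ _ _ X]mul1r; apply: is_derive_mulr_cst.
have nd x : `|x / d| = `|x| / d by rewrite normrM (gtr0_norm dV).
split.
- move=> n; have := smooth1_affine d^-1 0 (sf n).
  by under eq_fun do rewrite addr0 mulrC.
- exact: dd.
- by move=> x; apply: is_derive_mulr_cst; exact: dd.
- by split; [exact: cc|exact: ccM (cc _ cf1)|exact: ccM (ccM _ (cc _ cf2))].
- by move=> x; exact: f0.
- by move=> x xd; apply: fp; rewrite nd ltr_pdivrMr// mul1r.
- by move=> x; rewrite mulNr fe.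
- move=> x dx; have /fs[-> -> ->] : 1 < `|x / d| by rewrite nd ltr_pdivlMr// mul1r.
  by rewrite !mul0r.
exists (B + B / d + B / d / d); first by rewrite !addr_gt0// !mulr_gt0.
move=> x; have [h h1 h2] := fB (x / d).
have B1 : 0 <= B / d by rewrite ltW// mulr_gt0.
have B2 : 0 <= B / d / d by rewrite mulr_ge0// ltW.
split.
- by rewrite -addrA ler_wpDr// addr_ge0.
- rewrite addrAC ler_wpDl ?(addr_ge0 (ltW B0) B2)//.
  by rewrite normrM (gtr0_norm dV) ler_wpM2r// ltW.
rewrite ler_wpDl ?(addr_ge0 (ltW B0) B1)//.
by rewrite !normrM (gtr0_norm dV) !ler_wpM2r// ltW.
Qed.

(** Split [h w] into [h w - h y] and [h y]. The first part is at most [B] times the deviation over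
    [ball y (2 * d)], which contains the support of the kernel. In the second, [h y <= 0] and the
    kernel is at least its minimum [f c0] over the central half wherever [w] is in [ball y (d / 4)],
    a ball of length [d / 2]. The centre [x] may differ from [y] so that it can later be
    rational. *)
Lemma mollified_le (f f1 f2 : R -> R) : mollifier 1 f f1 f2 ->
  exists B c : R, [/\ 0 < B, 0 < c &
    forall (h : MR -> R) (x y d e : R), mu.-integrable setT (EFin \o h) ->
      0 < d -> y <= x <= y + d / 4 -> h y <= 0 ->
      (davg h y (2 * d) <= e%:E)%E ->
      \int[mu]_w (h w * f ((x - w) / d)) <= d * (4 * B * e + h y * c)].
Proof.
move=> mf; case: (mf) => _ _ _ [cf _ _] f0 fp _ fs [B B0 fB].
have [||c0 c0I cmin] := @EVT_min R f (- 2^-1) 2^-1; first by lra.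
  exact: continuous_subspaceT.
have fc0 : 0 < f c0.
  by apply: fp; move: c0I; rewrite in_itv/= ltr_norml => c0I; clear -c0I; lra.
exists B, (f c0 / 2); split => //; first by rewrite divr_gt0.
move=> h x y d e ih d0 xy hy0 he.
set D : set MR := ball y (2 * d); set S : set MR := ball y (d / 4).
have d20 : 0 <= 2 * d by rewrite mulr_ge0// ltW.
have mD : measurable D := measurable_ball _ _.
have mS : measurable S := measurable_ball _ _.
have muD : mu D = (4 * d)%:E.
  by rewrite /D lebesgue_measure_ball//; congr (_%:E); ring.
have muS : mu S = (d / 2)%:E.
  by rewrite /S lebesgue_measure_ball ?divr_ge0// ?(ltW d0)//; congr (_%:E); field.
have SD : S `<=` D by apply: le_ball; lra.
have mh : measurable_fun setT h by apply/measurable_EFinP; exact: measurable_int ih.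
have ihD : mu.-integrable D (EFin \o h) by exact: integrableS ih.
have iD (a : R) : mu.-integrable D (EFin \o cst a).
  apply/integrableP; split; first by apply/measurable_EFinP; exact: measurable_cst.
  rewrite (eq_integral (cst `|a|%:E)) //.
  have E : (`|a|%:E * mu D < +oo)%E by rewrite muD -EFinM ltry.
  by rewrite (integral_cst mu mD); exact: E.
have iS : mu.-integrable D (EFin \o \1_S).
  have -> : EFin \o \1_S = EFin \o (fun w : MR => cst 1 w * \1_S w : R).
    by apply/funext => w; rewrite /= mul1r.
  apply: (integrable_mul_bounded (B := 1) mD (iD 1)).
    exact: measurable_indic.
  by move=> w; rewrite indicE; case: (_ \in _); rewrite ?normr1 ?normr0.
have mk : measurable_fun setT (fun w : MR => f ((x - w) / d)).
  apply: continuous_measurable_fun => w.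
  apply: (@continuous_comp _ _ _ (fun w : R => (x - w) / d) f); last exact: cf.
  by apply: cvgMl; apply: cvgB; [exact: cvg_cst|exact: cvg_id].
have kB w : `|f ((x - w) / d)| <= B by have [] := fB ((x - w) / d).
have ik : mu.-integrable D (EFin \o (fun w => h w * f ((x - w) / d))).
  by apply: (integrable_mul_bounded mD ihD mk kB).
have -> : \int[mu]_w (h w * f ((x - w) / d)) =
    \int[mu]_(w in D) (h w * f ((x - w) / d)).
  rewrite [RHS]Rintegral_mkcond; apply: eq_Rintegral => w _.
  rewrite patchE; case: ifPn => // /negP; rewrite inE => Dw.
  have /fs[-> _ _] : 1 < `|(x - w) / d|; last by rewrite mulr0.
  rewrite normrM normfV (gtr0_norm d0) ltr_pdivlMr// mul1r ltNge; apply/negP => xw.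
  apply: Dw; rewrite /D /ball/= ltr_norml; move: xw; rewrite ler_norml => xw.
  by clear -xw xy d0; lra.
have iabs : mu.-integrable D (EFin \o (fun w => B * `|h w - h y|)).
  apply: integrable_scale => //; apply: (@integrable_norm _ _ _ _ D (fun w => h w - h y)) => //.
  exact: (@integrableB _ _ _ _ _ mD (EFin \o h) (EFin \o cst (h y)) ihD (iD (h y))).
have iab : mu.-integrable D (EFin \o (fun w => `|h w - h y|)).
  apply: (@integrable_norm _ _ _ _ D (fun w => h w - h y)) => //.
  exact: (@integrableB _ _ _ _ _ mD (EFin \o h) (EFin \o cst (h y)) ihD (iD (h y))).
have iSc := integrable_scale (h y * f c0) mD iS.
apply: (@le_trans _ _ (\int[mu]_(w in D) (B * `|h w - h y| + h y * f c0 * \1_S w))).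
  apply: le_Rintegral => //.
    exact: (@integrableD _ _ _ _ _ mD (EFin \o (fun w => B * `|h w - h y|)) (EFin \o (fun w => h y * f c0 * \1_S w))).
  move=> w Dw.
  have H1 : (h w - h y) * f ((x - w) / d) <= B * `|h w - h y|.
    rewrite (le_trans (ler_norm _))// normrM mulrC ler_wpM2r//.
  suff : h y * f ((x - w) / d) <= h y * f c0 * \1_S w by move: H1; lra.
  rewrite -mulrA ler_wnM2l// indicE.
  case: (boolP (w \in S)) => [|_]; last by rewrite mulr0.
  rewrite inE /S /ball/= ltr_norml => wS; rewrite mulr1; apply: cmin.
  by rewrite in_itv/= ler_pdivlMr// ler_pdivrMr//; clear -wS xy d0; lra.
have ES : \int[mu]_(w in D) \1_S w = d / 2.
  rewrite /Rintegral integral_indic//.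
  have -> : S `&` D = S by apply/setIidPl.
  have E : fine (mu S) = d / 2 by rewrite muS.
  exact: E.
rewrite RintegralD// !RintegralZl// ES.
suff : \int[mu]_(w in D) `|h w - h y| <= 4 * d * e.
  rewrite -(ler_pM2l B0) => H.
  have -> : d * (4 * B * e + h y * (f c0 / 2)) = B * (4 * d * e) + h y * f c0 * (d / 2) by field.
  by rewrite lerD2r.
have d40 : 0 < 4 * d by rewrite mulr_gt0.
move: he; rewrite /davg /iavg -/D muD inver gt_eqF//.
have -> : (\int[mu]_(y0 in D) `|((center (h y) \o h) y0)%:E|)%E =
    (\int[mu]_(w in D) `|h w - h y|)%:E.
  by rewrite fineK//; exact: integrable_fin_num.
by rewrite -EFinM lee_fin ler_pdivrMl.
Qed.

(** Rational centres and widths [1 / (n + 1)] suffice, and they keep the family of conditions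
    countable, which matters when each of them holds only off its own null set. *)
Lemma mollified_ge0 (f f1 f2 : R -> R) (h : MR -> R) (a b : R) :
  mollifier 1 f f1 f2 -> mu.-integrable setT (EFin \o h) ->
  (forall (u : rat) n, a < ratr u - n.+1%:R^-1 -> ratr u + n.+1%:R^-1 < b ->
    0 <= \int[mu]_w (h w * f ((ratr u - w) / n.+1%:R^-1))) ->
  {ae mu, forall y, a < y < b -> 0 <= h y}.
Proof.
move=> /mollified_le[B [c [B0 c0 H]]] ih h0.
have /lebesgue_differentiation : locally_integrable setT h.
  by apply: open_integrable_locally => //; exact: openT.
apply: (@negligibleS _ _ _ mu) => y; apply: contra_not => ly /andP[ay yb].
rewrite leNgt; apply/negP => hy0.
(* Chosen so that [4 * B * e + h y * c = h y * c / 2], which is still negative. *)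
pose e := - h y * c / (8 * B).
have e0 : 0 < e by rewrite divr_gt0 ?mulr_gt0// oppr_gt0.
have [r /= r0 Hr] : \forall r \near 0^'+, (davg h y r < e%:E)%E.
  apply: (ly [set z | (z < e%:E)%E]); apply: open_nbhs_nbhs; split => /=.
    exact: open_ereal_lt_ereal.
  by rewrite lte_fin.
(* A width below [r / 4] puts [2 * d] in the range where the average deviation is small; the other
   two terms keep the kernel inside []a, b[]. *)
pose m := Num.min (r / 4) (Num.min ((y - a) / 4) ((b - y) / 4)).
have m0 : 0 < m by rewrite !lt_min !divr_gt0// subr_gt0.
have [n nm] : exists n : nat, n.+1%:R^-1 < m.
  exists (Num.truncn m^-1); rewrite invf_plt ?posrE//.
  exact: truncnS_gt.
set d : R := n.+1%:R^-1 in nm.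
have d0 : 0 < d by rewrite invr_gt0.
move: nm; rewrite !lt_min => /and3P[dr dya dby].
have [u] : exists u : rat, ratr u \in `]y, (y + d / 4)[.
  by apply: rat_in_itvoo; rewrite ltrDl divr_gt0.
rewrite in_itv/= => /andP[yu ud].
have := h0 u n; rewrite -/d => /(_ ltac:(clear -yu dya d0; lra) ltac:(clear -ud dby d0; lra)).
apply/negP; rewrite -ltNge.
apply: (le_lt_trans (H h (ratr u) y d e ih d0 _ (ltW hy0) _)).
- by rewrite (ltW yu) (ltW ud).
- apply/ltW/Hr => /=; last by clear -d0; lra.
  by rewrite sub0r normrN gtr0_norm; clear -d0 dr; lra.
rewrite pmulr_rlt0// /e.
have -> : 4 * B * (- h y * c / (8 * B)) + h y * c = h y * c / 2.
  by field; rewrite gt_eqF.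
by rewrite pmulr_llt0// nmulr_rlt0.
Qed.

End MollifiedSign.

(** * Reduction to slices by Fubini *)

Section SectionIntegral.
Context d1 d2 (T1 : measurableType d1) (T2 : measurableType d2) (R : realType).
Variables (m1 : {sigma_finite_measure set T1 -> \bar R})
  (m2 : {sigma_finite_measure set T2 -> \bar R}).
Implicit Types (g : T1 * T2 -> R).

Lemma integrable_Rsection g : (m1 \x m2)%E.-integrable setT (EFin \o g) ->
  m1.-integrable setT (EFin \o (fun x => \int[m2]_y g (x, y))).
Proof.
move=> ig; have iF := integrable_fubini_F ig.
have mF := measurable_int _ iF.
apply: (le_integrable _ _ _ iF) => //.
  apply/measurable_EFinP; apply: (@measurableT_comp _ _ _ _ _ _ fine) => //.
move=> x _ /=; rewrite /Rintegral /fubini_F.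
have -> : (\int[m2]_y (EFin \o g) (x, y))%E = (\int[m2]_y (g (x, y))%:E)%E by [].
by case: (\int[m2]_y _)%E => //= *; rewrite ?normr0 ?lee_fin// leey.
Qed.

Lemma Rintegral_prod_section g : (m1 \x m2)%E.-integrable setT (EFin \o g) ->
  \int[(m1 \x m2)%E]_w g w = \int[m1]_x \int[m2]_y g (x, y).
Proof.
move=> ig; rewrite /Rintegral -integral12_prod_meas1//; congr fine.
have iF := integrable_fubini_F ig.
apply: ae_eq_integral => //; [exact: measurable_int iF| |].
  exact: measurable_int (integrable_Rsection ig).
(* [fine] replaces an infinite inner integral by 0; almost every section is integrable, so this
   changes nothing. *)
have := ae_integrable1 ig; apply: filterS => x ix _.
by rewrite fineK//; exact: integrable_fin_num.
Qed.

(** Integrating out the second factor leaves a function of the first variable alone, to which the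
    one-variable sign criterion applies. *)
Lemma Rintegral_prod_kernel g (h1 : T1 -> R) (h2 : T2 -> R) (B1 B2 : R) :
  (m1 \x m2)%E.-integrable setT (EFin \o g) ->
  measurable_fun setT h1 -> measurable_fun setT h2 ->
  (forall x, `|h1 x| <= B1) -> (forall y, `|h2 y| <= B2) ->
  m1.-integrable setT (EFin \o (fun x => \int[m2]_y (g (x, y) * h2 y))) /\
  \int[(m1 \x m2)%E]_w (g w * (h1 w.1 * h2 w.2)) =
    \int[m1]_x ((\int[m2]_y (g (x, y) * h2 y)) * h1 x).
Proof.
move=> ig mh1 mh2 hB1 hB2.
have mh2' : measurable_fun setT (fun w : T1 * T2 => h2 w.2).
  by apply: measurableT_comp => //; exact: measurable_snd.
have mh1' : measurable_fun setT (fun w : T1 * T2 => h1 w.1).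
  by apply: measurableT_comp => //; exact: measurable_fst.
have ig2 : (m1 \x m2)%E.-integrable setT (EFin \o (fun w => g w * h2 w.2)).
  exact: (integrable_mul_bounded measurableT ig mh2' (fun w => hB2 w.2)).
have ig12 : (m1 \x m2)%E.-integrable setT
    (EFin \o (fun w => g w * (h1 w.1 * h2 w.2))).
  apply: (integrable_mul_bounded (B := B1 * B2) measurableT ig).
    exact: measurable_funM.
  by move=> w; rewrite normrM ler_pM.
have i2 := integrable_Rsection ig2.
split => //; rewrite Rintegral_prod_section//; congr fine.
apply: ae_eq_integral => //.
- exact: measurable_int (integrable_Rsection ig12).
- exact: measurable_int (integrable_mul_bounded measurableT i2 mh1 hB1).
have := ae_integrable1 ig2; apply: filterS => x ix _ /=; congr EFin.
rewrite -RintegralZr//; apply: eq_Rintegral => y _ /=; ring.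
Qed.

End SectionIntegral.

Section Slices.
Variable R : realType.
Local Notation mu := (@lebesgue_measure R).
Local Notation T2 := (measurableTypeR R * measurableTypeR R)%type.

Lemma ae_leb2_sections (P : T2 -> Prop) : measurable [set w | P w] ->
  {ae mu, forall x, {ae mu, forall y, P (x, y)}} -> {ae @leb2 R, forall w, P w}.
Proof.
move=> mP aeP; set N := ~` [set w | P w].
have mN : measurable N by exact: measurableC.
apply/negligibleP => //; rewrite /leb2/= /product_measure1.
have -> : (0 = \int[mu]_x cst 0 x)%E by rewrite integral0.
apply: ae_eq_integral => //; first exact: measurable_fun_xsection.
move: aeP; apply: (@negligibleS _ _ _ mu) => x; apply: contra_not => H _ /=.
apply/negligibleP; first exact: measurable_xsection.
by move: H; apply: (@negligibleS _ _ _ mu) => y; rewrite /xsection/= inE.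
Qed.

(** The one-variable criterion is used twice: in [x] for each fixed kernel in time, then in time on
    almost every slice. The null sets of the first stage are countably many because the time kernels
    are. *)
Lemma mollified_prod_ge0 (f f1 f2 : R -> R) (g : T2 -> R) (xa xb ta tb : R) :
  mollifier 1 f f1 f2 -> (@leb2 R).-integrable setT (EFin \o g) ->
  (forall (u v : rat) m n, xa < ratr u - m.+1%:R^-1 -> ratr u + m.+1%:R^-1 < xb ->
    ta < ratr v - n.+1%:R^-1 -> ratr v + n.+1%:R^-1 < tb ->
    0 <= conv setT g (fun x => f (x / m.+1%:R^-1)) (fun t => f (t / n.+1%:R^-1))
      (ratr u) (ratr v)) ->
  {ae @leb2 R, forall w, xa < w.1 < xb -> ta < w.2 < tb -> 0 <= g w}.
Proof.
move=> mf ig H.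
have mg : measurable_fun setT g by apply/measurable_EFinP; exact: measurable_int ig.
have [B _ fB] := moll_bound mf; have [cf _ _] := moll_cont mf.
pose k (u : rat) n (w : measurableTypeR R) : R := f ((ratr u - w) / n.+1%:R^-1).
have mk u n : measurable_fun setT (k u n).
  apply: continuous_measurable_fun => w.
  apply: (@continuous_comp _ _ _ (fun w : R => (ratr u - w) / n.+1%:R^-1) f); last exact: cf.
  by apply: cvgMl; apply: cvgB; [exact: cvg_cst|exact: cvg_id].
have kB u n w : `|k u n w| <= B by have [] := fB ((ratr u - w) / n.+1%:R^-1).
have S1 v n : ta < ratr v - n.+1%:R^-1 -> ratr v + n.+1%:R^-1 < tb ->
    {ae mu, forall x, xa < x < xb -> 0 <= \int[mu]_y (g (x, y) * k v n y)}.
  move=> tav vtb.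
  have [i2 _] := Rintegral_prod_kernel ig (mk 0 0%N) (mk v n) (kB 0 0%N) (kB v n).
  apply: (mollified_ge0 mf i2) => u m xau uxb.
  have [_ <-] := Rintegral_prod_kernel ig (mk u m) (mk v n) (kB u m) (kB v n).
  exact: H.
(* The pairs [(v, n)] are enumerated by [unpickle], so one null set serves them all. *)
have S2 : {ae mu, forall x, forall i : nat, forall v n, unpickle i = Some (v, n) ->
    ta < ratr v - n.+1%:R^-1 -> ratr v + n.+1%:R^-1 < tb ->
    xa < x < xb -> 0 <= \int[mu]_y (g (x, y) * k v n y)}.
  apply: ae_foralln => i.
  case: (unpickle i) => [[v n]|]; last exact: aeW.
  have [h|h] := boolP ((ta < ratr v - n.+1%:R^-1) && (ratr v + n.+1%:R^-1 < tb)).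
    have /andP[h1 h2] := h; move: (S1 v n h1 h2).
    by apply: (@negligibleS _ _ _ mu) => x; apply: contra_not => Hx _ _ [<- <-] _ _.
  by apply: aeW => x _ _ [<- <-] h1 h2; rewrite h1 h2 in h.
apply: ae_leb2_sections.
  rewrite (_ : mkset _ = ~` (`]xa, xb[ `*` `]ta, tb[) `|` (g @^-1` `[0, +oo[)).
    apply: measurableU; last by rewrite -[X in measurable X]setTI; exact: mg.
    by apply: measurableC; apply: measurableX; exact: measurable_itv.
  apply/seteqP; split => -[x y] /=; rewrite !in_itv/= andbT.
    by move=> h; have [[? ?]|?] := pselect (xa < x < xb /\ ta < y < tb);
      [right; exact: h|left].
  by case=> [nI h1 h2|//]; case: nI.
have S3 := ae_integrable1 ig.
have := negligibleU S2 S3; apply: (@negligibleS _ _ _ mu) => x.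
apply: contra_notP => /not_orP[/contrapT Hx /contrapT ix].
have [xI|xI] := boolP (xa < x < xb); last first.
  by apply: aeW => y /= h; rewrite h in xI.
have := mollified_ge0 mf ix (a := ta) (b := tb).
move=> /(_ (fun v n h1 h2 => Hx (pickle (v, n)) v n (pickleK _) h1 h2 xI)).
by apply: (@negligibleS _ _ _ mu) => y; apply: contra_not => + _.
Qed.

End Slices.

Lemma solution_ae_rect (R : realType) (K1 k1 K2 sigma r q T p : R)
    (Y : R * R -> R) (xa xb ta tb : R) :
  0 < K1 -> K1 < k1 -> k1 < K2 -> 0 < r -> 0 < T ->
  bounded_strong_solution K1 k1 K2 sigma r q T p Y ->
  r * (K1 + k1 - K2) <= q * k1 ->
  xb < ln k1 -> 0 < ta -> tb < T ->
  {ae @leb2 R, forall z, xa < z.1 < xb -> ta < z.2 < tb ->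
    0 <= Dxx k1 T Y z - Dx k1 T Y z}.
Proof.
move=> K10 K1k1 k1K2 r0 T0 sol hqk1 xbl ta0 tbT.
have [f [f1 [f2 mf]]] := mollifier_exists (@ltr01 R).
case: (sol) => [[[_ [w10 w20 _] _] _] _].
pose K := `[xa, xb] `*` `[ta, tb].
have mK : measurable (K : set (measurableTypeR R * measurableTypeR R)).
  exact: measurable_rect.
have cK : compact K by exact: compact_rect.
have KQ : K `<=` Qint k1 T.
  move=> [w1 w2] [/=]; rewrite !in_itv/= => /andP[_ w1b] /andP[w2a w2b].
  split; rewrite /= in_itv/=; first exact: le_lt_trans xbl.
  by rewrite (lt_le_trans ta0)// (le_lt_trans w2b).
have iDx : (@leb2 R).-integrable K (EFin \o Dx k1 T Y).
  by case: (weak_derivativeP w10) => _ /(_ K cK KQ).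
have iDxx : (@leb2 R).-integrable K (EFin \o Dxx k1 T Y).
  by case: (weak_derivativeP w20) => _ /(_ K cK KQ).
pose D z := Dxx k1 T Y z - Dx k1 T Y z.
have iD : (@leb2 R).-integrable setT (EFin \o (D \_ K)).
  rewrite -restrict_EFin; apply: (integrable_mkcond _ mK).1.
  exact: (integrableB mK iDxx iDx).
have n0 n : 0 < n.+1%:R^-1 :> R by rewrite invr_gt0.
have : {ae @leb2 R, forall w, xa < w.1 < xb -> ta < w.2 < tb -> 0 <= (D \_ K) w}.
  apply: (mollified_prod_ge0 mf iD) => u v m n hu1 hu2 hv1 hv2.
  have mfm := mollifier_scale mf (n0 m); have mfn := mollifier_scale mf (n0 n).
  rewrite -conv_patch.
  exact: (solution_conv_ge0 K10 K1k1 k1K2 r0 T0 sol hqk1 xbl ta0 tbT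
    hu1 hu2 (ltW hv1) (ltW hv2) mfm mfn).
apply: ae_leb2_mono => w H w1I w2I; move: (H w1I w2I).
rewrite patchE mem_set//; move: w1I w2I => /andP[? ?] /andP[? ?].
by split; rewrite /= in_itv/= !ltW.
Qed.

(** Countably many open rectangles exhaust the interior; the remaining top line [tau = T] is a null
    set. *)
Lemma solution_ae_second_minus_first (R : realType)
    (K1 k1 K2 sigma r q T p : R) (Y : R * R -> R) :
  0 < K1 -> K1 < k1 -> k1 < K2 -> 0 < r -> 0 < T ->
  bounded_strong_solution K1 k1 K2 sigma r q T p Y ->
  r * (K1 + k1 - K2) <= q * k1 ->
  {ae @leb2 R, forall z, Qdom k1 T z -> 0 <= Dxx k1 T Y z - Dx k1 T Y z}.
Proof.
move=> K10 K1k1 k1K2 r0 T0 sol hqk1.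
have n0 n : 0 < n.+1%:R^-1 :> R by rewrite invr_gt0.
have aeR : {ae @leb2 R, forall z, forall n : nat,
    ln k1 - n.+1%:R < z.1 < ln k1 - n.+1%:R^-1 ->
    n.+1%:R^-1 < z.2 < T - n.+1%:R^-1 -> 0 <= Dxx k1 T Y z - Dx k1 T Y z}.
  apply: ae_foralln => n.
  apply: (solution_ae_rect _ K10 K1k1 k1K2 r0 T0 sol hqk1) => //.
    by rewrite gtrBl.
  by rewrite gtrBl.
have aeT : {ae @leb2 R, forall z, z.2 != T}.
  exists (setT `*` [set T]); split.
  - exact: measurableX.
  - have T0' : (@lebesgue_measure R setT * @lebesgue_measure R [set T] = 0)%E.
      by rewrite lebesgue_measure_set1 mule0.
    by rewrite /leb2 product_measure1E//; exact: T0'.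
  - by move=> [x t] /= /negP; rewrite negbK => /eqP ->.
have := negligibleU aeR aeT; apply: negligibleS => z.
apply: contra_notP => /not_orP[/contrapT/= H /contrapT/= zT].
move=> [/=]; rewrite !in_itv/= => z1 /andP[z20]; rewrite le_eqVlt (negPf zT)/= => z2T.
(* The four positive summands are the lower bounds that the four sides of the rectangle impose on
   [n + 1]; any number above their sum meets all of them. *)
pose M := (ln k1 - z.1) + (ln k1 - z.1)^-1 + z.2^-1 + (T - z.2)^-1.
have a0 : 0 < ln k1 - z.1 by rewrite subr_gt0.
have b0 : 0 < T - z.2 by rewrite subr_gt0.
have aV : 0 < (ln k1 - z.1)^-1 by rewrite invr_gt0.
have bV : 0 < (T - z.2)^-1 by rewrite invr_gt0.
have zV : 0 < z.2^-1 by rewrite invr_gt0.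
have := truncnS_gt M; set n := Num.truncn M => nM.
have inv (c : R) : 0 < c -> c^-1 < n.+1%:R -> n.+1%:R^-1 < c.
  by move=> c0 cn; rewrite invf_plt ?posrE.
have h1 := inv _ a0 ltac:(clear -nM aV bV zV a0; rewrite /M in nM; lra).
have h2 := inv _ b0 ltac:(clear -nM aV bV zV a0; rewrite /M in nM; lra).
have h3 := inv _ z20 ltac:(clear -nM aV bV zV a0; rewrite /M in nM; lra).
apply: (H n); apply/andP; split; rewrite /M in nM.
- by clear -nM aV bV zV; lra.
- by rewrite ltrBrDr addrC -ltrBrDr.
- exact: h3.
- by rewrite ltrBrDr addrC -ltrBrDr.
Qed.

Unset Implicit Arguments.

Theorem lemma4p12 (R : realType) (K1 k1 k2 K2 sigma r q T : R)
    (hK1 : 0 < K1) (hK1k1 : K1 < k1) (hk1k2 : k1 < k2) (hk2K2 : k2 < K2)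
    (hsigma : 0 < sigma) (hr : 0 < r) (hq : 0 <= q) (hT : 0 < T)
    (p : R) (hp : 1 < p) (Y : R * R -> R)
    (hY : bounded_strong_solution K1 k1 K2 sigma r q T p Y)
    (hqk1 : r * (K1 + k1 - K2) <= q * k1) :
  (forall tau : R, 0 <= tau <= T ->
     convex_function `]0, k1[ (fun s : R => Y (ln s, tau))) /\
  {ae @leb2 R, forall z, Qdom k1 T z -> 0 <= Dxx k1 T Y z - Dx k1 T Y z}.
Proof.
have hk1K2 : k1 < K2 := lt_trans hk1k2 hk2K2.
split; last first.
  exact: (solution_ae_second_minus_first hK1 hK1k1 hk1K2 hr hT hY hqk1).
move=> tau htau.
apply: (@convex_function_ln _ _ (fun x => Y (x, tau))) => lam al be x hlam hal hbe hE hx.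
exact: (solution_translated_comb hK1 hK1k1 hk1K2 hr hT hY hqk1).
Qed.
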